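(* Let $T$ be a Hopf monad on an autonomous category $\mathcal{C}$ and $Q$ a comonoidal endofunctor of $T\text{-}\mathcal{C}$ such that $Q\rtimes T$ is centralizable, with centralizer $(Z_{Q\rtimes T},\partial)$. Let $D_{Q,T}=Z_{Q\rtimes T}\circ_\Omega T$ be the double of the pair $(Q,T)$, where $\Omega$ is the canonical distributive law of $(Q,T)$. Let $\eta$ and $u$ be the units of $T$ and $Z_{Q\rtimes T}$. Let $\mathcal{U}\colon\mathcal{Z}_Q(T\text{-}\mathcal{C})\to\mathcal{C}$ be the forgetful functor $\mathcal{U}((M,r),\sigma)=M$, $\mathcal{U}(f)=f$, and let $I\colon D_{Q,T}\text{-}\mathcal{C}\to\mathcal{Z}_Q(T\text{-}\mathcal{C})$ be the functor defined by $$I(M,r)=\bigl((M,r\,u_{T(M)}),\sigma\bigr),\quad I(f)=f,\quad\text{where}\quad \sigma_{(N,s)}=\bigl(U_TQ(s)\otimes r\,Z_{Q\rtimes T}(\eta_M)\bigr)\partial_{M,N}.$$ Then $I$ is an isomorphism of categories such that $\mathcal{U}I=U_{D_{Q,T}}$. Furthermore, if $Q$ is a bimonad (so that $D_{Q,T}$ is a bimonad and $\mathcal{Z}_Q(T\text{-}\mathcal{C})$ is monoidal), then the functor $I$ is strict monoidal (and so $\mathcal{U}I=U_{D_{Q,T}}$ as monoidal functors).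
   Context: Categories are small and monoidal categories are strict, with product $\otimes$ and unit $\mathbf 1$. A monoidal category is autonomous if every object $X$ has a left dual ${}^\vee X$ (with $\mathrm{ev}_X\colon {}^\vee X\otimes X\to\mathbf 1$, $\mathrm{coev}_X\colon \mathbf 1\to X\otimes {}^\vee X$) and a right dual $X^\vee$ (with $\widetilde{\mathrm{ev}}_X\colon X\otimes X^\vee\to \mathbf 1$, $\widetilde{\mathrm{coev}}_X\colon \mathbf 1\to X^\vee\otimes X$). Duals are chosen; ${}^\vee f$, $f^\vee$ are dual morphisms. A comonoidal functor $F$ is a functor with a coassociative and counital natural transformation $F_2(X,Y)\colon F(X\otimes Y)\to F(X)\otimes F(Y)$, $F_0\colon F(\mathbf 1)\to\mathbf 1$. Comonoidal natural transformations are those compatible with these structures; composites are comonoidal by $(GF)_2(X,Y)=G_2(F(X),F(Y))G(F_2(X,Y))$, $(GF)_0=G_0G(F_0)$. A bimonad is a monad $(T,\mu,\eta)$ with a comonoidal structure on $T$ such that $\mu,\eta$ are comonoidal. A left antipode for $T$ is a natural transformation $s^l_X\colon T({}^\vee T(X))\to {}^\vee X$ with $T_0T(\mathrm{ev}_X)T({}^\vee\eta_X\otimes \mathrm{id}_X)=\mathrm{ev}_{T(X)}(s^l_{T(X)}T({}^\vee\mu_X)\otimes \mathrm{id})T_2({}^\vee T(X),X)$ and $(\eta_X\otimes \mathrm{id}_{{}^\vee X})\mathrm{coev}_XT_0=(\mu_X\otimes s^l_X)T_2(T(X),{}^\vee T(X))T(\mathrm{coev}_{T(X)})$. A right antipode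 is a natural transformation $s^r_X\colon T(T(X)^\vee)\to X^\vee$ with $T_0T(\widetilde{\mathrm{ev}}_X)T(\mathrm{id}_X\otimes\eta_X^\vee)=\widetilde{\mathrm{ev}}_{T(X)}(\mathrm{id}\otimes s^r_{T(X)}T(\mu_X^\vee))T_2(X,T(X)^\vee)$ and $(\mathrm{id}_{X^\vee}\otimes\eta_X)\widetilde{\mathrm{coev}}_XT_0=(s^r_X\otimes\mu_X)T_2(T(X)^\vee,T(X))T(\widetilde{\mathrm{coev}}_{T(X)})$. A Hopf monad is a bimonad on an autonomous category having a left and a right antipode. For a monad $T$, $T\text{-}\mathcal{C}$ is the category of $T$-modules $(M,r)$ ($r\colon T(M)\to M$, $rT(r)=r\mu_M$, $r\eta_M=\mathrm{id}_M$) and $T$-linear morphisms; $U_T$ is the forgetful functor, $F_T(X)=(T(X),\mu_X)$ its left adjoint, with unit $\eta$ and counit $\varepsilon_{(M,r)}=r$. If $T$ is a bimonad, $T\text{-}\mathcal{C}$ is monoidal with $(M,r)\otimes(N,s)=(M\otimes N,(r\otimes s)T_2(M,N))$ and unit $(\mathbf 1,T_0)$; if $T$ is a Hopf monad it is autonomous. Cross product: $Q\rtimes T=U_TQF_T$. If $(Q,q,v)$ is a monad, $Q\rtimes T$ is a monad with product $q_{F_T}Q(\varepsilon_{QF_T})$ and unit $v_{F_T}\eta$. If $Q$ is comonoidal, $Q\rtimes T$ is comonoidal with $(Q\rtimes T)_2(X,Y)=Q_2(F_T(X),F_T(Y))\,Q(\varepsilon_{F_T(X)\otimes F_T(Y)}F_T(\eta_X\otimes\eta_Y))$,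 $(Q\rtimes T)_0=Q_0Q(\varepsilon_{(\mathbf 1,T_0)})$. A centralizer of an endofunctor $P$ of a monoidal category $\mathcal{A}$ is a pair $(Z_P,\partial)$ with $Z_P$ an endofunctor of $\mathcal{A}$ and $\partial_{X,Y}\colon X\otimes Y\to P(Y)\otimes Z_P(X)$ natural in $X,Y$, such that for all objects $X,W$ and every natural $\{\xi_Y\colon X\otimes Y\to P(Y)\otimes W\}_Y$ there is a unique $r\colon Z_P(X)\to W$ with $\xi_Y=(\mathrm{id}_{P(Y)}\otimes r)\partial_{X,Y}$ for all $Y$. $P$ is centralizable if it has a centralizer. When $\mathcal{A}$ is left autonomous: if $P$ is comonoidal, $Z_P$ is a monad with product $m$ and unit $u$ determined by $(\mathrm{id}\otimes m_X)(\mathrm{id}_{P(Y_1)}\otimes\partial_{Z_P(X),Y_2})(\partial_{X,Y_1}\otimes\mathrm{id}_{Y_2})=(P_2(Y_1,Y_2)\otimes\mathrm{id}_{Z_P(X)})\partial_{X,Y_1\otimes Y_2}$, $u_X=(P_0\otimes\mathrm{id}_{Z_P(X)})\partial_{X,\mathbf 1}$; if $P$ is a bimonad with product $\mu$ and unit $\eta$, $Z_P$ is a bimonad with comonoidal structure determined by $(\mathrm{id}_{P(Y)}\otimes(Z_P)_2(X_1,X_2))\partial_{X_1\otimes X_2,Y}=(\mu_Y\otimes\mathrm{id})(\partial_{X_1,P(Y)}\otimes\mathrm{id}_{Z_P(X_2)})(\mathrm{id}_{X_1}\otimes\partial_{X_2,Y})$, $(\mathrm{id}_{P(Y)}\otimes(Z_P)_0)\partial_{\mathbf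 1,Y}=\eta_Y$. There is a unique centralizer $(Z_Q,\widetilde\partial)$ of $Q$ such that $U_TZ_Q=Z_{Q\rtimes T}U_T$ and $\widetilde\partial_{(M,r),(N,s)}=(Q(s)\otimes\mathrm{id})\partial_{M,N}$; the monad $Z_Q$ is a lift of the monad $Z_{Q\rtimes T}$ to $T\text{-}\mathcal{C}$. The canonical distributive law of $(Q,T)$ is the unique distributive law $\Omega\colon TZ_{Q\rtimes T}\to Z_{Q\rtimes T}T$ of $T$ over $Z_{Q\rtimes T}$ such that $Z_Q(M,r)=(Z_{Q\rtimes T}(M),Z_{Q\rtimes T}(r)\Omega_M)$ for every $T$-module $(M,r)$. (A distributive law of $(T,\mu,\eta)$ over $(P,m,u)$ is a natural $\Omega\colon TP\to PT$ with $\Omega_XT(m_X)=m_{T(X)}P(\Omega_X)\Omega_{P(X)}$, $\Omega_XT(u_X)=u_{T(X)}$, $\Omega_X\mu_{P(X)}=P(\mu_X)\Omega_{T(X)}T(\Omega_X)$, $\Omega_X\eta_{P(X)}=P(\eta_X)$.) $D_{Q,T}=Z_{Q\rtimes T}\circ_\Omega T$ is the endofunctor $Z_{Q\rtimes T}T$ with product $m_{T(X)}Z_{Q\rtimes T}^2(\mu_X)Z_{Q\rtimes T}(\Omega_{T(X)})$ and unit $u_{T(X)}\eta_X$; if $Q$ is a bimonad, it is a bimonad with the composite comonoidal structure. For a comonoidal endofunctor $Q$ of a monoidal category $\mathcal{A}$, the center $\mathcal{Z}_Q(\mathcal{A})$ of $\mathcal{A}$ relative to $Q$ has as objects pairs $(M,\sigma)$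 with $\sigma=\{\sigma_Y\colon M\otimes Y\to Q(Y)\otimes M\}_Y$ natural, such that $(Q_2(Y,Z)\otimes\mathrm{id}_M)\sigma_{Y\otimes Z}=(\mathrm{id}_{Q(Y)}\otimes\sigma_Z)(\sigma_Y\otimes\mathrm{id}_Z)$ and $(Q_0\otimes\mathrm{id}_M)\sigma_{\mathbf 1}=\mathrm{id}_M$; morphisms $(M,\sigma)\to(M',\sigma')$ are $f\colon M\to M'$ with $(\mathrm{id}_{Q(Y)}\otimes f)\sigma_Y=\sigma'_Y(f\otimes\mathrm{id}_Y)$. If $(Q,q,v)$ is a bimonad, it is monoidal with unit $(\mathbf 1,v)$ and $(M,\sigma)\otimes(N,\gamma)=(M\otimes N,\rho)$, $\rho_Y=(q_Y\otimes\mathrm{id}_{M\otimes N})(\sigma_{Q(Y)}\otimes\mathrm{id}_N)(\mathrm{id}_M\otimes\gamma_Y)$. *)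

(* Defs.v *)
From Stdlib Require Import ssreflect ProofIrrelevance FunctionalExtensionality.

Set Implicit Arguments.
Unset Strict Implicit.
Unset Printing Implicit Defensive.

Declare Scope cat_scope.
Delimit Scope cat_scope with cat.
Open Scope cat_scope.

Reserved Notation "g ∘ f" (at level 40, left associativity).
Reserved Notation "X ⊗ Y" (at level 36, left associativity).
Reserved Notation "f ⊠ g" (at level 36, left associativity).

Record Category := {
  ob :> Type;
  Hom : ob -> ob -> Type;
  idc : forall X, Hom X X;
  comp : forall X Y Z, Hom Y Z -> Hom X Y -> Hom X Z;
  comp1f : forall X Y (f : Hom X Y), comp (idc Y) f = f;
  compf1 : forall X Y (f : Hom X Y), comp f (idc X) = f;
  compA : forall X Y Z W (h : Hom Z W) (g : Hom Y Z) (f : Hom X Y),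
    comp h (comp g f) = comp (comp h g) f }.
Arguments Hom {c} X Y.
Arguments idc {c} X.
Notation "g ∘ f" := (comp g f) : cat_scope.

(* An equality of objects, seen as an (identity) morphism.  Strictness of a
   monoidal category is an equality of objects; the morphisms [eqhom] are the
   identities that make the two sides of an equation have the same type. *)
Definition eqhom {C : Category} {X Y : C} (e : X = Y) : Hom X Y :=
  match e in _ = Z return Hom X Z with eq_refl => idc X end.

Record Functor (C D : Category) := {
  fob :> C -> D;
  fmap : forall X Y : C, Hom X Y -> Hom (fob X) (fob Y);
  fmap1 : forall X : C, fmap (idc X) = idc (fob X);
  fmapD : forall (X Y Z : C) (g : Hom Y Z) (f : Hom X Y),
    fmap (g ∘ f) = fmap g ∘ fmap f }.
Arguments fmap {C D} _ {X Y} _.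

Definition idF (C : Category) : Functor C C.
Proof. by refine {| fob := fun X => X; fmap := fun X Y f => f |}. Defined.

Definition compF (C D E : Category) (G : Functor D E) (F : Functor C D) :
  Functor C E.
Proof.
refine {| fob := fun X => G (F X); fmap := fun X Y f => fmap G (fmap F f) |}.
- by move=> X; rewrite !fmap1.
- by move=> *; rewrite !fmapD.
Defined.

Definition IsIsoOfCategories (C D : Category) (F : Functor C D) : Prop :=
  exists G : Functor D C, compF G F = idF C /\ compF F G = idF D.

Section EqHom.
Variable C : Category.

Lemma eqhom1 (X : C) (e : X = X) : eqhom e = idc X.
Proof. by rewrite (proof_irrelevance _ e eq_refl). Qed.

Lemma eqhomD (X Y Z : C) (e : X = Y) (e' : Y = Z) :
  eqhom e' ∘ eqhom e = eqhom (eq_trans e e').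
Proof. by case: _ / e'; rewrite /= comp1f. Qed.

Lemma eqhom_irr (X Y : C) (e e' : X = Y) : eqhom e = eqhom e'.
Proof. by rewrite (proof_irrelevance _ e e'). Qed.

Lemma eqhomK (X Y : C) (e : X = Y) (e' : Y = X) : eqhom e' ∘ eqhom e = idc X.
Proof. by rewrite eqhomD eqhom1. Qed.

Lemma eqhom_cancel_l (X Y Z : C) (e : Y = Z) (f g : Hom X Y) :
  eqhom e ∘ f = eqhom e ∘ g -> f = g.
Proof. by case: _ / e; rewrite /= !comp1f. Qed.

Lemma eqhom_cancel_r (X Y Z : C) (e : X = Y) (f g : Hom Y Z) :
  f ∘ eqhom e = g ∘ eqhom e -> f = g.
Proof. by case: _ / e f g => f g; rewrite /= !compf1. Qed.

End EqHom.

Lemma fmap_eqhom (C D : Category) (F : Functor C D) (X Y : C) (e : X = Y)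
    (e' : F X = F Y) :
  fmap F (eqhom e) = eqhom e'.
Proof. by case: _ / e e' => e'; rewrite /= fmap1 eqhom1. Qed.

Section Reassoc.
Variable C : Category.

Lemma reas (X Y Z : C) (a : Hom Y Z) (b : Hom X Y) (r : Hom X Z) :
  a ∘ b = r -> forall W (h : Hom Z W), h ∘ a ∘ b = h ∘ r.
Proof. by move=> <- W h; rewrite compA. Qed.

Lemma reas3 (X Y Z V : C) (a : Hom Z V) (b : Hom Y Z) (d : Hom X Y)
    (r : Hom X V) :
  a ∘ b ∘ d = r -> forall W (h : Hom V W), h ∘ a ∘ b ∘ d = h ∘ r.
Proof. by move=> <- W h; rewrite !compA. Qed.
End Reassoc.

Record MonCat := {
  mcat :> Category;
  tens : mcat -> mcat -> mcat;
  one : mcat;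
  tensm : forall X X' Y Y' : mcat,
    Hom X X' -> Hom Y Y' -> Hom (tens X Y) (tens X' Y');
  tensm1 : forall X Y : mcat, tensm (idc X) (idc Y) = idc (tens X Y);
  tensmD : forall (X X' X'' Y Y' Y'' : mcat)
    (f' : Hom X' X'') (f : Hom X X') (g' : Hom Y' Y'') (g : Hom Y Y'),
    tensm (f' ∘ f) (g' ∘ g) = tensm f' g' ∘ tensm f g;
  tensA : forall X Y Z : mcat, tens (tens X Y) Z = tens X (tens Y Z);
  tens1l : forall X : mcat, tens one X = X;
  tens1r : forall X : mcat, tens X one = X;
  tensmA : forall (X X' Y Y' Z Z' : mcat)
    (f : Hom X X') (g : Hom Y Y') (h : Hom Z Z'),
    eqhom (tensA X' Y' Z') ∘ tensm (tensm f g) h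
    = tensm f (tensm g h) ∘ eqhom (tensA X Y Z);
  tensm1l : forall (X X' : mcat) (f : Hom X X'),
    eqhom (tens1l X') ∘ tensm (idc one) f = f ∘ eqhom (tens1l X);
  tensm1r : forall (X X' : mcat) (f : Hom X X'),
    eqhom (tens1r X') ∘ tensm f (idc one) = f ∘ eqhom (tens1r X) }.
Arguments one {m}.
Arguments tensA {m} X Y Z.
Arguments tens1l {m} X.
Arguments tens1r {m} X.
Notation "X ⊗ Y" := (tens X Y) : cat_scope.
Notation "f ⊠ g" := (tensm f g) : cat_scope.

(* The identities [(X ⊗ Y) ⊗ Z = X ⊗ (Y ⊗ Z)], [1 ⊗ X = X], [X ⊗ 1 = X] and
   their inverses, as morphisms. *)
Notation asc X Y Z := (eqhom (tensA X Y Z)).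
Notation asc' X Y Z := (eqhom (eq_sym (tensA X Y Z))).
Notation lun X := (eqhom (tens1l X)).
Notation lun' X := (eqhom (eq_sym (tens1l X))).
Notation run X := (eqhom (tens1r X)).
Notation run' X := (eqhom (eq_sym (tens1r X))).

Record StrictMonoidal (A B : MonCat) (F : Functor A B) : Prop := {
  strict_tens : forall X Y : A, F (X ⊗ Y) = F X ⊗ F Y;
  strict_one : F one = one;
  strict_tensm : forall (X X' Y Y' : A) (f : Hom X X') (g : Hom Y Y'),
    eqhom (strict_tens X' Y') ∘ fmap F (f ⊠ g)
    = (fmap F f ⊠ fmap F g) ∘ eqhom (strict_tens X Y) }.

Record StrictFunctor (A B : MonCat) := {
  sfun :> Functor A B;
  sfunP : StrictMonoidal sfun }.

Definition strict_comp (A B D : MonCat) (G : StrictFunctor B D)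
    (F : StrictFunctor A B) : StrictFunctor A D.
Proof.
refine {| sfun := compF G F |}.
abstract (
  case: G => G [gt g1 gm]; case: F => F [ft f1 fm] /=;
  unshelve refine (@Build_StrictMonoidal _ _ (compF G F) _ _ _);
  [ by move=> X Y; rewrite /= ft gt
  | by rewrite /= f1 g1
  | move=> X X' Y Y' f g /=;
    set e' := (X in eqhom X ∘ _); set e := (X in _ = _ ∘ eqhom X);
    rewrite (eqhom_irr e' (eq_trans (f_equal G (ft X' Y')) (gt _ _)));
    rewrite (eqhom_irr e (eq_trans (f_equal G (ft X Y)) (gt _ _)));
    rewrite -!eqhomD compA -gm;
    rewrite -!(fmap_eqhom (F := G)) -!compA -!fmapD fm; by [] ]).
Defined.

Section MonCatTheory.
Variable C : MonCat.

Lemma tensm_l (X X' X'' Y : C) (f' : Hom X' X'') (f : Hom X X') :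
  (f' ∘ f) ⊠ idc Y = (f' ⊠ idc Y) ∘ (f ⊠ idc Y).
Proof. by rewrite -tensmD comp1f. Qed.

Lemma tensm_r (X X' X'' Y : C) (f' : Hom X' X'') (f : Hom X X') :
  idc Y ⊠ (f' ∘ f) = (idc Y ⊠ f') ∘ (idc Y ⊠ f).
Proof. by rewrite -tensmD comp1f. Qed.

Lemma tensm_lr (X X' Y Y' : C) (f : Hom X X') (g : Hom Y Y') :
  f ⊠ g = (f ⊠ idc Y') ∘ (idc X ⊠ g).
Proof. by rewrite -tensmD comp1f compf1. Qed.

Lemma tensm_rl (X X' Y Y' : C) (f : Hom X X') (g : Hom Y Y') :
  f ⊠ g = (idc X' ⊠ g) ∘ (f ⊠ idc Y).
Proof. by rewrite -tensmD comp1f compf1. Qed.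

Lemma tensm_xchg (X X' Y Y' : C) (f : Hom X X') (g : Hom Y Y') :
  (idc X' ⊠ g) ∘ (f ⊠ idc Y) = (f ⊠ idc Y') ∘ (idc X ⊠ g).
Proof. by rewrite -tensm_lr -tensm_rl. Qed.

Lemma eqhom_tens (X X' Y Y' : C) (e : X = X') (e' : Y = Y')
    (e'' : X ⊗ Y = X' ⊗ Y') :
  eqhom e ⊠ eqhom e' = eqhom e''.
Proof. by case: _ / e e''; case: _ / e' => e''; rewrite /= tensm1 eqhom1. Qed.

Lemma eqhom_tensl (X X' Y : C) (e : X = X') (e'' : X ⊗ Y = X' ⊗ Y) :
  eqhom e ⊠ idc Y = eqhom e''.
Proof. exact: (eqhom_tens e eq_refl). Qed.

Lemma eqhom_tensr (X X' Y : C) (e : X = X') (e'' : Y ⊗ X = Y ⊗ X') :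
  idc Y ⊠ eqhom e = eqhom e''.
Proof. exact: (eqhom_tens eq_refl e). Qed.

Lemma eqhom_wl (X X' Y : C) (e : X = X') :
  eqhom e ⊠ idc Y = eqhom (f_equal (fun Z : C => Z ⊗ Y) e).
Proof. exact: eqhom_tensl. Qed.

Lemma eqhom_wr (X X' Y : C) (e : X = X') :
  idc Y ⊠ eqhom e = eqhom (f_equal (fun Z : C => Y ⊗ Z) e).
Proof. exact: eqhom_tensr. Qed.

Lemma tensmA_l (X X' Y Z : C) (f : Hom X X') :
  asc X' Y Z ∘ ((f ⊠ idc Y) ⊠ idc Z) = (f ⊠ idc (Y ⊗ Z)) ∘ asc X Y Z.
Proof. by rewrite tensmA tensm1. Qed.

Lemma tensmA_r (X Y Z Z' : C) (f : Hom Z Z') :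
  asc X Y Z' ∘ (idc (X ⊗ Y) ⊠ f) = (idc X ⊠ (idc Y ⊠ f)) ∘ asc X Y Z.
Proof. by rewrite -tensmA tensm1. Qed.

Lemma tensmA_m (X Y Y' Z : C) (f : Hom Y Y') :
  asc X Y' Z ∘ ((idc X ⊠ f) ⊠ idc Z) = (idc X ⊠ (f ⊠ idc Z)) ∘ asc X Y Z.
Proof. exact: tensmA. Qed.

Lemma tensmA' (X X' Y Y' Z Z' : C)
    (f : Hom X X') (g : Hom Y Y') (h : Hom Z Z') :
  asc' X' Y' Z' ∘ (f ⊠ (g ⊠ h)) = ((f ⊠ g) ⊠ h) ∘ asc' X Y Z.
Proof.
apply: (eqhom_cancel_l (e := tensA X' Y' Z')).
by rewrite !compA eqhomK comp1f tensmA -compA eqhomK compf1.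
Qed.

Lemma tensmA'_l (X X' Y Z : C) (f : Hom X X') :
  asc' X' Y Z ∘ (f ⊠ idc (Y ⊗ Z)) = ((f ⊠ idc Y) ⊠ idc Z) ∘ asc' X Y Z.
Proof. by rewrite -tensmA' tensm1. Qed.

Lemma tensmA'_r (X Y Z Z' : C) (f : Hom Z Z') :
  asc' X Y Z' ∘ (idc X ⊠ (idc Y ⊠ f)) = (idc (X ⊗ Y) ⊠ f) ∘ asc' X Y Z.
Proof. by rewrite tensmA' tensm1. Qed.

Lemma tensmA'_m (X Y Y' Z : C) (f : Hom Y Y') :
  asc' X Y' Z ∘ (idc X ⊠ (f ⊠ idc Z)) = ((idc X ⊠ f) ⊠ idc Z) ∘ asc' X Y Z.
Proof. exact: tensmA'. Qed.
End MonCatTheory.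

Ltac coh :=
  rewrite ?(tensm1, comp1f, compf1) ?(eqhom_wl, eqhom_wr, eqhomD);
  exact: eqhom_irr.

Record AutonomousCategory := {
  acat :> MonCat;
  ldual : acat -> acat;
  ev : forall X : acat, Hom (ldual X ⊗ X) one;
  coev : forall X : acat, Hom one (X ⊗ ldual X);
  ev_coev : forall X : acat,
    run X ∘ (idc X ⊠ ev X) ∘ asc X (ldual X) X ∘ (coev X ⊠ idc X) ∘ lun' X
    = idc X;
  coev_ev : forall X : acat,
    lun (ldual X) ∘ (ev X ⊠ idc (ldual X)) ∘ asc' (ldual X) X (ldual X)
      ∘ (idc (ldual X) ⊠ coev X) ∘ run' (ldual X)
    = idc (ldual X);
  rdual : acat -> acat;
  rev : forall X : acat, Hom (X ⊗ rdual X) one;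
  rcoev : forall X : acat, Hom one (rdual X ⊗ X);
  rev_rcoev : forall X : acat,
    lun X ∘ (rev X ⊠ idc X) ∘ asc' X (rdual X) X ∘ (idc X ⊠ rcoev X) ∘ run' X
    = idc X;
  rcoev_rev : forall X : acat,
    run (rdual X) ∘ (idc (rdual X) ⊠ rev X) ∘ asc (rdual X) X (rdual X)
      ∘ (rcoev X ⊠ idc (rdual X)) ∘ lun' (rdual X)
    = idc (rdual X) }.
Arguments ldual {a} X.
Arguments ev {a} X.
Arguments coev {a} X.
Arguments rdual {a} X.
Arguments rev {a} X.
Arguments rcoev {a} X.

Definition ldualm (C : AutonomousCategory) (X Y : C) (f : Hom X Y) :
    Hom (ldual Y) (ldual X) :=
  lun (ldual X) ∘ (ev Y ⊠ idc (ldual X)) ∘ asc' (ldual Y) Y (ldual X)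
    ∘ (idc (ldual Y) ⊠ (f ⊠ idc (ldual X))) ∘ (idc (ldual Y) ⊠ coev X)
    ∘ run' (ldual Y).

Definition rdualm (C : AutonomousCategory) (X Y : C) (f : Hom X Y) :
    Hom (rdual Y) (rdual X) :=
  run (rdual X) ∘ (idc (rdual X) ⊠ rev Y) ∘ asc (rdual X) Y (rdual Y)
    ∘ ((idc (rdual X) ⊠ f) ⊠ idc (rdual Y)) ∘ (rcoev X ⊠ idc (rdual Y))
    ∘ lun' (rdual Y).

Record Comonoidal (A B : MonCat) (F : Functor A B) := {
  com2 : forall X Y : A, Hom (F (X ⊗ Y)) (F X ⊗ F Y);
  com0 : Hom (F one) one;
  com2_nat : forall (X X' Y Y' : A) (f : Hom X X') (g : Hom Y Y'),
    com2 X' Y' ∘ fmap F (f ⊠ g) = (fmap F f ⊠ fmap F g) ∘ com2 X Y;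
  com2A : forall X Y Z : A,
    asc (F X) (F Y) (F Z) ∘ (com2 X Y ⊠ idc (F Z)) ∘ com2 (X ⊗ Y) Z
    = (idc (F X) ⊠ com2 Y Z) ∘ com2 X (Y ⊗ Z) ∘ fmap F (asc X Y Z);
  com01l : forall X : A,
    lun (F X) ∘ (com0 ⊠ idc (F X)) ∘ com2 one X = fmap F (lun X);
  com01r : forall X : A,
    run (F X) ∘ (idc (F X) ⊠ com0) ∘ com2 X one = fmap F (run X) }.

Definition Comonoidal_id (A : MonCat) : Comonoidal (idF A).
Proof.
refine {| com2 := fun X Y => idc (X ⊗ Y) : Hom (idF A (X ⊗ Y)) _;
          com0 := idc one : Hom (idF A one) one |} => /=.
- by move=> *; rewrite comp1f compf1.
- by move=> *; rewrite !tensm1 !compf1 comp1f.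
- by move=> *; rewrite !tensm1 !compf1.
- by move=> *; rewrite !tensm1 !compf1.
Defined.

Definition Comonoidal_comp (A B C : MonCat) (G : Functor B C) (F : Functor A B)
    (cG : Comonoidal G) (cF : Comonoidal F) : Comonoidal (compF G F).
Proof.
refine {| com2 := fun X Y => com2 cG (F X) (F Y) ∘ fmap G (com2 cF X Y)
                    : Hom (compF G F (X ⊗ Y)) _;
          com0 := com0 cG ∘ fmap G (com0 cF) |} => /=.
- move=> X X' Y Y' f g.
  by rewrite -compA -fmapD com2_nat fmapD !compA com2_nat.
- move=> X Y Z.
  have E1 := com2_nat cG (com2 cF X Y) (idc (F Z)).
  have E2 := com2_nat cG (idc (F X)) (com2 cF Y Z).
  rewrite fmap1 in E1; rewrite fmap1 in E2.
  transitivity (asc (G (F X)) (G (F Y)) (G (F Z))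
    ∘ (com2 cG (F X) (F Y) ⊠ idc (G (F Z))) ∘ com2 cG (F X ⊗ F Y) (F Z)
    ∘ fmap G ((com2 cF X Y ⊠ idc (F Z)) ∘ com2 cF (X ⊗ Y) Z)).
    by rewrite tensm_l fmapD -!compA; do 2 congr (_ ∘ _); rewrite !compA E1.
  rewrite com2A -!compA -fmapD !compA com2A fmapD fmapD tensm_r.
  by rewrite -!compA; congr (_ ∘ _); rewrite !compA E2.
- move=> X.
  rewrite tensm_l -(fmap1 G).
  have E1 := com2_nat cG (com0 cF) (idc (F X)).
  rewrite -!compA (compA (fmap G _ ⊠ _)) -E1 !compA fmap1 com01l -!fmapD.
  by rewrite com01l.
- move=> X.
  rewrite tensm_r -(fmap1 G).
  have E1 := com2_nat cG (idc (F X)) (com0 cF).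
  rewrite -!compA (compA (_ ⊠ fmap G _)) -E1 !compA fmap1 com01r -!fmapD.
  by rewrite com01r.
Defined.

Definition IsComonoidalNat (A B : MonCat) (F G : Functor A B)
    (cF : Comonoidal F) (cG : Comonoidal G) (a : forall X : A, Hom (F X) (G X)) :
    Prop :=
  (forall X Y : A, com2 cG X Y ∘ a (X ⊗ Y) = (a X ⊠ a Y) ∘ com2 cF X Y)
  /\ com0 cG ∘ a one = com0 cF.

(* [Monad T] is the type of monad structures on the endofunctor [T]. *)
Record Monad (C : Category) (T : Functor C C) := {
  mu : forall X : C, Hom (T (T X)) (T X);
  eta : forall X : C, Hom X (T X);
  mu_nat : forall (X Y : C) (f : Hom X Y),
    mu Y ∘ fmap T (fmap T f) = fmap T f ∘ mu X;
  eta_nat : forall (X Y : C) (f : Hom X Y), eta Y ∘ f = fmap T f ∘ eta X;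
  muA : forall X : C, mu X ∘ fmap T (mu X) = mu X ∘ mu (T X);
  mu_eta : forall X : C, mu X ∘ eta (T X) = idc (T X);
  mu_Teta : forall X : C, mu X ∘ fmap T (eta X) = idc (T X) }.

Record IsBimonad (C : MonCat) (T : Functor C C) (m : Monad T)
    (c : Comonoidal T) : Prop := {
  mu_com : IsComonoidalNat (Comonoidal_comp c c) c (mu m);
  eta_com : IsComonoidalNat (Comonoidal_id C) c (eta m) }.

Definition IsLeftAntipode (C : AutonomousCategory) (T : Functor C C)
    (m : Monad T) (c : Comonoidal T)
    (s : forall X : C, Hom (T (ldual (T X))) (ldual X)) : Prop :=
  (forall (X Y : C) (f : Hom X Y),
     s X ∘ fmap T (ldualm (fmap T f)) = ldualm f ∘ s Y)
  /\ (forall X : C,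
     com0 c ∘ fmap T (ev X) ∘ fmap T (ldualm (eta m X) ⊠ idc X)
     = ev (T X) ∘ ((s (T X) ∘ fmap T (ldualm (mu m X))) ⊠ idc (T X))
         ∘ com2 c (ldual (T X)) X)
  /\ (forall X : C,
     (eta m X ⊠ idc (ldual X)) ∘ coev X ∘ com0 c
     = (mu m X ⊠ s X) ∘ com2 c (T X) (ldual (T X)) ∘ fmap T (coev (T X))).

Definition IsRightAntipode (C : AutonomousCategory) (T : Functor C C)
    (m : Monad T) (c : Comonoidal T)
    (s : forall X : C, Hom (T (rdual (T X))) (rdual X)) : Prop :=
  (forall (X Y : C) (f : Hom X Y),
     s X ∘ fmap T (rdualm (fmap T f)) = rdualm f ∘ s Y)
  /\ (forall X : C,
     com0 c ∘ fmap T (rev X) ∘ fmap T (idc X ⊠ rdualm (eta m X))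
     = rev (T X) ∘ (idc (T X) ⊠ (s (T X) ∘ fmap T (rdualm (mu m X))))
         ∘ com2 c X (rdual (T X)))
  /\ (forall X : C,
     (idc (rdual X) ⊠ eta m X) ∘ rcoev X ∘ com0 c
     = (s X ⊠ mu m X) ∘ com2 c (rdual (T X)) (T X) ∘ fmap T (rcoev (T X))).

Record Bimonad (C : MonCat) := {
  bfun :> Functor C C;
  bmon : Monad bfun;
  bcom : Comonoidal bfun;
  bimonadP : IsBimonad bmon bcom }.

Record HopfMonad (C : AutonomousCategory) := {
  hbim :> Bimonad C;
  left_antipode : exists s, IsLeftAntipode (bmon hbim) (bcom hbim) s;
  right_antipode : exists s, IsRightAntipode (bmon hbim) (bcom hbim) s }.

Record Module (C : Category) (T : Functor C C) (m : Monad T) := {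
  mcar :> C;
  mact : Hom (T mcar) mcar;
  mactM : mact ∘ fmap T mact = mact ∘ mu m mcar;
  mact1 : mact ∘ eta m mcar = idc mcar }.

Section Modules.
Variables (C : Category) (T : Functor C C) (m : Monad T).

Definition IsLinear (A B : Module m) (f : Hom (mcar A) (mcar B)) : Prop :=
  f ∘ mact A = mact B ∘ fmap T f.

Record MHom (A B : Module m) := {
  lin :> Hom (mcar A) (mcar B);
  linP : IsLinear lin }.

Lemma MHom_eq (A B : Module m) (f g : MHom A B) :
  lin f = lin g -> f = g.
Proof.
case: f => f Hf; case: g => g Hg /= E; case: _ / E Hg => Hg.
by rewrite (proof_irrelevance _ Hf Hg).
Qed.

Definition MHom_id (A : Module m) : MHom A A.
Proof.
by refine {| lin := idc (mcar A) |}; rewrite /IsLinear fmap1 compf1 comp1f.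
Defined.

Definition MHom_comp (A B D : Module m) (g : MHom B D) (f : MHom A B) : MHom A D.
Proof.
refine {| lin := lin g ∘ lin f |}.
by rewrite /IsLinear fmapD -compA (linP f) !compA (linP g).
Defined.

Definition ModCat : Category.
Proof.
refine {| ob := Module m; Hom := MHom; idc := MHom_id; comp := MHom_comp |}.
- by move=> A B f; apply: MHom_eq; rewrite /= comp1f.
- by move=> A B f; apply: MHom_eq; rewrite /= compf1.
- by move=> *; apply: MHom_eq; rewrite /= compA.
Defined.

Definition forget : Functor ModCat C.
Proof.
by refine {| fob := fun A : ModCat => mcar A;
             fmap := fun (A B : ModCat) (f : Hom A B) => lin f |}.
Defined.

Lemma module_eq (A B : Module m) (e : mcar A = mcar B) :
  IsLinear (eqhom e) -> A = B.
Proof.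
rewrite /IsLinear; case: A e => a r r1 r2; case: B => b s s1 s2 /= e.
case: _ / e s s1 s2 => s s1 s2 /=; rewrite fmap1 comp1f compf1 => E.
case: _ / E s1 s2 => s1 s2.
by rewrite (proof_irrelevance _ r1 s1) (proof_irrelevance _ r2 s2).
Qed.

Lemma lin_eqhom (A B : ModCat) (e : A = B) (e' : mcar A = mcar B) :
  lin (eqhom e) = eqhom e'.
Proof. exact: (fmap_eqhom (F := forget)). Qed.

Definition free_mod (X : C) : Module m.
Proof.
refine {| mcar := T X; mact := mu m X |}.
- exact: muA.
- exact: mu_eta.
Defined.

Definition freem (X Y : C) (f : Hom X Y) : MHom (free_mod X) (free_mod Y) :=
  @Build_MHom (free_mod X) (free_mod Y) (fmap T f) (eq_sym (mu_nat m f)).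

Definition free : Functor C ModCat.
Proof.
refine {| fob := (free_mod : C -> ModCat); fmap := freem |}.
- by move=> X; apply: MHom_eq; rewrite /= fmap1.
- by move=> *; apply: MHom_eq; rewrite /= fmapD.
Defined.

Definition counit (A : ModCat) : @Hom ModCat (free (mcar A)) A :=
  @Build_MHom (free_mod (mcar A)) A (mact A) (eq_sym (mactM A)).

Lemma counit_nat (A B : ModCat) (f : Hom A B) :
  counit B ∘ fmap free (lin f) = f ∘ counit A.
Proof. by apply: MHom_eq; rewrite /= -(linP f). Qed.
End Modules.
Arguments ModCat {C T} m.
Arguments forget {C T} m.
Arguments free {C T} m.
Arguments counit {C T} m A.

Section ModMonCat.
Variables (C : MonCat) (T : Functor C C) (m : Monad T) (c : Comonoidal T).
Hypothesis Hb : IsBimonad m c.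

Definition mod_tens (A B : Module m) : Module m.
Proof.
refine {| mcar := mcar A ⊗ mcar B;
          mact := (mact A ⊠ mact B) ∘ com2 c (mcar A) (mcar B) |}.
- have [E _] := mu_com Hb; move: {E}(E (mcar A) (mcar B)) => /= E.
  rewrite -[RHS]compA E !fmapD -!compA (compA (com2 _ _ _) (fmap T (_ ⊠ _))).
  by rewrite com2_nat !compA -!tensmD !mactM.
- have [E _] := eta_com Hb; move: {E}(E (mcar A) (mcar B)) => /= E.
  by rewrite -compA E compf1 -tensmD !mact1 tensm1.
Defined.

Definition mod_one : Module m.
Proof.
refine {| mcar := one; mact := com0 c |}.
- by have [_ E] := mu_com Hb; rewrite E.
- by have [_ E] := eta_com Hb; rewrite E.
Defined.

Lemma mod_tensm_lin (A A' B B' : Module m) (f : MHom A A') (g : MHom B B') :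
  @IsLinear _ _ m (mod_tens A B) (mod_tens A' B') (lin f ⊠ lin g).
Proof.
rewrite /IsLinear /=.
by rewrite compA -tensmD (linP f) (linP g) tensmD -!compA com2_nat.
Qed.

Definition mod_tensm (A A' B B' : Module m) (f : MHom A A') (g : MHom B B') :
  MHom (mod_tens A B) (mod_tens A' B') := Build_MHom (mod_tensm_lin f g).

Lemma mod_tensA (A B D : Module m) :
  mod_tens (mod_tens A B) D = mod_tens A (mod_tens B D).
Proof.
apply: (@module_eq _ _ m (mod_tens (mod_tens A B) D)
          (mod_tens A (mod_tens B D)) (tensA A B D)).
rewrite /IsLinear /=.
have -> : ((mact A ⊠ mact B) ∘ com2 c (mcar A) (mcar B)) ⊠ mact D
  = ((mact A ⊠ mact B) ⊠ mact D) ∘ (com2 c (mcar A) (mcar B) ⊠ idc _).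
  by rewrite -tensmD compf1.
have -> : mact A ⊠ ((mact B ⊠ mact D) ∘ com2 c (mcar B) (mcar D))
  = (mact A ⊠ (mact B ⊠ mact D)) ∘ (idc _ ⊠ com2 c (mcar B) (mcar D)).
  by rewrite -tensmD compf1.
rewrite !compA tensmA -!compA; congr (_ ∘ _).
by rewrite !compA com2A.
Qed.

Lemma mod_tens1l (A : Module m) : mod_tens mod_one A = A.
Proof.
apply: (@module_eq _ _ m (mod_tens mod_one A) A (tens1l _)).
rewrite /IsLinear /= -(com01l c) !compA -tensm1l -(compA _ (idc one ⊠ mact A)) -tensmD.
by rewrite comp1f compf1.
Qed.

Lemma mod_tens1r (A : Module m) : mod_tens A mod_one = A.
Proof.
apply: (@module_eq _ _ m (mod_tens A mod_one) A (tens1r _)).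
rewrite /IsLinear /= -(com01r c) !compA -tensm1r -(compA _ (mact A ⊠ idc one)) -tensmD.
by rewrite comp1f compf1.
Qed.

Definition ModMonCat : MonCat.
Proof.
refine {| mcat := ModCat m; tens := mod_tens : ModCat m -> ModCat m -> ModCat m;
          one := mod_one : ModCat m; tensm := mod_tensm;
          tensA := mod_tensA; tens1l := mod_tens1l; tens1r := mod_tens1r |}.
- by move=> X Y; apply: MHom_eq; rewrite /= tensm1.
- by move=> *; apply: MHom_eq; rewrite /= tensmD.
- move=> X X' Y Y' Z Z' f g h; apply: MHom_eq => /=.
  rewrite (lin_eqhom (mod_tensA X Y Z) (tensA (mcar X) (mcar Y) (mcar Z))).
  by rewrite (lin_eqhom (mod_tensA X' Y' Z') (tensA (mcar X') (mcar Y') (mcar Z'))) tensmA.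
- move=> X X' f; apply: MHom_eq => /=.
  rewrite (lin_eqhom (mod_tens1l X) (tens1l (mcar X))).
  by rewrite (lin_eqhom (mod_tens1l X') (tens1l (mcar X'))) tensm1l.
- move=> X X' f; apply: MHom_eq => /=.
  rewrite (lin_eqhom (mod_tens1r X) (tens1r (mcar X))).
  by rewrite (lin_eqhom (mod_tens1r X') (tens1r (mcar X'))) tensm1r.
Defined.

Lemma forget_strict : StrictMonoidal (forget m : Functor ModMonCat C).
Proof.
refine (@Build_StrictMonoidal ModMonCat C (forget m : Functor ModMonCat C)
  (fun X Y => eq_refl) eq_refl _).
by move=> *; rewrite /= comp1f compf1.
Qed.

Lemma lin_eq (X Y : ModMonCat) (f g : Hom X Y) : lin f = lin g -> f = g.
Proof. exact: MHom_eq. Qed.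

Lemma lin_comp (X Y Z : ModMonCat) (g : Hom Y Z) (f : Hom X Y) :
  lin (g ∘ f) = lin g ∘ lin f.
Proof. by []. Qed.

Lemma lin_id (X : ModMonCat) : lin (idc X) = idc (mcar X).
Proof. by []. Qed.

Lemma lin_tensm (X X' Y Y' : ModMonCat) (f : Hom X X') (g : Hom Y Y') :
  lin (f ⊠ g) = lin f ⊠ lin g.
Proof. by []. Qed.

Lemma lin_asc (X Y Z : ModMonCat) :
  lin (asc X Y Z) = asc (mcar X) (mcar Y) (mcar Z).
Proof. exact: (@lin_eqhom C T m _ _ (tensA X Y Z) (tensA _ _ _)). Qed.

Lemma lin_lun (X : ModMonCat) : lin (lun X) = lun (mcar X).
Proof. exact: (@lin_eqhom C T m _ _ (tens1l X) (tens1l _)). Qed.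

Lemma lin_run (X : ModMonCat) : lin (run X) = run (mcar X).
Proof. exact: (@lin_eqhom C T m _ _ (tens1r X) (tens1r _)). Qed.
End ModMonCat.

Section Cross.
Variables (C : MonCat) (T : Bimonad C).
Local Notation A := (ModMonCat (bimonadP T)).
Local Notation m := (bmon T).
Local Notation c := (bcom T).

Definition free_com2 (X Y : C) :
    @Hom A (free m (X ⊗ Y)) (@tens A (free m X) (free m Y)) :=
  counit m (@tens A (free m X) (free m Y)) ∘ fmap (free m) (eta m X ⊠ eta m Y).

Lemma free_com2E (X Y : C) : lin (free_com2 X Y) = com2 c X Y.
Proof.
rewrite /= -compA com2_nat compA -tensmD !mu_Teta.
by rewrite tensm1 comp1f.
Qed.

Definition lift_com (a2 : forall X Y : C,
      @Hom A (free m (X ⊗ Y)) (@tens A (free m X) (free m Y)))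
    (a0 : @Hom A (free m one) (@one A))
    (E2 : forall X Y, lin (a2 X Y) = com2 c X Y) (E0 : lin a0 = com0 c) :
  Comonoidal (free m : Functor C A).
Proof.
refine (@Build_Comonoidal C A (free m : Functor C A) a2 a0 _ _ _ _).
- abstract (move=> X X' Y Y' f g; apply: lin_eq;
    rewrite !lin_comp lin_tensm !E2; exact: com2_nat).
- abstract (move=> X Y Z; apply: lin_eq;
    rewrite !lin_comp !lin_tensm lin_asc !lin_id !E2; exact: com2A).
- abstract (move=> X; apply: lin_eq;
    rewrite !lin_comp !lin_tensm lin_lun !lin_id E2 E0; exact: com01l).
- abstract (move=> X; apply: lin_eq;
    rewrite !lin_comp !lin_tensm lin_run !lin_id E2 E0; exact: com01r).
Defined.

Definition free_com : Comonoidal (free m : Functor C A) :=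
  lift_com (a0 := counit m (@one A)) free_com2E eq_refl.

Definition forget_com (B : MonCat) (G : Functor B A) (d : Comonoidal G) :
  Comonoidal (compF (forget m : Functor A C) G).
Proof.
refine (@Build_Comonoidal B C (compF (forget m : Functor A C) G)
  (fun X Y => lin (com2 d X Y)) (lin (com0 d)) _ _ _ _).
- abstract (move=> X X' Y Y' f g;
    move: (f_equal (@lin _ _ _ _ _) (com2_nat d f g));
    rewrite !lin_comp lin_tensm; exact).
- abstract (move=> X Y Z; move: (f_equal (@lin _ _ _ _ _) (com2A d X Y Z));
    rewrite !lin_comp !lin_tensm lin_asc; exact).
- abstract (move=> X; move: (f_equal (@lin _ _ _ _ _) (com01l d X));
    rewrite !lin_comp !lin_tensm lin_lun; exact).
- abstract (move=> X; move: (f_equal (@lin _ _ _ _ _) (com01r d X));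
    rewrite !lin_comp !lin_tensm lin_run; exact).
Defined.

Variable Q : Functor A A.

Definition cross : Functor C C :=
  compF (forget m : Functor A C) (compF Q (free m : Functor C A)).

(* [com2] is [Q_2 (F X, F Y) ∘ Q (ε ∘ F (η ⊠ η))] and [com0] is [Q_0 ∘ Q ε]. *)
Definition cross_com (cQ : Comonoidal Q) : Comonoidal cross :=
  forget_com (Comonoidal_comp cQ free_com).

Lemma cross_com2E (cQ : Comonoidal Q) (X Y : C) :
  com2 (cross_com cQ) X Y
  = lin (com2 cQ (free m X) (free m Y)
         ∘ fmap Q (counit m (@tens A (free m X) (free m Y))
                   ∘ fmap (free m) (eta m X ⊠ eta m Y))).
Proof. by []. Qed.

Lemma cross_com0E (cQ : Comonoidal Q) :
  com0 (cross_com cQ) = lin (com0 cQ ∘ fmap Q (counit m (@one A))).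
Proof. by []. Qed.

Definition cross_mu (q : Monad Q) (X : C) : Hom (cross (cross X)) (cross X) :=
  lin (mu q (free m X) ∘ fmap Q (counit m (Q (free m X)))).

Definition cross_eta (q : Monad Q) (X : C) : Hom X (cross X) :=
  lin (eta q (free m X)) ∘ eta m X.

Definition cross_monad (q : Monad Q) : Monad cross.
Proof.
refine (@Build_Monad C cross (cross_mu q) (cross_eta q) _ _ _ _ _).
- abstract (move=> X Y f;
  have E : mu q (free m Y) ∘ fmap Q (counit m (Q (free m Y)))
      ∘ fmap Q (fmap (free m) (lin (fmap Q (fmap (free m) f))))
    = fmap Q (fmap (free m) f) ∘ (mu q (free m X)
      ∘ fmap Q (counit m (Q (free m X))));
  [ by rewrite -compA -fmapD counit_nat fmapD !compA mu_nat
  | exact: (f_equal (@lin _ _ _ _ _) E) ]).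
- abstract (move=> X Y f;
  have E := f_equal (@lin _ _ _ _ _) (eta_nat q (fmap (free m) f));
  rewrite /cross_eta -compA eta_nat !compA; congr (_ ∘ _); exact: E).
- abstract (move=> X;
  have E : mu q (free m X) ∘ fmap Q (counit m (Q (free m X)))
      ∘ fmap Q (fmap (free m) (lin (mu q (free m X)
                               ∘ fmap Q (counit m (Q (free m X))))))
    = mu q (free m X) ∘ fmap Q (counit m (Q (free m X)))
      ∘ (mu q (free m (cross X))
         ∘ fmap Q (counit m (Q (free m (cross X)))))
  ; [ by rewrite -compA -fmapD counit_nat !fmapD !compA muA
         -(compA (mu q _) (mu q _)) mu_nat !compA
         -(compA (mu q _) (fmap Q (counit m _)) (mu q _)) -mu_nat !compA
    | exact: (f_equal (@lin _ _ _ _ _) E) ]).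
- abstract (move=> X;
  have E : mu q (free m X) ∘ fmap Q (counit m (Q (free m X)))
      ∘ eta q (free m (cross X)) = counit m (Q (free m X))
  ; [ by rewrite -compA -eta_nat compA mu_eta comp1f
    | move: (f_equal (@lin _ _ _ _ _) E) => E';
      rewrite /cross_eta compA; rewrite -[RHS](mact1 (Q (free m X)));
      congr (_ ∘ _); exact: E' ]).
- abstract (move=> X;
  have E1 : counit m (free m X) ∘ fmap (free m) (eta m X) = idc (free m X)
  ; [ by apply: MHom_eq; exact: mu_Teta | ];
  have E : mu q (free m X) ∘ fmap Q (counit m (Q (free m X)))
      ∘ fmap Q (fmap (free m) (cross_eta q X)) = idc (Q (free m X))
  ; [ by rewrite -compA -fmapD /cross_eta (fmapD (free m)) (compA (counit m _)) counit_nat -compA E1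
        compf1 mu_Teta
    | exact: (f_equal (@lin _ _ _ _ _) E) ]).
Defined.
End Cross.

Record Centralizer (A : MonCat) (P : Functor A A) := {
  zfun :> Functor A A;
  zd : forall X Y : A, Hom (X ⊗ Y) (P Y ⊗ zfun X);
  zd_nat : forall (X X' Y Y' : A) (f : Hom X X') (g : Hom Y Y'),
    zd X' Y' ∘ (f ⊠ g) = (fmap P g ⊠ fmap zfun f) ∘ zd X Y;
  zd_univ : forall (X W : A) (xi : forall Y : A, Hom (X ⊗ Y) (P Y ⊗ W)),
    (forall (Y Y' : A) (g : Hom Y Y'),
       xi Y' ∘ (idc X ⊠ g) = (fmap P g ⊠ idc W) ∘ xi Y) ->
    exists! r : Hom (zfun X) W,
      forall Y : A, xi Y = (idc (P Y) ⊠ r) ∘ zd X Y }.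

(* The equations determining the monad structure of the centralizer of a
   comonoidal endofunctor. *)
Definition IsCentralizerMonad (A : MonCat) (P : Functor A A)
    (cP : Comonoidal P) (Z : Centralizer P) (m : Monad Z) : Prop :=
  (forall X Y1 Y2 : A,
     (idc (P Y1) ⊠ (idc (P Y2) ⊠ mu m X)) ∘ (idc (P Y1) ⊠ zd Z (Z X) Y2)
       ∘ asc (P Y1) (Z X) Y2 ∘ (zd Z X Y1 ⊠ idc Y2)
     = asc (P Y1) (P Y2) (Z X) ∘ (com2 cP Y1 Y2 ⊠ idc (Z X))
         ∘ zd Z X (Y1 ⊗ Y2) ∘ asc X Y1 Y2)
  /\ (forall X : A,
     eta m X = lun (Z X) ∘ (com0 cP ⊠ idc (Z X)) ∘ zd Z X one ∘ run' X).

(* The equations determining the comonoidal structure of the centralizer of a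
   bimonad. *)
Definition IsCentralizerComonoidal (A : MonCat) (P : Functor A A)
    (mP : Monad P) (Z : Centralizer P) (c : Comonoidal Z) : Prop :=
  (forall X1 X2 Y : A,
     (idc (P Y) ⊠ com2 c X1 X2) ∘ zd Z (X1 ⊗ X2) Y
     = (mu mP Y ⊠ idc (Z X1 ⊗ Z X2)) ∘ asc (P (P Y)) (Z X1) (Z X2)
         ∘ (zd Z X1 (P Y) ⊠ idc (Z X2)) ∘ asc' X1 (P Y) (Z X2)
         ∘ (idc X1 ⊠ zd Z X2 Y) ∘ asc X1 X2 Y)
  /\ (forall Y : A,
     (idc (P Y) ⊠ com0 c) ∘ zd Z one Y = run' (P Y) ∘ eta mP Y ∘ lun Y).

Record DistrLaw (C : Category) (T P : Functor C C) (mT : Monad T)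
    (mP : Monad P) := {
  dlaw :> forall X : C, Hom (T (P X)) (P (T X));
  dlaw_nat : forall (X Y : C) (f : Hom X Y),
    dlaw Y ∘ fmap T (fmap P f) = fmap P (fmap T f) ∘ dlaw X;
  dlaw_mu : forall X : C,
    dlaw X ∘ fmap T (mu mP X)
    = mu mP (T X) ∘ fmap P (dlaw X) ∘ dlaw (P X);
  dlaw_eta : forall X : C, dlaw X ∘ fmap T (eta mP X) = eta mP (T X);
  dlaw_muT : forall X : C,
    dlaw X ∘ mu mT (P X) = fmap P (mu mT X) ∘ dlaw (T X) ∘ fmap T (dlaw X);
  dlaw_etaT : forall X : C, dlaw X ∘ eta mT (P X) = fmap P (eta mT X) }.

Section DistrLawTheory.
Variables (C : Category) (T P : Functor C C) (mT : Monad T) (mP : Monad P).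
Variable O : DistrLaw mT mP.

Definition composite_mu (X : C) :
    Hom (compF P T (compF P T X)) (compF P T X) :=
  mu mP (T X) ∘ fmap P (fmap P (mu mT X)) ∘ fmap P (O (T X)).

Definition composite_eta (X : C) : Hom X (compF P T X) :=
  eta mP (T X) ∘ eta mT X.

Lemma composite_mu_nat (X Y : C) (f : Hom X Y) :
  composite_mu Y ∘ fmap P (fmap T (fmap P (fmap T f)))
  = fmap P (fmap T f) ∘ composite_mu X.
Proof.
rewrite /composite_mu !compA.
have E1 : fmap P (O (T Y)) ∘ fmap P (fmap T (fmap P (fmap T f)))
  = fmap P (fmap P (fmap T (fmap T f))) ∘ fmap P (O (T X)).
  by rewrite -!fmapD dlaw_nat.
have E2 : fmap P (fmap P (mu mT Y)) ∘ fmap P (fmap P (fmap T (fmap T f)))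
  = fmap P (fmap P (fmap T f)) ∘ fmap P (fmap P (mu mT X)).
  by rewrite -!fmapD mu_nat.
by rewrite (reas E1) !compA (reas E2) !compA mu_nat.
Qed.

Lemma composite_muA (X : C) :
  composite_mu X ∘ fmap P (fmap T (composite_mu X))
  = composite_mu X ∘ composite_mu (P (T X)).
Proof.
pose N := mu mP (T X) ∘ mu mP (P (T X))
  ∘ fmap P (fmap P (fmap P (mu mT X ∘ mu mT (T X))))
  ∘ fmap P (fmap P (O (T (T X)))) ∘ fmap P (fmap P (fmap T (O (T X))))
  ∘ fmap P (O (T (P (T X)))).
transitivity N; rewrite /N /composite_mu.
- rewrite !fmapD !compA.
  have E1 : fmap P (O (T X)) ∘ fmap P (fmap T (mu mP (T X)))
    = fmap P (mu mP (T (T X))) ∘ fmap P (fmap P (O (T X)))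
      ∘ fmap P (O (P (T X))) by rewrite -!fmapD dlaw_mu !fmapD.
  rewrite (reas E1) !compA.
  have E2 : fmap P (O (P (T X))) ∘ fmap P (fmap T (fmap P (fmap P (mu mT X))))
    = fmap P (fmap P (fmap T (fmap P (mu mT X)))) ∘ fmap P (O (P (T (T X)))).
    by rewrite -!fmapD dlaw_nat !fmapD.
  rewrite (reas E2) !compA.
  have E3 : fmap P (fmap P (O (T X))) ∘ fmap P (fmap P (fmap T (fmap P (mu mT X))))
    = fmap P (fmap P (fmap P (fmap T (mu mT X)))) ∘ fmap P (fmap P (O (T (T X)))).
    by rewrite -!fmapD dlaw_nat !fmapD.
  rewrite (reas E3) !compA.
  have E4 : fmap P (mu mP (T (T X))) ∘ fmap P (fmap P (fmap P (fmap T (mu mT X))))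
    = fmap P (fmap P (fmap T (mu mT X))) ∘ fmap P (mu mP (T (T (T X)))).
    by rewrite -!fmapD mu_nat !fmapD.
  rewrite (reas E4) !compA.
  have E5 : fmap P (fmap P (mu mT X)) ∘ fmap P (fmap P (fmap T (mu mT X)))
    = fmap P (fmap P (mu mT X)) ∘ fmap P (fmap P (mu mT (T X))).
    by rewrite -!fmapD muA !fmapD.
  rewrite (reas E5) !compA.
  have E6 (A B : C) (g : Hom A B) :
    fmap P (fmap P g) ∘ fmap P (mu mP A) = fmap P (mu mP B) ∘ fmap P (fmap P (fmap P g)).
    by rewrite -!fmapD mu_nat !fmapD.
  rewrite (reas (E6 _ _ _)) !compA (reas (E6 _ _ _)) !compA muA.
  have E7 : fmap P (O (P (T (T X)))) ∘ fmap P (fmap T (fmap P (O (T X))))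
    = fmap P (fmap P (fmap T (O (T X)))) ∘ fmap P (O (T (P (T X)))).
    by rewrite -!fmapD dlaw_nat !fmapD.
  by rewrite (reas E7) !compA.
- rewrite !fmapD !compA.
  rewrite (reas (eq_sym (mu_nat mP _))) !compA.
  have E1 : fmap P (fmap P (O (T X))) ∘ fmap P (fmap P (mu mT (P (T X))))
    = fmap P (fmap P (fmap P (mu mT (T X)))) ∘ fmap P (fmap P (O (T (T X))))
      ∘ fmap P (fmap P (fmap T (O (T X)))).
    by rewrite -!fmapD dlaw_muT !fmapD.
  by rewrite (reas E1) !compA (reas (eq_sym (mu_nat mP _))) !compA.
Qed.

Lemma composite_mu_eta (X : C) :
  composite_mu X ∘ composite_eta (P (T X)) = idc (P (T X)).
Proof.
rewrite /composite_mu /composite_eta !compA.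
rewrite (reas (eq_sym (eta_nat mP _))) !compA (reas (dlaw_etaT O _)).
rewrite (reas (eq_sym (eta_nat mP _))) !compA mu_eta comp1f.
by rewrite -fmapD mu_eta fmap1.
Qed.

Lemma composite_mu_Teta (X : C) :
  composite_mu X ∘ fmap P (fmap T (composite_eta X)) = idc (P (T X)).
Proof.
rewrite /composite_mu /composite_eta !fmapD !compA.
have E : fmap P (O (T X)) ∘ fmap P (fmap T (eta mP (T X)))
  = fmap P (eta mP (T (T X))) by rewrite -fmapD dlaw_eta.
rewrite (reas E).
have E' : fmap P (fmap P (mu mT X)) ∘ fmap P (eta mP (T (T X)))
  = fmap P (eta mP (T X)) ∘ fmap P (mu mT X) by rewrite -!fmapD eta_nat.
by rewrite (reas E') !compA mu_Teta comp1f -fmapD mu_Teta fmap1.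
Qed.

Definition composite_monad : Monad (compF P T).
Proof.
refine (@Build_Monad C (compF P T) composite_mu composite_eta _ _ _ _ _).
- exact: composite_mu_nat.
- abstract (by move=> X Y f;
    rewrite /composite_eta -compA (eta_nat mT) compA [in LHS](eta_nat mP) compA).
- exact: composite_muA.
- exact: composite_mu_eta.
- exact: composite_mu_Teta.
Defined.

Definition lift_module (A : Module mT) : Module mT.
Proof.
refine (@Build_Module C T mT (P (mcar A)) (fmap P (mact A) ∘ O (mcar A)) _ _).
- abstract (by rewrite fmapD -!compA (compA (O _) (fmap T (fmap P _)))
    dlaw_nat dlaw_muT !compA -!fmapD mactM).
- abstract (by rewrite -compA dlaw_etaT -fmapD mact1 fmap1).
Defined.
End DistrLawTheory.

Definition IsHalfBraiding (A : MonCat) (Q : Functor A A) (cQ : Comonoidal Q)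
    (M : A) (s : forall Y : A, Hom (M ⊗ Y) (Q Y ⊗ M)) : Prop :=
  (forall (Y Y' : A) (g : Hom Y Y'),
     s Y' ∘ (idc M ⊠ g) = (fmap Q g ⊠ idc M) ∘ s Y)
  /\ (forall Y Z : A,
     asc (Q Y) (Q Z) M ∘ (com2 cQ Y Z ⊠ idc M) ∘ s (Y ⊗ Z) ∘ asc M Y Z
     = (idc (Q Y) ⊠ s Z) ∘ asc (Q Y) M Z ∘ (s Y ⊠ idc Z))
  /\ lun M ∘ (com0 cQ ⊠ idc M) ∘ s one = run M.

Section HalfBraidings.
Variable A : MonCat.

Definition hb_push (F G : Functor A A) (a : forall X : A, Hom (F X) (G X))
    (M : A) (s : forall Y : A, Hom (M ⊗ Y) (F Y ⊗ M)) (Y : A) :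
    Hom (M ⊗ Y) (G Y ⊗ M) :=
  (a Y ⊠ idc M) ∘ s Y.

Lemma hb_pushP (F G : Functor A A) (cF : Comonoidal F) (cG : Comonoidal G)
    (a : forall X : A, Hom (F X) (G X)) (M : A)
    (s : forall Y : A, Hom (M ⊗ Y) (F Y ⊗ M)) :
  (forall (X Y : A) (f : Hom X Y), a Y ∘ fmap F f = fmap G f ∘ a X) ->
  IsComonoidalNat cF cG a ->
  IsHalfBraiding cF s -> IsHalfBraiding cG (hb_push (F := F) (G := G) a s).
Proof.
move=> an [a2 a0] [sn [s2 s0]]; rewrite /hb_push; split; last split.
- move=> Y Y' g; rewrite -compA sn !compA -!tensmD.
  by rewrite an compf1.
- move=> Y Z.
  rewrite !compA (reas (eq_sym (tensmD _ _ _ _))) a2 comp1f tensm_l !compA.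
  rewrite tensmA -!compA (compA (com2 _ _ _ ⊠ _)) (compA (asc _ _ _)).
  rewrite (compA (asc _ _ _)) s2 tensm_r tensm_l !compA.
  rewrite (reas (tensmA_l _ _ _)) !compA; do 2 congr (_ ∘ _).
  by rewrite -!tensmD !compf1 !comp1f.
- by rewrite !compA (reas (eq_sym (tensmD _ _ _ _))) a0 comp1f s0.
Qed.

Definition hb_comp (F G : Functor A A) (M N : A)
    (s : forall Y : A, Hom (M ⊗ Y) (F Y ⊗ M))
    (t : forall Y : A, Hom (N ⊗ Y) (G Y ⊗ N)) (Y : A) :
    Hom (M ⊗ N ⊗ Y) (compF F G Y ⊗ (M ⊗ N)) :=
  asc (F (G Y)) M N ∘ (s (G Y) ⊠ idc N) ∘ asc' M (G Y) N
    ∘ (idc M ⊠ t Y) ∘ asc M N Y.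

Lemma hb_compP (F G : Functor A A) (cF : Comonoidal F) (cG : Comonoidal G)
    (M N : A) (s : forall Y : A, Hom (M ⊗ Y) (F Y ⊗ M))
    (t : forall Y : A, Hom (N ⊗ Y) (G Y ⊗ N)) :
  IsHalfBraiding cF s -> IsHalfBraiding cG t ->
  IsHalfBraiding (Comonoidal_comp cF cG) (hb_comp (F := F) (G := G) s t).
Proof.
move=> [sn [s2 s0]] [tn [t2 t0]]; rewrite /hb_comp; split; last split.
- move=> Y Y' g.
  have E1 : asc M N Y' ∘ (idc (M ⊗ N) ⊠ g) = (idc M ⊠ (idc N ⊠ g)) ∘ asc M N Y.
    exact: tensmA_r.
  have E2 : (idc M ⊠ t Y') ∘ (idc M ⊠ (idc N ⊠ g))
    = (idc M ⊠ (fmap G g ⊠ idc N)) ∘ (idc M ⊠ t Y) by rewrite -!tensm_r tn.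
  have E3 : (s (G Y') ⊠ idc N) ∘ ((idc M ⊠ fmap G g) ⊠ idc N)
    = ((fmap F (fmap G g) ⊠ idc M) ⊠ idc N) ∘ (s (G Y) ⊠ idc N).
    by rewrite -!tensm_l sn.
  rewrite (reas E1) !compA (reas E2) !compA (reas (tensmA'_m _ _ _)) !compA.
  by rewrite (reas E3) !compA tensmA_l.
- move=> Y Z; rewrite !compA.
  pose N1 := (idc (F (G Y)) ⊠ asc (F (G Z)) M N)
    ∘ (idc (F (G Y)) ⊠ (s (G Z) ⊠ idc N))
    ∘ (idc (F (G Y)) ⊠ asc' M (G Z) N) ∘ asc (F (G Y)) M (G Z ⊗ N)
    ∘ (s (G Y) ⊠ idc (G Z ⊗ N)) ∘ (idc (M ⊗ G Y) ⊠ t Z)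
    ∘ asc (M ⊗ G Y) N Z ∘ (asc' M (G Y) N ⊠ idc Z)
    ∘ ((idc M ⊠ t Y) ⊠ idc Z) ∘ (asc M N Y ⊠ idc Z).
  transitivity N1; rewrite /N1.
  + have s2' : (com2 cF (G Y) (G Z) ⊠ idc M) ∘ s (G Y ⊗ G Z)
      = asc' (F (G Y)) (F (G Z)) M ∘ (idc (F (G Y)) ⊠ s (G Z))
        ∘ asc (F (G Y)) M (G Z) ∘ (s (G Y) ⊠ idc (G Z)) ∘ asc' M (G Y) (G Z).
      rewrite -2!(compA (asc' _ _ _)) -s2 -!compA eqhomK compf1 !compA.
      by rewrite eqhomK comp1f.
    have t2' : (com2 cG Y Z ⊠ idc N) ∘ t (Y ⊗ Z) ∘ asc N Y Z
      = asc' (G Y) (G Z) N ∘ (idc (G Y) ⊠ t Z) ∘ asc (G Y) N Z ∘ (t Y ⊠ idc Z).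
      by rewrite -2!(compA (asc' _ _ _)) -t2 !compA eqhomK comp1f.
    rewrite /= tensm_l !compA.
    have C1 : asc M N (Y ⊗ Z) ∘ asc (M ⊗ N) Y Z
      = (idc M ⊠ asc N Y Z) ∘ asc M (N ⊗ Y) Z ∘ (asc M N Y ⊠ idc Z) by coh.
    rewrite (reas C1) !compA.
    rewrite (reas (eq_sym (tensmA_l _ _ (fmap F (com2 cG Y Z))))) !compA.
    have E1 : ((fmap F (com2 cG Y Z) ⊠ idc M) ⊠ idc N) ∘ (s (G (Y ⊗ Z)) ⊠ idc N)
      = (s (G Y ⊗ G Z) ⊠ idc N) ∘ ((idc M ⊠ com2 cG Y Z) ⊠ idc N).
      by rewrite -!tensm_l sn.
    rewrite (reas E1) !compA (reas (eq_sym (tensmA'_m _ _ _))) !compA.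
    have E2 : (idc M ⊠ (com2 cG Y Z ⊠ idc N)) ∘ (idc M ⊠ t (Y ⊗ Z))
        ∘ (idc M ⊠ asc N Y Z)
      = (idc M ⊠ asc' (G Y) (G Z) N) ∘ (idc M ⊠ (idc (G Y) ⊠ t Z))
        ∘ (idc M ⊠ asc (G Y) N Z) ∘ (idc M ⊠ (t Y ⊠ idc Z)).
      by rewrite -!tensm_r t2'.
    rewrite (reas3 E2) !compA.
    rewrite (reas (eq_sym (tensmA_l _ _ (com2 cF (G Y) (G Z))))) !compA.
    have E3 : ((com2 cF (G Y) (G Z) ⊠ idc M) ⊠ idc N) ∘ (s (G Y ⊗ G Z) ⊠ idc N)
      = (asc' (F (G Y)) (F (G Z)) M ⊠ idc N)
        ∘ ((idc (F (G Y)) ⊠ s (G Z)) ⊠ idc N)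
        ∘ (asc (F (G Y)) M (G Z) ⊠ idc N) ∘ ((s (G Y) ⊠ idc (G Z)) ⊠ idc N)
        ∘ (asc' M (G Y) (G Z) ⊠ idc N).
      by rewrite -!tensm_l s2'.
    rewrite (reas E3) !compA.
    have C2 : asc (F (G Y)) (F (G Z)) (M ⊗ N) ∘ asc (F (G Y) ⊗ F (G Z)) M N
        ∘ (asc' (F (G Y)) (F (G Z)) M ⊠ idc N)
      = (idc (F (G Y)) ⊠ asc (F (G Z)) M N) ∘ asc (F (G Y)) (F (G Z) ⊗ M) N.
      by coh.
    rewrite C2 (reas (tensmA_m _ _ _)) !compA.
    have C3 : asc (F (G Y)) (M ⊗ G Z) N ∘ (asc (F (G Y)) M (G Z) ⊠ idc N)
      = (idc (F (G Y)) ⊠ asc' M (G Z) N) ∘ asc (F (G Y)) M (G Z ⊗ N)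
        ∘ asc (F (G Y) ⊗ M) (G Z) N by coh.
    rewrite (reas C3) !compA (reas (tensmA_l _ _ (s (G Y)))) !compA.
    have C4 : asc (M ⊗ G Y) (G Z) N ∘ (asc' M (G Y) (G Z) ⊠ idc N)
        ∘ asc' M (G Y ⊗ G Z) N ∘ (idc M ⊠ asc' (G Y) (G Z) N)
      = asc' M (G Y) (G Z ⊗ N) by coh.
    rewrite -(compA _ (asc' M _ N)) (reas3 (eq_trans (compA _ _ _) C4)).
    rewrite (reas (tensmA'_r _ _ _)) !compA.
    have C5 : asc' M (G Y) (N ⊗ Z) ∘ (idc M ⊠ asc (G Y) N Z)
      = asc (M ⊗ G Y) N Z ∘ (asc' M (G Y) N ⊠ idc Z) ∘ asc' M (G Y ⊗ N) Z by coh.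
    rewrite (reas C5) !compA (reas (tensmA'_m _ _ _)) !compA.
    by rewrite (reas (eqhomK _ _)) compf1.
  + rewrite !tensm_r !tensm_l !compA.
    have C1 : (idc (F (G Y)) ⊠ asc M N Z) ∘ asc (F (G Y)) (M ⊗ N) Z
        ∘ (asc (F (G Y)) M N ⊠ idc Z)
      = asc (F (G Y)) M (N ⊗ Z) ∘ asc (F (G Y) ⊗ M) N Z by coh.
    rewrite /= (reas3 C1) !compA (reas (eq_sym (tensmA_r _ _ (t Z)))) !compA.
    rewrite (reas (tensmA_l _ _ (s (G Y)))) !compA.
    by rewrite (reas (tensm_xchg _ _)) !compA.
- rewrite /= tensm_l !compA.
  rewrite (reas (eq_sym (tensmA_l _ _ (fmap F (com0 cG))))) !compA.
  have E1 : ((fmap F (com0 cG) ⊠ idc M) ⊠ idc N) ∘ (s (G one) ⊠ idc N)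
      = (s one ⊠ idc N) ∘ ((idc M ⊠ com0 cG) ⊠ idc N) by rewrite -!tensm_l sn.
  rewrite (reas E1) !compA (reas (eq_sym (tensmA'_m _ _ _))) !compA.
  rewrite (reas (eq_sym (tensmA_l _ _ (com0 cF)))) !compA.
  have C1 : lun (M ⊗ N) ∘ asc one M N = lun M ⊠ idc N by coh.
  rewrite C1.
  have E2 : (lun M ⊠ idc N) ∘ ((com0 cF ⊠ idc M) ⊠ idc N) ∘ (s one ⊠ idc N)
    = run M ⊠ idc N by rewrite -!tensm_l s0.
  have C2 : (run M ⊠ idc N) ∘ asc' M one N = idc M ⊠ lun N by coh.
  rewrite E2 C2.
  have E3 : (idc M ⊠ lun N) ∘ (idc M ⊠ (com0 cG ⊠ idc N)) ∘ (idc M ⊠ t one)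
    = idc M ⊠ run N by rewrite -!tensm_r t0.
  by rewrite E3; coh.
Qed.

Lemma push2_slide (U U' V V' W M N S : A) (a : Hom U W) (a' : Hom V U)
    (b : Hom U' W) (b' : Hom V U') (f : Hom M N)
    (x : Hom V' (V ⊗ M)) (x' : Hom S (V ⊗ N)) (z : Hom V' S) :
  a ∘ a' = b ∘ b' -> (idc V ⊠ f) ∘ x = x' ∘ z ->
  (idc W ⊠ f) ∘ ((a ⊠ idc M) ∘ ((a' ⊠ idc M) ∘ x))
  = (b ⊠ idc N) ∘ ((b' ⊠ idc N) ∘ x') ∘ z.
Proof.
move=> E1 E2; rewrite !compA tensm_xchg (reas (tensm_xchg _ _)) !compA.
by rewrite (reas E2) !compA -!tensm_l E1.
Qed.

Lemma push2_cancel (U V' W M N S : A) (a : Hom U W) (a' : Hom W U)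
    (f : Hom M N) (x : Hom V' (W ⊗ M)) (x' : Hom S (W ⊗ N)) (z : Hom V' S) :
  a ∘ a' = idc W -> (idc W ⊠ f) ∘ x = x' ∘ z ->
  (idc W ⊠ f) ∘ ((a ⊠ idc M) ∘ ((a' ⊠ idc M) ∘ x)) = x' ∘ z.
Proof.
move=> E1 E2; rewrite (compA (a ⊠ _)) -tensm_l E1 tensm1 comp1f.
exact: E2.
Qed.

Definition hb_one (Y : A) : Hom (one ⊗ Y) (idF A Y ⊗ one) := run' Y ∘ lun Y.

Lemma hb_oneP : IsHalfBraiding (Comonoidal_id A) hb_one.
Proof.
rewrite /hb_one; split; last split => /=.
- move=> Y Y' g; apply: (eqhom_cancel_l (e := tens1r Y')).
  rewrite !compA eqhomK comp1f tensm1l tensm1r.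
  by rewrite (reas (eqhomK _ _)) compf1.
- move=> Y Z; rewrite tensm1; coh.
- rewrite tensm1; coh.
Qed.

Definition IsBraidedHom (F : Functor A A) (M N : A)
    (s : forall Y : A, Hom (M ⊗ Y) (F Y ⊗ M))
    (t : forall Y : A, Hom (N ⊗ Y) (F Y ⊗ N)) (f : Hom M N) : Prop :=
  forall Y : A, (idc (F Y) ⊠ f) ∘ s Y = t Y ∘ (f ⊠ idc Y).

Lemma hb_push_hom (F G : Functor A A) (a : forall X : A, Hom (F X) (G X))
    (M N : A) (s : forall Y : A, Hom (M ⊗ Y) (F Y ⊗ M))
    (t : forall Y : A, Hom (N ⊗ Y) (F Y ⊗ N)) (f : Hom M N) :
  IsBraidedHom s t f ->
  IsBraidedHom (F := G) (hb_push (F := F) (G := G) a s)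
    (hb_push (F := F) (G := G) a t) f.
Proof.
move=> E Y; rewrite /hb_push !compA tensm_xchg.
by rewrite -!compA E.
Qed.

Lemma hb_comp_hom (F G : Functor A A) (M M' N N' : A)
    (s : forall Y : A, Hom (M ⊗ Y) (F Y ⊗ M))
    (s' : forall Y : A, Hom (M' ⊗ Y) (F Y ⊗ M'))
    (t : forall Y : A, Hom (N ⊗ Y) (G Y ⊗ N))
    (t' : forall Y : A, Hom (N' ⊗ Y) (G Y ⊗ N')) (f : Hom M M') (g : Hom N N') :
  IsBraidedHom s s' f -> IsBraidedHom t t' g ->
  IsBraidedHom (F := compF F G) (hb_comp (F := F) (G := G) s t)
    (hb_comp (F := F) (G := G) s' t') (f ⊠ g).
Proof.
move=> Ef Eg Y; rewrite /hb_comp /= !compA.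
rewrite -tensmA (reas (eq_sym (tensmD _ _ _ _))) Ef.
rewrite (reas (tensmA _ _ _)) !compA (reas (eq_sym (tensmD _ _ _ _))).
rewrite -Eg comp1f.
have -> : (s' (G Y) ∘ (f ⊠ idc (G Y))) ⊠ (g ∘ idc N)
  = (s' (G Y) ⊠ idc N') ∘ ((f ⊠ idc (G Y)) ⊠ g).
  by rewrite -tensmD comp1f compf1.
rewrite !compA (reas (eq_sym (tensmA' _ _ _))) !compA.
by rewrite (reas (eq_sym (tensmD _ _ _ _))) compf1.
Qed.

Lemma hb_push_push (F G H : Functor A A) (a : forall X : A, Hom (F X) (G X))
    (b : forall X : A, Hom (G X) (H X)) (M : A)
    (s : forall Y : A, Hom (M ⊗ Y) (F Y ⊗ M)) (Y : A) :
  hb_push (F := G) (G := H) b (hb_push (F := F) (G := G) a s) Y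
  = hb_push (F := F) (G := H) (fun X => b X ∘ a X) s Y.
Proof. by rewrite /hb_push compA tensm_l. Qed.

Lemma hb_comp_pushl (F F' G : Functor A A) (a : forall X : A, Hom (F X) (F' X))
    (M N : A) (s : forall Y : A, Hom (M ⊗ Y) (F Y ⊗ M))
    (t : forall Y : A, Hom (N ⊗ Y) (G Y ⊗ N)) (Y : A) :
  hb_comp (F := F') (G := G) (hb_push (F := F) (G := F') a s) t Y
  = (a (G Y) ⊠ idc (M ⊗ N)) ∘ hb_comp (F := F) (G := G) s t Y.
Proof.
by rewrite /hb_comp /hb_push tensm_l !compA tensmA_l.
Qed.

Lemma hb_comp_pushr (F G G' : Functor A A) (b : forall X : A, Hom (G X) (G' X))
    (M N : A) (s : forall Y : A, Hom (M ⊗ Y) (F Y ⊗ M))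
    (t : forall Y : A, Hom (N ⊗ Y) (G Y ⊗ N)) (Y : A) :
  (forall (Y Y' : A) (g : Hom Y Y'),
     s Y' ∘ (idc M ⊠ g) = (fmap F g ⊠ idc M) ∘ s Y) ->
  hb_comp (F := F) (G := G') s (hb_push (F := G) (G := G') b t) Y
  = (fmap F (b Y) ⊠ idc (M ⊗ N)) ∘ hb_comp (F := F) (G := G) s t Y.
Proof.
move=> sn; rewrite /hb_comp /hb_push tensm_r !compA.
rewrite (reas (tensmA'_m _ _ _)) !compA.
have E : (s (G' Y) ⊠ idc N) ∘ ((idc M ⊠ b Y) ⊠ idc N)
  = ((fmap F (b Y) ⊠ idc M) ⊠ idc N) ∘ (s (G Y) ⊠ idc N).
  by rewrite -!tensm_l sn.
by rewrite (reas E) !compA tensmA_l.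
Qed.

Lemma hb_compA (F G H : Functor A A) (M N P : A)
    (s : forall Y : A, Hom (M ⊗ Y) (F Y ⊗ M))
    (t : forall Y : A, Hom (N ⊗ Y) (G Y ⊗ N))
    (u : forall Y : A, Hom (P ⊗ Y) (H Y ⊗ P)) (Y : A) :
  (idc (F (G (H Y))) ⊠ asc M N P)
    ∘ hb_comp (F := compF F G) (G := H) (hb_comp (F := F) (G := G) s t) u Y
  = hb_comp (F := F) (G := compF G H) s (hb_comp (F := G) (G := H) t u) Y
    ∘ (asc M N P ⊠ idc Y).
Proof.
rewrite /hb_comp /= !tensm_l !tensm_r !compA.
have C1 : (idc (F (G (H Y))) ⊠ asc M N P) ∘ asc (F (G (H Y))) (M ⊗ N) P
    ∘ (asc (F (G (H Y))) M N ⊠ idc P)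
  = asc (F (G (H Y))) M (N ⊗ P) ∘ asc (F (G (H Y)) ⊗ M) N P by coh.
rewrite C1 (reas (tensmA_l _ _ (s (G (H Y))))) !compA.
have C2 : asc' M (G (H Y)) (N ⊗ P) ∘ (idc M ⊠ asc (G (H Y)) N P)
  = asc (M ⊗ G (H Y)) N P ∘ (asc' M (G (H Y)) N ⊠ idc P)
    ∘ asc' M (G (H Y) ⊗ N) P by coh.
rewrite (reas C2) !compA (reas (tensmA'_m _ _ _)) !compA.
have C3 : asc' M (N ⊗ H Y) P ∘ (idc M ⊠ asc' N (H Y) P)
  = (asc M N (H Y) ⊠ idc P) ∘ asc' (M ⊗ N) (H Y) P ∘ asc' M N (H Y ⊗ P) by coh.
rewrite (reas C3) !compA (reas (tensmA'_r _ _ _)) !compA.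
rewrite -!compA; do 8 congr (_ ∘ _); coh.
Qed.

Lemma hb_comp1l (F : Functor A A) (M : A)
    (s : forall Y : A, Hom (M ⊗ Y) (F Y ⊗ M)) (Y : A) :
  (idc (F Y) ⊠ lun M) ∘ hb_comp (F := idF A) (G := F) hb_one s Y
  = s Y ∘ (lun M ⊠ idc Y).
Proof.
rewrite /hb_comp /hb_one /= !tensm_l !compA.
have C1 : (idc (F Y) ⊠ lun M) ∘ asc (F Y) one M ∘ (run' (F Y) ⊠ idc M)
    ∘ (lun (F Y) ⊠ idc M) ∘ asc' one (F Y) M = lun (F Y ⊗ M) by coh.
rewrite C1 tensm1l -compA; congr (_ ∘ _); coh.
Qed.

Lemma hb_comp1r (F : Functor A A) (M : A)
    (s : forall Y : A, Hom (M ⊗ Y) (F Y ⊗ M)) (Y : A) :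
  (idc (F Y) ⊠ run M) ∘ hb_comp (F := F) (G := idF A) s hb_one Y
  = s Y ∘ (run M ⊠ idc Y).
Proof.
rewrite /hb_comp /hb_one /= !tensm_r !compA.
have C1 : (idc (F Y) ⊠ run M) ∘ asc (F Y) M one = run (F Y ⊗ M) by coh.
rewrite C1 tensm1r -!compA; congr (_ ∘ _); coh.
Qed.
End HalfBraidings.

Section Center.
Variables (A : MonCat) (Q : Functor A A) (cQ : Comonoidal Q).

Record CenterOb := {
  cob :> A;
  hb : forall Y : A, Hom (cob ⊗ Y) (Q Y ⊗ cob);
  hbP : IsHalfBraiding cQ hb }.

Record CenterHom (M N : CenterOb) := {
  chom :> Hom (cob M) (cob N);
  chomP : IsBraidedHom (hb M) (hb N) chom }.

Lemma CenterHom_eq (M N : CenterOb) (f g : CenterHom M N) :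
  chom f = chom g -> f = g.
Proof.
case: f => f Hf; case: g => g Hg /= E; case: _ / E Hg => Hg.
by rewrite (proof_irrelevance _ Hf Hg).
Qed.

Definition CenterHom_id (M : CenterOb) : CenterHom M M.
Proof.
by refine {| chom := idc (cob M) |} => Y; rewrite !tensm1 comp1f compf1.
Defined.

Definition CenterHom_comp (M N P : CenterOb) (g : CenterHom N P)
    (f : CenterHom M N) : CenterHom M P.
Proof.
refine {| chom := chom g ∘ chom f |} => Y.
by rewrite tensm_r tensm_l -compA chomP !compA chomP.
Defined.

Definition CenterCat : Category.
Proof.
refine {| ob := CenterOb; Hom := CenterHom; idc := CenterHom_id;
          comp := CenterHom_comp |}.
- by move=> M N f; apply: CenterHom_eq; rewrite /= comp1f.
- by move=> M N f; apply: CenterHom_eq; rewrite /= compf1.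
- by move=> *; apply: CenterHom_eq; rewrite /= compA.
Defined.

Definition center_forget : Functor CenterCat A.
Proof.
by refine {| fob := fun M : CenterCat => cob M;
             fmap := fun (M N : CenterCat) (f : Hom M N) => chom f |}.
Defined.

Lemma center_eq (M N : CenterOb) (e : cob M = cob N) :
  IsBraidedHom (hb M) (hb N) (eqhom e) -> M = N.
Proof.
rewrite /IsBraidedHom; case: M e => M s Hs; case: N => N t Ht /= e.
case: _ / e t Ht => t Ht E.
have {}E : s = t.
  apply: functional_extensionality_dep => Y.
  by have := E Y; rewrite /= !tensm1 comp1f compf1.
by case: _ / E Ht => Ht; rewrite (proof_irrelevance _ Hs Ht).
Qed.

Lemma chom_eqhom (M N : CenterCat) (e : M = N) (e' : cob M = cob N) :
  chom (eqhom e) = eqhom e'.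
Proof. exact: (fmap_eqhom (F := center_forget)). Qed.

Variable mQ : Monad Q.
Hypothesis Hb : IsBimonad mQ cQ.

(* The half braiding is
   (q_Y ⊠ id) ∘ (hb M (Q Y) ⊠ id) ∘ (id ⊠ hb N Y), up to associativity. *)
Definition center_tens (M N : CenterOb) : CenterOb.
Proof.
refine {| cob := cob M ⊗ cob N;
          hb := hb_push (F := compF Q Q) (G := Q) (mu mQ)
                  (hb_comp (F := Q) (G := Q) (hb M) (hb N)) |}.
abstract (exact: (hb_pushP (F := compF Q Q) (mu_nat mQ) (mu_com Hb)
  (hb_compP (hbP M) (hbP N)))).
Defined.

(* The half braiding is [v_Y : 1 ⊗ Y = Y -> Q Y = Q Y ⊗ 1]. *)
Definition center_one : CenterOb.
Proof.
refine {| cob := one;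
          hb := hb_push (F := idF A) (G := Q) (eta mQ) (hb_one (A := A)) |}.
abstract (exact: (hb_pushP (F := idF A) (eta_nat mQ) (eta_com Hb)
  (hb_oneP A))).
Defined.

Definition center_tensm (M M' N N' : CenterOb) (f : CenterHom M M')
    (g : CenterHom N N') : CenterHom (center_tens M N) (center_tens M' N').
Proof.
refine (@Build_CenterHom (center_tens M N) (center_tens M' N')
  (chom f ⊠ chom g) _).
abstract (exact: (hb_push_hom (F := compF Q Q) (G := Q) (mu mQ)
  (hb_comp_hom (chomP f) (chomP g)))).
Defined.

Lemma center_tensA (M N P : CenterOb) :
  center_tens (center_tens M N) P = center_tens M (center_tens N P).
Proof.
apply: (@center_eq (center_tens (center_tens M N) P)
  (center_tens M (center_tens N P)) (tensA _ _ _)) => Y /=.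
have [sn _] := hbP M.
rewrite {1 3}/hb_push hb_comp_pushl (hb_comp_pushr _ _ _ sn).
apply: push2_slide; first by rewrite muA.
exact: (hb_compA (F := Q) (G := Q) (H := Q)).
Qed.

Lemma center_tens1l (M : CenterOb) : center_tens center_one M = M.
Proof.
apply: (@center_eq (center_tens center_one M) M (tens1l _)) => Y /=.
rewrite {1}/hb_push hb_comp_pushl.
apply: push2_cancel; first exact: mu_eta.
exact: hb_comp1l.
Qed.

Lemma center_tens1r (M : CenterOb) : center_tens M center_one = M.
Proof.
apply: (@center_eq (center_tens M center_one) M (tens1r _)) => Y /=.
have [sn _] := hbP M.
rewrite {1}/hb_push (hb_comp_pushr _ _ _ sn).
apply: push2_cancel; first exact: mu_Teta.
exact: hb_comp1r.
Qed.

Definition CenterMonCat : MonCat.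
Proof.
refine {| mcat := CenterCat;
          tens := center_tens : CenterCat -> CenterCat -> CenterCat;
          one := center_one : CenterCat; tensm := center_tensm;
          tensA := center_tensA; tens1l := center_tens1l;
          tens1r := center_tens1r |}.
- by move=> X Y; apply: CenterHom_eq; rewrite /= tensm1.
- by move=> *; apply: CenterHom_eq; rewrite /= tensmD.
- move=> X X' Y Y' Z Z' f g h; apply: CenterHom_eq => /=.
  rewrite (chom_eqhom (center_tensA X Y Z) (tensA (cob X) (cob Y) (cob Z))).
  rewrite (chom_eqhom (center_tensA X' Y' Z')
             (tensA (cob X') (cob Y') (cob Z'))).
  exact: tensmA.
- move=> X X' f; apply: CenterHom_eq => /=.
  rewrite (chom_eqhom (center_tens1l X) (tens1l (cob X))).
  rewrite (chom_eqhom (center_tens1l X') (tens1l (cob X'))).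
  exact: tensm1l.
- move=> X X' f; apply: CenterHom_eq => /=.
  rewrite (chom_eqhom (center_tens1r X) (tens1r (cob X))).
  rewrite (chom_eqhom (center_tens1r X') (tens1r (cob X'))).
  exact: tensm1r.
Defined.

Lemma center_forget_strict :
  StrictMonoidal (center_forget : Functor CenterMonCat A).
Proof.
refine (@Build_StrictMonoidal CenterMonCat A
  (center_forget : Functor CenterMonCat A) (fun X Y => eq_refl) eq_refl _).
by move=> *; rewrite /= comp1f compf1.
Qed.
End Center.

Section Double.
Variables (C : MonCat) (T : Bimonad C).
Local Notation TC := (ModMonCat (bimonadP T)).
Local Notation m := (bmon T).
Local Notation UT := (forget m : Functor TC C).
Variables (Q : Functor TC TC) (cQ : Comonoidal Q) (Z : Centralizer (cross Q)).

(* [W] is a centralizer of [Q] with [U W = Z U], whose universal morphism at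
   [((M, r), (N, s))] is [(Q s ⊠ id) ∘ zd Z M N]. *)
Definition LiftsCentralizer (W : Centralizer Q) : Prop :=
  exists e : compF UT W = compF Z UT, forall M N : TC,
    (idc (UT (Q N)) ⊠ eqhom (f_equal (fun F : Functor TC C => F M) e))
      ∘ lin (zd W M N)
    = (lin (fmap Q (counit m N)) ⊠ idc (Z (UT M))) ∘ zd Z (UT M) (UT N).

Variable mZ : Monad Z.

Definition IsCanonicalLaw (O : DistrLaw m mZ) : Prop :=
  exists W : Centralizer Q,
    LiftsCentralizer W /\ forall M : TC, W M = lift_module O M.

Variable O : DistrLaw m mZ.

Definition double : Monad (compF Z T) := composite_monad O.

Lemma restrictM (A : Module double) :
  mact A ∘ eta mZ (T A) ∘ fmap T (mact A ∘ eta mZ (T A))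
  = mact A ∘ eta mZ (T A) ∘ mu m A.
Proof.
rewrite fmapD !compA (reas (eta_nat mZ _)) !compA.
have /= E := mactM A; rewrite E /composite_mu !compA.
rewrite (reas (eq_sym (eta_nat mZ (O _)))) !compA (reas (dlaw_eta O _)).
rewrite (reas (eq_sym (eta_nat mZ (fmap Z (mu m A))))) !compA.
rewrite (reas (mu_eta mZ _)) compf1.
by rewrite (reas (eq_sym (eta_nat mZ (mu m A)))) !compA.
Qed.

Lemma restrict1 (A : Module double) :
  mact A ∘ eta mZ (T A) ∘ eta m A = idc (mcar A).
Proof. by have /= E := mact1 A; rewrite -E /composite_eta !compA. Qed.

(* The [T]-module [(M, r ∘ u_(T M))] underlying a module [(M, r)] over the
   double. *)
Definition restrict (A : Module double) : TC :=
  @Build_Module C T m (mcar A) (mact A ∘ eta mZ (T A))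
    (restrictM A) (restrict1 A).

Definition sigma (A : Module double) (N : TC) :
    Hom (UT (restrict A) ⊗ UT N) (UT (Q N) ⊗ UT (restrict A)) :=
  (lin (fmap Q (counit m N)) ⊠ (mact A ∘ fmap Z (eta m (mcar A))))
    ∘ zd Z (mcar A) (UT N).

Lemma restrict_lin (A B : Module double) (f : MHom A B) :
  @IsLinear C T m (restrict A) (restrict B) (lin f).
Proof.
rewrite /IsLinear /= compA (linP f) /=.
by rewrite (reas (eta_nat mZ (fmap T (lin f)))) !compA.
Qed.

Lemma sigma_nat (A B : Module double) (f : MHom A B) (N : TC) :
  (idc (UT (Q N)) ⊠ lin f) ∘ sigma A N
  = sigma B N ∘ (lin f ⊠ idc (UT N)).
Proof.
have E : fmap Z (fmap T (lin f)) ∘ fmap Z (eta m (mcar A))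
  = fmap Z (eta m (mcar B)) ∘ fmap Z (lin f) by rewrite -!fmapD eta_nat.
rewrite /sigma compA -tensmD comp1f compA (linP f) /= (reas E) !compA.
rewrite (reas (zd_nat Z (lin f) (idc (UT N)))) fmap1 !compA -tensmD.
by rewrite compf1.
Qed.

(* [((M, r ∘ u_(T M)), sigma)] is an object of the center relative to [Q] for
   every module [(M, r)] over the double. *)
Record ComparisonWellDefined : Prop := {
  sigma_lin : forall (A : Module double) (N : TC),
    @IsLinear C T m (restrict A ⊗ N) (Q N ⊗ restrict A) (sigma A N);
  sigma_hb : forall A : Module double,
    IsHalfBraiding cQ (M := restrict A)
      (fun N => @Build_MHom C T m (restrict A ⊗ N) (Q N ⊗ restrict A)
                  (sigma A N) (sigma_lin A N)) }.

Variable H : ComparisonWellDefined.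

Definition comparison_ob (A : Module double) : CenterOb cQ :=
  Build_CenterOb (sigma_hb H A).

Definition comparison_hom (A B : Module double) (f : MHom A B) :
  CenterHom (comparison_ob A) (comparison_ob B).
Proof.
refine (@Build_CenterHom TC Q cQ (comparison_ob A) (comparison_ob B)
  (@Build_MHom C T m (restrict A) (restrict B) (lin f) (restrict_lin f)) _).
abstract (move=> N; apply: lin_eq; exact: sigma_nat).
Defined.

(* I (M, r) = ((M, r ∘ u_(T M)), sigma) and I f = f. *)
Definition comparison : Functor (ModCat double) (CenterCat cQ).
Proof.
refine {| fob := (comparison_ob : ModCat double -> CenterCat cQ);
          fmap := comparison_hom |}.
- abstract (by move=> A; apply: CenterHom_eq; apply: lin_eq).
- abstract (by move=> A B D g f; apply: CenterHom_eq; apply: lin_eq).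
Defined.
End Double.

Definition forget_center (C : MonCat) (T : Bimonad C)
    (Q : Functor (ModMonCat (bimonadP T)) (ModMonCat (bimonadP T)))
    (cQ : Comonoidal Q) : Functor (CenterCat cQ) C :=
  compF (forget (bmon T)) (center_forget cQ).

Definition forgetS (C : MonCat) (T : Functor C C) (m : Monad T)
    (c : Comonoidal T) (Hb : IsBimonad m c) :
    StrictFunctor (ModMonCat Hb) C :=
  Build_StrictFunctor (forget_strict Hb).

Definition forget_centerS (C : MonCat) (T : Bimonad C)
    (Q : Functor (ModMonCat (bimonadP T)) (ModMonCat (bimonadP T)))
    (cQ : Comonoidal Q) (mQ : Monad Q) (HQ : IsBimonad mQ cQ) :
    StrictFunctor (CenterMonCat HQ) C :=
  strict_comp (forgetS (bimonadP T))
    (Build_StrictFunctor (center_forget_strict HQ)).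

(* Main.v *)
(** The equations between tensor diagrams are proved in an algebra of all
    arrows of the category, with a partial composition, in which the tensor
    product is strictly associative and unital; the equality of objects that
    strictness provides then never has to be mentioned.

    Natural families [X ⊗ Y -> P Y ⊗ W] are the maps [Z X -> W], and, left
    duals moving [V] to the other side, natural families
    [X ⊗ Y ⊗ V -> P Y ⊗ W] are the maps [Z X ⊗ V -> W].  Applied to
    [P_2 ∂ : X ⊗ Y ⊗ V -> P Y ⊗ P V ⊗ Z X] this gives a half braiding of [Z X]
    with [P], which makes [Z X] the free object on [X] in the center.  So the
    modules of the monad [Z] are the half braidings, and its comonoidal
    structure comes from the tensor product of the center.

    The antipodes provide duals of [T]-modules; hence linear maps
    [F A ⊗ F D -> N] are at the same time the maps [T A ⊗ D -> N] and the maps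
    [A ⊗ T D -> N].  Going from one to the other shows that a map
    [T (Z X) -> W] amounts to a natural family [T (X ⊗ Y) -> P Y ⊗ W], and this
    lifts [Z] to a centralizer [W] of [Q] on [T]-modules, to which the first
    part applies again.  The canonical law is read off the action on [W (F X)],
    and modules over the double are the [W]-modules in the category of
    [T]-modules, that is, the half braidings with [Q]. *)
From Stdlib Require Import ssreflect ProofIrrelevance FunctionalExtensionality.
From Stdlib Require Import ClassicalEpsilon.
Require Import Defs.

Set Implicit Arguments.
Unset Strict Implicit.
Unset Printing Implicit Defensive.

(* The obstacle is that [∂] controls only the maps out of [Z X], whereas an action of [T] on [Z X]
   is a map out of [T (Z X)], and no assumption says how [T] treats universal properties. This is
   where both antipodes enter: extending maps [T A ⊗ D -> N] to linear maps takes right duals of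
   modules, and restricting these faithfully to [A ⊗ T D] takes left duals.

   The lift [W] has the carriers of [Z], but its monad and comonoidal structures come from universal
   equations over modules, with [Q] in place of [Q ⋊ T]. They agree with those of [Z] because the
   equations at free modules [F Y], restricted along [η_Y], are the equations for [Z]. The structure
   maps of [W] are linear by construction, so the agreement makes those of [Z] linear; this is the
   compatibility of the canonical law with product, unit and comonoidal structure.

   All structures are characterized by universal properties, so each is picked by description from
   an existence proof, and its uniqueness is the same cancellation of [∂] that proves its laws. *)
Declare Scope arr_scope.
Delimit Scope arr_scope with arr.
Reserved Notation "g • f" (at level 40, left associativity).
Reserved Notation "f ⊛ g" (at level 38, right associativity).

(** * The strict algebra of arrows *)

Section Arrows.
Variable C : MonCat.

(* [None] stands for the composites that are not defined, so that composition is
   total and associative. *)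

Record arrow := Arrow { adom : C; acod : C; ahom : Hom adom acod }.
Definition arr := option arrow.

Definition mor (X Y : C) (f : Hom X Y) : arr := Some (Arrow f).

(** Agreement of the endpoints is decided classically, and the [eqhom] between them lets arrows
    compose whose middle objects are equal but not convertible, such as [(X ⊗ Y) ⊗ Z] and
    [X ⊗ (Y ⊗ Z)]. *)
Definition acomp (g f : arr) : arr :=
  match g, f with
  | Some b, Some a =>
    match excluded_middle_informative (acod a = adom b) with
    | left e => mor (ahom b ∘ eqhom e ∘ ahom a)
    | right _ => None
    end
  | _, _ => None
  end.

Definition atens (f g : arr) : arr :=
  match f, g with
  | Some a, Some b => mor (ahom a ⊠ ahom b)
  | _, _ => None
  end.

Definition ident (X : C) : arr := mor (idc X).

Definition typed (X : C) (m : arr) (Y : C) : Prop := exists f : Hom X Y, m = mor f.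

End Arrows.
Arguments ident {C} X.
Arguments mor {C X Y} f.

Definition amap (A B : MonCat) (F : Functor A B) (m : arr A) : arr B :=
  match m with
  | Some a => mor (fmap F (ahom a))
  | None => None
  end.
Notation "g • f" := (acomp g f) : arr_scope.
Notation "f ⊛ g" := (atens f g) : arr_scope.
Notation "'ι' X" := (ident X) (at level 8, X at level 8) : arr_scope.
Open Scope arr_scope.

Section ArrowTheory.
Variable C : MonCat.
Implicit Types m n p : arr C.

Lemma mor_hetero (X Y X' Y' : C) (f : Hom X Y) (g : Hom X' Y')
    (e : X = X') (e' : Y = Y') :
  eqhom e' ∘ f = g ∘ eqhom e -> mor f = mor g.
Proof.
by case: _ / e g; case: _ / e' => g; rewrite /= comp1f compf1 => ->.
Qed.

(** An equality of arrows carries equalities of endpoints; for parallel morphisms these are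
    self-equalities, trivial by proof irrelevance. So typed equations can be proved in the
    algebra. *)
Lemma mor_inj (X Y : C) (f g : Hom X Y) : mor f = mor g -> f = g.
Proof.
move=> E.
suff H (a b : arrow C) (e : a = b) : exists (u : adom a = adom b) (v : acod a = acod b),
    eqhom v ∘ ahom a = ahom b ∘ eqhom u.
  have Eab : Arrow f = Arrow g.
    exact: (f_equal (fun m => match m with Some a => a | None => Arrow f end) E).
  have [u [v]] := H _ _ Eab.
  by rewrite /= !eqhom1 comp1f compf1.
by case: _ / e; exists eq_refl, eq_refl; rewrite /= comp1f compf1.
Qed.

Lemma mor_comp (X Y Z : C) (g : Hom Y Z) (f : Hom X Y) :
  mor (g ∘ f) = mor g • mor f.
Proof.
rewrite /acomp /=; case: excluded_middle_informative => [e|]; last by [].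
by rewrite eqhom1 compf1.
Qed.

Lemma mor_tens (X X' Y Y' : C) (f : Hom X X') (g : Hom Y Y') :
  mor (f ⊠ g) = mor f ⊛ mor g.
Proof. by []. Qed.

Lemma mor_id (X : C) : mor (idc X) = ι X.
Proof. by []. Qed.

Lemma mor_eqhom (X Y : C) (e : X = Y) : mor (eqhom e) = ι X.
Proof. by case: _ / e. Qed.

Lemma typed_mor (X Y : C) (f : Hom X Y) : typed X (mor f) Y.
Proof. by exists f. Qed.

Lemma typed_id (X : C) : typed X (ι X) X.
Proof. by exists (idc X). Qed.

Lemma typed_comp (X Y Y' Z : C) m n :
  typed Y m Z -> typed X n Y' -> Y' = Y -> typed X (m • n) Z.
Proof.
move=> [g ->] [f ->] E; case: _ / E g => g.
by exists (g ∘ f); rewrite mor_comp.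
Qed.

Lemma typed_tens (X X' Y Y' : C) m n :
  typed X m X' -> typed Y n Y' -> typed (X ⊗ Y) (m ⊛ n) (X' ⊗ Y').
Proof. by move=> [f ->] [g ->]; exists (f ⊠ g). Qed.

Lemma typed_conv (X X' Y Y' : C) m :
  typed X m Y -> X = X' -> Y = Y' -> typed X' m Y'.
Proof. by move=> H <- <-. Qed.

Lemma acompA m n p : m • (n • p) = m • n • p.
Proof.
case: m n p => [[X Y f]|] [[X' Y' g]|] [[X'' Y'' h]|] //=;
  do ?[case: excluded_middle_informative => //=].
by move=> e e1 e2; rewrite (proof_irrelevance _ e2 e) !compA.
Qed.

Lemma atensA m n p : (m ⊛ n) ⊛ p = m ⊛ (n ⊛ p).
Proof.
case: m n p => [[X Y f]|] [[X' Y' g]|] [[X'' Y'' h]|] //=.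
exact: mor_hetero (tensmA f g h).
Qed.

Lemma atens1l m : ι one ⊛ m = m.
Proof. by case: m => [[X Y f]|] //=; exact: mor_hetero (tensm1l f). Qed.

Lemma atens1r m : m ⊛ ι one = m.
Proof. by case: m => [[X Y f]|] //=; exact: mor_hetero (tensm1r f). Qed.

Lemma id_tens (X Y : C) : ι (X ⊗ Y) = ι X ⊛ ι Y.
Proof. by rewrite /ident -tensm1. Qed.

Lemma acomp1l (X Y : C) m : typed X m Y -> ι Y • m = m.
Proof. by move=> [f ->]; rewrite -mor_comp comp1f. Qed.

Lemma acomp1r (X Y : C) m : typed X m Y -> m • ι X = m.
Proof. by move=> [f ->]; rewrite -mor_comp compf1. Qed.

End ArrowTheory.

Section ArrowMap.
Variables (A B : MonCat) (F : Functor A B).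
Implicit Types m n : arr A.

Lemma mor_fmap (X Y : A) (f : Hom X Y) : mor (fmap F f) = amap F (mor f).
Proof. by []. Qed.

Lemma typed_map (X Y : A) m : typed X m Y -> typed (F X) (amap F m) (F Y).
Proof. by move=> [f ->]; exists (fmap F f). Qed.

Lemma amap_id (X : A) : amap F (ι X) = ι (F X).
Proof. by rewrite /ident -mor_fmap fmap1. Qed.
End ArrowMap.
Arguments acomp : simpl never.
Arguments atens : simpl never.
Arguments mor : simpl never.
Arguments ident : simpl never.
Arguments amap : simpl never.

(** The way back from the algebra: a formula with the right endpoints denotes a morphism, unique by
    [mor_inj]. *)
Definition realize (C : MonCat) (X Y : C) (m : arr C) (H : typed X m Y) : Hom X Y :=
  proj1_sig (constructive_indefinite_description _ H).

Lemma realizeE (C : MonCat) (X Y : C) (m : arr C) (H : typed X m Y) :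
  mor (realize H) = m.
Proof. by rewrite /realize; case: constructive_indefinite_description. Qed.

Ltac obeq :=
  first [ reflexivity | cbn; rewrite ?tensA ?tens1l ?tens1r; reflexivity ].

Ltac infer_type :=
  lazymatch goal with
  | |- typed _ (_ • _) _ => eapply typed_comp; [infer_type | infer_type | obeq]
  | |- typed _ (_ ⊛ _) _ => eapply typed_tens; infer_type
  | |- typed _ (ident _) _ => apply typed_id
  | |- typed _ (mor _) _ => apply typed_mor
  | |- typed _ (amap _ _) _ => eapply typed_map; infer_type
  | |- _ => eassumption
  end.

Ltac ty := eapply typed_conv; [infer_type | obeq | obeq].

Section Whisker.
Variable C : MonCat.
Implicit Types m n p : arr C.

Lemma wl_comp (A X Y Y' Z : C) m n :
  typed Y m Z -> typed X n Y' -> Y' = Y ->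
  ι A ⊛ (m • n) = (ι A ⊛ m) • (ι A ⊛ n).
Proof.
move=> [f ->] [g ->] E; case: _ / E f => f.
by rewrite -(mor_comp f g) -!mor_id -!mor_tens -mor_comp tensm_r.
Qed.

Lemma wr_comp (A X Y Y' Z : C) m n :
  typed Y m Z -> typed X n Y' -> Y' = Y ->
  (m • n) ⊛ ι A = (m ⊛ ι A) • (n ⊛ ι A).
Proof.
move=> [f ->] [g ->] E; case: _ / E f => f.
by rewrite -(mor_comp f g) -!mor_id -!mor_tens -mor_comp tensm_l.
Qed.

Lemma xchg (X X' Y Y' : C) m n : typed X m X' -> typed Y n Y' ->
  (ι X' ⊛ n) • (m ⊛ ι Y) = (m ⊛ ι Y') • (ι X ⊛ n).
Proof.
move=> [f ->] [g ->].
by rewrite -!mor_id -!mor_tens -!mor_comp tensm_xchg.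
Qed.

Lemma tens_slices (X X' Y Y' : C) m n : typed X m X' -> typed Y n Y' ->
  m ⊛ n = (m ⊛ ι Y') • (ι X ⊛ n).
Proof.
move=> [f ->] [g ->].
by rewrite -!mor_id -!mor_tens -!mor_comp -tensm_lr.
Qed.

End Whisker.

(* In flat form, identities are split along tensors, and tensors and composites
   nest to the right. *)
Ltac split_comp :=
  repeat match goal with
  | |- context [ident ?A ⊛ (?m • ?n)] =>
      erewrite (@wl_comp _ A _ _ _ _ m n); [ | infer_type | infer_type | obeq ]
  | |- context [(?m • ?n) ⊛ (ident ?A ⊛ ?r)] => rewrite -(atensA (m • n) (ident A) r)
  | |- context [(?m • ?n) ⊛ ident ?A] =>
      erewrite (@wr_comp _ A _ _ _ _ m n); [ | infer_type | infer_type | obeq ]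
  end.
Ltac strict_redex X :=
  match X with
  | context [(_ ⊗ _) ⊗ _] => idtac
  | context [one ⊗ _] => idtac
  | context [_ ⊗ one] => idtac
  | context [@mcar _ _ _ (@one _)] => idtac
  | context [@mcar _ _ _ (@tens _ _ _)] => idtac
  end.
Ltac strict := cbn [mcar one tens mcat ModMonCat mod_one mod_tens];
  rewrite ?tensA ?tens1l ?tens1r.
Ltac strict_ident X :=
  strict_redex X;
  let H := fresh in
  eassert (H : ident X = ident _);
  [ strict; reflexivity
  | lazymatch type of H with ?a = ?a => fail | _ => rewrite H; clear H end ].
Ltac strict_idents :=
  repeat match goal with |- context [ident ?X] => strict_ident X end.
Ltac strict_idents_in H :=
  repeat match type of H with context [ident ?X] =>
    strict_redex X;
    let E := fresh in
    eassert (E : ident X = ident _);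
    [ strict; reflexivity
    | lazymatch type of E with ?a = ?a => fail | _ => rewrite E in H; clear E end ]
  end.
Ltac strict_mor f :=
  strict_redex f;
  let H := fresh in
  eassert (H : mor f = mor _);
  [ rewrite ?tensA ?tens1l ?tens1r; reflexivity
  | lazymatch type of H with ?a = ?a => fail | _ => rewrite H; clear H end ].
Ltac strict_mors :=
  repeat match goal with |- context [mor ?f] => strict_mor f end.
Ltac objs := cbn [compF idF fob]; rewrite ?tensA ?tens1l ?tens1r; strict_idents; strict_mors.
Ltac flat := objs; rewrite ?id_tens ?atensA ?atens1l ?atens1r; split_comp;
  rewrite ?atensA -?acompA.
Ltac unmor := rewrite ?(mor_comp, mor_tens, mor_eqhom, mor_id).

Ltac flat_in H :=
  cbn [compF idF fob] in H;
  rewrite ?tensA ?tens1l ?tens1r in H; strict_idents_in H;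
  rewrite ?id_tens ?atensA ?atens1l ?atens1r in H;
  repeat match type of H with
  | context [ident ?A ⊛ (?m • ?n)] =>
      erewrite (@wl_comp _ A _ _ _ _ m n) in H; [ | infer_type | infer_type | obeq ]
  | context [(?m • ?n) ⊛ (ident ?A ⊛ ?r)] => rewrite -(atensA (m • n) (ident A) r) in H
  | context [(?m • ?n) ⊛ ident ?A] =>
      erewrite (@wr_comp _ A _ _ _ _ m n) in H; [ | infer_type | infer_type | obeq ]
  end;
  rewrite ?atensA -?acompA in H.

(* Rewrites with an equation of composites inside a longer composite. *)
Ltac crew E :=
  first [ rewrite E
        | let H := fresh in
          eassert (H : forall k, _);
          [ let k := fresh in let E' := fresh in
            intro k; pose proof (f_equal (fun x => x • k) E) as E';
            cbv beta in E'; rewrite -?acompA in E'; exact E'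
          | rewrite H; clear H ] ].

Ltac wrew A B E :=
  let H := fresh in
  have H := f_equal (fun x => ι A ⊛ (x ⊛ ι B)) E;
  cbv beta in H;
  flat_in H; crew H; clear H.

(** The identities on [A], [B], [D] cover every position of two active arrows in a tensor; an empty
    position is filled with [one]. *)
Lemma xchg5 (C : MonCat) (A X X' B Y Y' D : C) m n : typed X m X' -> typed Y n Y' ->
  (ι A ⊛ ι X' ⊛ ι B ⊛ n ⊛ ι D) • (ι A ⊛ m ⊛ ι B ⊛ ι Y ⊛ ι D)
   = (ι A ⊛ m ⊛ ι B ⊛ ι Y' ⊛ ι D) • (ι A ⊛ ι X ⊛ ι B ⊛ n ⊛ ι D).
Proof.
move=> Hm Hn.
have E := @xchg C X X' (B ⊗ Y) (B ⊗ Y') m (ι B ⊛ n) Hm.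
have {}E := f_equal (fun x => ι A ⊛ (x ⊛ ι D)) (E ltac:(ty)).
flat_in E. rewrite E //.
Qed.

Ltac exch A m B n D :=
  let H := fresh in
  eassert (H := @xchg5 _ A _ _ B _ _ D m n ltac:(infer_type) ltac:(infer_type));
  flat_in H; first [crew H | crew (eq_sym H)]; clear H.

(* A slice is a tensor of identities and one active arrow [m]; [left_objs] and
   [right_objs] give the objects on either side of [m], as right-nested tensors
   that end with the unit. *)
Ltac left_objs C s m :=
  lazymatch s with
  | ident ?X ⊛ ?r => let Y := left_objs C r m in constr:(X ⊗ Y)
  | ?x ⊛ _ => let _ := match goal with _ => unify x m end in constr:(@one C)
  | ?x => let _ := match goal with _ => unify x m end in constr:(@one C)
  end.
Ltac idents_objs C r :=
  lazymatch r with
  | ident ?X ⊛ ?r' => let Y := idents_objs C r' in constr:(X ⊗ Y)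
  | ident ?X => constr:(X ⊗ @one C)
  end.
Ltac right_objs C s m :=
  lazymatch s with
  | ident _ ⊛ ?r => right_objs C r m
  | _ ⊛ ?r => idents_objs C r
  | _ => constr:(@one C)
  end.
Ltac exch_between A m R n D B :=
  first
  [ exch A m B n D
  | lazymatch R with
    | ?X ⊗ ?R' => exch_between A m R' n D constr:(B ⊗ X)
    end ].
Ltac exch_slices C s1 s2 m n :=
  first
  [ let A := left_objs C s1 m in let R := right_objs C s1 m in
    let _ := left_objs C s2 n in
    let D := right_objs C s2 n in exch_between A m R n D constr:(@one C)
  | let A := left_objs C s2 m in let R := right_objs C s2 m in
    let _ := left_objs C s1 n in
    let D := right_objs C s1 n in exch_between A m R n D constr:(@one C) ].
(* Naturality of [m] and [n], active in adjacent slices, [m] to the left of [n]. *)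
Ltac exchange m n :=
  lazymatch type of m with arr ?C =>
    match goal with
    | |- context [?s1 • (?s2 • _)] => exch_slices C s1 s2 m n
    | |- context [?s1 • ?s2] => exch_slices C s1 s2 m n
    end
  end.

Ltac active s :=
  lazymatch s with
  | ident _ ⊛ ?r => active r
  | ?m ⊛ _ => constr:(m)
  | ?m => constr:(m)
  end.
Ltac first_slice e :=
  lazymatch e with
  | ?s • _ => constr:(s)
  | ?s => constr:(s)
  end.
Ltac len P := lazymatch P with _ ⊗ ?R => let n := len R in constr:(S n) | _ => constr:(O) end.
Ltac take_obj C A n :=
  lazymatch n with
  | O => constr:(@one C)
  | S ?n' => lazymatch A with ?X ⊗ ?R => let Y := take_obj C R n' in constr:(X ⊗ Y) end
  end.
Ltac drop_obj A n :=
  lazymatch n with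
  | O => constr:(A)
  | S ?n' => lazymatch A with _ ⊗ ?R => drop_obj R n' end
  end.
Ltac nat_sub a b := let n := eval compute in (Nat.sub a b) in constr:(n).
Ltac place C s E h n1 n2 :=
  let L := left_objs C s h in let R := right_objs C s h in
  let l := len L in let k := nat_sub l n1 in
  let A := take_obj C L k in let B := drop_obj R n2 in
  wrew A B E.
(* Rewrites with [E] tensored with identities on both sides; these are found by
   locating in the goal the active arrow of the first slice of [E]. *)
Ltac srew E :=
  let H := fresh in have H := E; flat_in H;
  lazymatch type of H with @eq (arr ?C) ?lhs _ =>
    let s := first_slice lhs in let h := active s in
    let L := left_objs C s h in let R := right_objs C s h in
    let n1 := len L in let n2 := len R in
    match goal with
    | |- context [?s1 • _] => place C s1 H h n1 n2
    | |- context [_ • ?s1] => place C s1 H h n1 n2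
    | |- context [?s1 = _] => place C s1 H h n1 n2
    | |- _ = ?s1 => place C s1 H h n1 n2
    end
  end; clear H.

Lemma drop_idl (C : MonCat) (X Y Y' : C) m : typed X m Y -> Y = Y' -> ι Y' • m = m.
Proof. by move=> H <-; exact: acomp1l H. Qed.

Lemma drop_idr (C : MonCat) (X Y X' : C) m : typed X m Y -> X = X' -> m • ι X' = m.
Proof. by move=> H <-; exact: acomp1r H. Qed.

Ltac drop_id :=
  rewrite -?id_tens;
  repeat match goal with
  | |- context [ident ?X • ?m] => erewrite (@drop_idl _ _ _ X m); [ | infer_type | obeq ]
  | |- context [?m • ident ?X] => erewrite (@drop_idr _ _ _ X m); [ | infer_type | obeq ]
  end; flat.

(** The two zigzag identities. The predicate makes [D] a left dual of [X] and [X] a right dual of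
    [D], so it serves both sides. *)
Definition dual_pair (C : MonCat) (D X : C) (e : Hom (D ⊗ X) one) (c : Hom one (X ⊗ D)) :=
  (ι X ⊛ mor e) • (mor c ⊛ ι X) = ι X /\ (mor e ⊛ ι D) • (ι D ⊛ mor c) = ι D.

Definition has_left_duals (A : MonCat) :=
  forall X : A, exists D e c, @dual_pair A D X e c.
Definition has_right_duals (A : MonCat) :=
  forall X : A, exists D e c, @dual_pair A X D e c.

Lemma uncurry_curry (C : MonCat) (D V B W : C) (e : Hom (D ⊗ V) one) (c : Hom one (V ⊗ D)) m :
  dual_pair e c -> typed (B ⊗ V) m W ->
  (ι W ⊛ mor e) • (((m ⊛ ι D) • (ι B ⊛ mor c)) ⊛ ι V) = m.
Proof.
move=> [z1 z2] Hm; flat.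
exchange m (mor e).
srew z1.
by drop_id.
Qed.

(** * Centralizers *)

Section CentralizerMaps.
Variables (A : MonCat).
Hypothesis dualA : has_left_duals A.
Variables (P : Functor A A) (cP : Comonoidal P) (Z : Centralizer P).

Lemma zd_natE (X X' Y Y' : A) (f : Hom X X') (g : Hom Y Y') :
  mor (zd Z X' Y') • (mor f ⊛ mor g) = (mor (fmap P g) ⊛ mor (fmap Z f)) • mor (zd Z X Y).
Proof. by have := f_equal mor (zd_nat Z f g); rewrite !mor_comp !mor_tens. Qed.

Lemma zd_natr (X Y Y' : A) (g : Hom Y Y') :
  mor (zd Z X Y') • (ι X ⊛ mor g) = (mor (fmap P g) ⊛ ι (Z X)) • mor (zd Z X Y).
Proof. by have := zd_natE (idc X) g; rewrite fmap1. Qed.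

Lemma zd_natl (X X' Y : A) (f : Hom X X') :
  mor (zd Z X' Y) • (mor f ⊛ ι Y) = (ι (P Y) ⊛ mor (fmap Z f)) • mor (zd Z X Y).
Proof. by have := zd_natE f (idc Y); rewrite fmap1. Qed.

Lemma zd_uniq (X W : A) (r r' : Hom (Z X) W) :
  (forall Y, (ι (P Y) ⊛ mor r) • mor (zd Z X Y) = (ι (P Y) ⊛ mor r') • mor (zd Z X Y)) -> r = r'.
Proof.
move=> E.
have [Y Y' g|q [_ Hq]] := @zd_univ _ _ Z X W (fun Y => (idc (P Y) ⊠ r) ∘ zd Z X Y).
  apply: mor_inj; unmor; flat.
  rewrite zd_natr.
  by exchange (mor (fmap P g)) (mor r).
by rewrite -(Hq r) // -(Hq r') // => Y; apply: mor_inj; unmor; rewrite E.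
Qed.

Lemma zd_exists (X W : A) (xi : forall Y, arr A) :
  (forall Y, typed (X ⊗ Y) (xi Y) (P Y ⊗ W)) ->
  (forall (Y Y' : A) (g : Hom Y Y'),
     xi Y' • (ι X ⊛ mor g) = (mor (fmap P g) ⊛ ι W) • xi Y) ->
  exists r : Hom (Z X) W, forall Y, xi Y = (ι (P Y) ⊛ mor r) • mor (zd Z X Y).
Proof.
move=> T N.
have [Y Y' g|r [Hr _]] := @zd_univ _ _ Z X W (fun Y => realize (T Y)).
  by apply: mor_inj; unmor; rewrite !realizeE N.
by exists r => Y; rewrite -(realizeE (T Y)) Hr; unmor.
Qed.

Lemma zd_param_uniq (X V W : A) (r r' : arr A) : typed (Z X ⊗ V) r W -> typed (Z X ⊗ V) r' W ->
  (forall Y, (ι (P Y) ⊛ r) • (mor (zd Z X Y) ⊛ ι V)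
           = (ι (P Y) ⊛ r') • (mor (zd Z X Y) ⊛ ι V)) -> r = r'.
Proof.
move=> T T' E; have [D [e [c d]]] := dualA V.
rewrite -(uncurry_curry d T) -(uncurry_curry d T').
have S r0 : typed (Z X ⊗ V) r0 W -> typed (Z X) ((r0 ⊛ ι D) • (ι (Z X) ⊛ mor c)) (W ⊗ D) by move=> T0; ty.
rewrite -(realizeE (S r T)) -(realizeE (S r' T')).
rewrite (zd_uniq (r := realize (S r T)) (r' := realize (S r' T'))) // => Y.
rewrite !realizeE; flat.
exchange (mor (zd Z X Y)) (mor c).
have {}E := E Y. srew E.
exchange (mor (zd Z X Y)) (mor c). done.
Qed.

Lemma zd_param (X V W : A) (xi : forall Y, arr A) :
  (forall Y, typed (X ⊗ Y ⊗ V) (xi Y) (P Y ⊗ W)) ->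
  (forall (Y Y' : A) (g : Hom Y Y'),
     xi Y' • (ι X ⊛ mor g ⊛ ι V) = (mor (fmap P g) ⊛ ι W) • xi Y) ->
  exists r : Hom (Z X ⊗ V) W, forall Y, xi Y = (ι (P Y) ⊛ mor r) • (mor (zd Z X Y) ⊛ ι V).
Proof.
move=> T N; have [D [e [c d]]] := dualA V.
have [Y|Y Y' g|r0 Hr0] := @zd_exists X (W ⊗ D) (fun Y => (xi Y ⊛ ι D) • (ι (X ⊗ Y) ⊛ mor c)).
- have := T Y => ?. ty.
- have := T Y' => ?; have := T Y => ?. flat.
  exchange (mor g) (mor c). by srew (N Y Y' g).
- have Tr : typed (Z X ⊗ V) ((ι W ⊛ mor e) • (mor r0 ⊛ ι V)) W by ty.
exists (realize Tr) => Y; rewrite realizeE.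
have := T Y => TY.
rewrite -(uncurry_curry d TY) Hr0. flat. done.
Qed.
End CentralizerMaps.

Lemma monad_eq (C : Category) (T : Functor C C) (m n : Monad T) :
  (forall X, mu m X = mu n X) -> (forall X, eta m X = eta n X) -> m = n.
Proof.
case: m => m1 e1 ? ? ? ? ?; case: n => m2 e2 ? ? ? ? ? /= Em Ee.
have {}Em : m1 = m2 by apply: functional_extensionality_dep.
have {}Ee : e1 = e2 by apply: functional_extensionality_dep.
by subst; f_equal; exact: proof_irrelevance.
Qed.

(** * The monad structure of a centralizer *)

Section CentralizerMonad.
Variables (A : MonCat).
Hypothesis dualA : has_left_duals A.
Variables (P : Functor A A) (cP : Comonoidal P) (Z : Centralizer P).

Lemma com2_natr (X Y Y' : A) (g : Hom Y Y') :
  mor (com2 cP X Y') • amap P (ι X ⊛ mor g) = (ι (P X) ⊛ mor (fmap P g)) • mor (com2 cP X Y).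
Proof. by have := f_equal mor (com2_nat cP (idc X) g); unmor; rewrite fmap1. Qed.

Lemma com2_natl (X X' Y : A) (f : Hom X X') :
  mor (com2 cP X' Y) • amap P (mor f ⊛ ι Y) = (mor (fmap P f) ⊛ ι (P Y)) • mor (com2 cP X Y).
Proof. by have := f_equal mor (com2_nat cP f (idc Y)); unmor; rewrite fmap1. Qed.

Lemma com2_assoc (X Y W : A) :
  (mor (com2 cP X Y) ⊛ ι (P W)) • mor (com2 cP (X ⊗ Y) W)
  = (ι (P X) ⊛ mor (com2 cP Y W)) • mor (com2 cP X (Y ⊗ W)).
Proof.
have := f_equal mor (com2A cP X Y W). unmor.
rewrite mor_fmap mor_eqhom amap_id; flat. by drop_id.
Qed.

Lemma com0_left (X : A) : (mor (com0 cP) ⊛ ι (P X)) • mor (com2 cP one X) = ι (P X).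
Proof.
have := f_equal mor (com01l cP X). unmor.
by rewrite mor_fmap mor_eqhom amap_id; flat; drop_id.
Qed.

Lemma com0_right (X : A) : (ι (P X) ⊛ mor (com0 cP)) • mor (com2 cP X one) = ι (P X).
Proof.
have := f_equal mor (com01r cP X). unmor.
by rewrite mor_fmap mor_eqhom amap_id; flat; drop_id.
Qed.

Lemma zd_uniq_arr (X W : A) (r r' : arr A) : typed (Z X) r W -> typed (Z X) r' W ->
  (forall Y, (ι (P Y) ⊛ r) • mor (zd Z X Y) = (ι (P Y) ⊛ r') • mor (zd Z X Y)) -> r = r'.
Proof.
by move=> [f ->] [f' ->] E; rewrite (zd_uniq E).
Qed.

Lemma zbraid_exists (X Y : A) : exists s : Hom (Z X ⊗ Y) (P Y ⊗ Z X), forall Y1,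
  (mor (com2 cP Y1 Y) ⊛ ι (Z X)) • mor (zd Z X (Y1 ⊗ Y))
  = (ι (P Y1) ⊛ mor s) • (mor (zd Z X Y1) ⊛ ι Y).
Proof.
apply: (zd_param dualA) => [Y1|Y1 Y1' g].
  ty.
flat.
have := zd_natr Z X (g ⊠ idc Y); rewrite mor_tens => ->.
rewrite mor_fmap; have H := com2_natl Y g.
by srew H.
Qed.

Definition zbraid (X Y : A) : Hom (Z X ⊗ Y) (P Y ⊗ Z X) :=
  proj1_sig (constructive_indefinite_description _ (zbraid_exists X Y)).

Lemma zbraidE (X Y1 Y : A) :
  (ι (P Y1) ⊛ mor (zbraid X Y)) • (mor (zd Z X Y1) ⊛ ι Y)
  = (mor (com2 cP Y1 Y) ⊛ ι (Z X)) • mor (zd Z X (Y1 ⊗ Y)).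
Proof. by rewrite /zbraid; case: constructive_indefinite_description. Qed.

Lemma zbraid_natr (X Y Y' : A) (g : Hom Y Y') :
  mor (zbraid X Y') • (ι (Z X) ⊛ mor g) = (mor (fmap P g) ⊛ ι (Z X)) • mor (zbraid X Y).
Proof.
apply: (zd_param_uniq dualA (Z := Z) (W := P Y' ⊗ Z X)) => [||Y1]; try ty.
flat; exchange (mor (zd Z X Y1)) (mor g).
have H := zbraidE X Y1 Y'; srew H.
have H1 := zd_natr Z X (idc Y1 ⊠ g); rewrite mor_tens mor_id in H1; srew H1.
rewrite mor_fmap mor_tens; have H2 := com2_natr Y1 g; srew H2.
have H3 := zbraidE X Y1 Y; srew H3. done.
Qed.

Lemma zbraid_natl (X X' Y : A) (f : Hom X X') :
  mor (zbraid X' Y) • (mor (fmap Z f) ⊛ ι Y) = (ι (P Y) ⊛ mor (fmap Z f)) • mor (zbraid X Y).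
Proof.
apply: (zd_param_uniq dualA (Z := Z) (W := P Y ⊗ Z X')) => [||Y1]; try ty.
flat.
have H := zd_natl Z Y1 f; srew (eq_sym H).
have H' := zbraidE X' Y1 Y; srew H'.
have H1 := zd_natl Z (Y1 ⊗ Y) f; srew H1.
have H3 := zbraidE X Y1 Y; srew H3.
by exchange (mor (com2 cP Y1 Y)) (mor (fmap Z f)).
Qed.

(** Composed with [∂] at a third object, both sides become the threefold comultiplication of [P]
    after [∂] at the triple tensor product, by coassociativity of [P]. *)
Lemma zbraid_tens (X Y1 Y2 : A) :
  (mor (com2 cP Y1 Y2) ⊛ ι (Z X)) • mor (zbraid X (Y1 ⊗ Y2))
  = (ι (P Y1) ⊛ mor (zbraid X Y2)) • (mor (zbraid X Y1) ⊛ ι Y2).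
Proof.
apply: (zd_param_uniq dualA (Z := Z) (W := P Y1 ⊗ P Y2 ⊗ Z X)) => [||Y0]; try ty.
flat.
have H := zbraidE X Y0 (Y1 ⊗ Y2); srew H.
have H1 := zbraidE X Y0 Y1; srew H1.
exchange (mor (com2 cP Y0 Y1)) (mor (zbraid X Y2)).
have H2 := zbraidE X (Y0 ⊗ Y1) Y2; srew H2.
have H3 := com2_assoc Y0 Y1 Y2; srew H3.
by flat.
Qed.

Lemma zbraid_one (X : A) : (mor (com0 cP) ⊛ ι (Z X)) • mor (zbraid X one) = ι (Z X).
Proof.
apply: (zd_uniq_arr (X := X) (W := Z X)) => [||Y0]; try ty.
flat.
have H := zbraidE X Y0 one; srew H.
have H1 := com0_right Y0; srew H1.
by drop_id.
Qed.

(** Half braidings with values in the algebra, so that composites such as an action after [∂]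
    qualify without being realized as morphisms first. *)
Record half_braiding_arr (M : A) (s : A -> arr A) : Prop := {
  hba_typed : forall Y, typed (M ⊗ Y) (s Y) (P Y ⊗ M);
  hba_nat : forall (Y Y' : A) (g : Hom Y Y'),
    s Y' • (ι M ⊛ mor g) = (mor (fmap P g) ⊛ ι M) • s Y;
  hba_tens : forall Y1 Y2,
    (mor (com2 cP Y1 Y2) ⊛ ι M) • s (Y1 ⊗ Y2) = (ι (P Y1) ⊛ s Y2) • (s Y1 ⊛ ι Y2);
  hba_one : (mor (com0 cP) ⊛ ι M) • s one = ι M }.

Lemma half_braidingE (M : A) (s : forall Y, Hom (M ⊗ Y) (P Y ⊗ M)) :
  IsHalfBraiding cP s <-> half_braiding_arr M (fun Y => mor (s Y)).
Proof.
split=> [[s1 [s2 s3]] | [_ s1 s2 s3]].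
- split=> [Y|Y Y' g|Y1 Y2|].
  + ty.
  + by have := f_equal mor (s1 _ _ g); unmor.
  + by have := f_equal mor (s2 Y1 Y2); unmor; flat; drop_id.
  + by have := f_equal mor s3; unmor; flat; drop_id.
- split=> [Y Y' g|]; last split=> [Y1 Y2|].
  + by apply: mor_inj; unmor; rewrite s1.
  + apply: mor_inj; unmor; flat; drop_id. exact: s2.
  + apply: mor_inj; unmor; flat; drop_id. exact: s3.
Qed.

Lemma zbraid_half_braiding (X : A) : half_braiding_arr (Z X) (fun Y => mor (zbraid X Y)).
Proof.
split=> [Y|Y Y' g|Y1 Y2|].
- ty.
- exact: zbraid_natr.
- exact: zbraid_tens.
- exact: zbraid_one.
Qed.

Lemma zunit_typed (X : A) :
  typed X ((mor (com0 cP) ⊛ ι (Z X)) • mor (zd Z X one)) (Z X).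
Proof. ty. Qed.

Definition zunit (X : A) : Hom X (Z X) := realize (zunit_typed X).

(** Read through [zbraidE], both sides of the equation defining the product start with [∂_{X,Y1}];
    cancelling it leaves the equation here. So the product classifies the natural family
    [zbraid X]. *)
Lemma zmult_exists (X : A) : exists r : Hom (Z (Z X)) (Z X),
  forall Y, mor (zbraid X Y) = (ι (P Y) ⊛ mor r) • mor (zd Z (Z X) Y).
Proof. by apply: zd_exists => [Y|Y Y' g]; [ty | exact: zbraid_natr]. Qed.

Definition zmult (X : A) : Hom (Z (Z X)) (Z X) :=
  proj1_sig (constructive_indefinite_description _ (zmult_exists X)).

Lemma zmultE (X Y : A) : mor (zbraid X Y) = (ι (P Y) ⊛ mor (zmult X)) • mor (zd Z (Z X) Y).
Proof. by rewrite /zmult; case: constructive_indefinite_description. Qed.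

Lemma zunitE (X : A) : mor (zunit X) = (mor (com0 cP) ⊛ ι (Z X)) • mor (zd Z X one).
Proof. exact: realizeE. Qed.

Lemma zunit_nat (X Y : A) (f : Hom X Y) : zunit Y ∘ f = fmap Z f ∘ zunit X.
Proof.
apply: mor_inj; unmor; rewrite !zunitE; flat.
have H := zd_natl Z one f; flat_in H; crew H.
by exchange (mor (com0 cP)) (mor (fmap Z f)).
Qed.

Lemma zmult_nat (X Y : A) (f : Hom X Y) :
  zmult Y ∘ fmap Z (fmap Z f) = fmap Z f ∘ zmult X.
Proof.
apply: zd_uniq => V; unmor; flat.
have H := zd_natl Z V (fmap Z f); rewrite -H acompA -!zmultE; clear H.
rewrite zbraid_natl zmultE. by flat.
Qed.

(** Counitality of [P] removes the factor [P one]. Thus [∂] is the half braiding of [Z X] restricted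
    to the generators [X]. *)
Lemma zbraid_zunit (X Y : A) : mor (zbraid X Y) • (mor (zunit X) ⊛ ι Y) = mor (zd Z X Y).
Proof.
rewrite zunitE; flat.
exchange (mor (com0 cP)) (mor (zbraid X Y)).
have H := zbraidE X one Y; srew H.
have H1 := com0_left Y; srew H1. by drop_id.
Qed.

(** After cancelling one more [∂], the two sides are the two ways of moving [Y1 ⊗ Y2] past [M]: at
    once, or one factor after the other. For [zbraid X] this is associativity of the monad. *)
Lemma half_braiding_actM (M : A) (r : Hom (Z M) M) s : half_braiding_arr M s ->
  (forall Y, s Y = (ι (P Y) ⊛ mor r) • mor (zd Z M Y)) ->
  r ∘ fmap Z r = r ∘ zmult M.
Proof.
move=> Hs Hr; apply: zd_uniq => Y2; unmor; flat.
rewrite -(zd_natl Z Y2 r) -zmultE acompA -Hr.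
have T := hba_typed Hs Y2.
apply: (zd_param_uniq dualA (Z := Z) (W := P Y2 ⊗ M)) => [||Y1]; try ty.
flat. have H := zbraidE M Y1 Y2; srew H.
exchange (mor (com2 cP Y1 Y2)) (mor r).
have H1 := Hr (Y1 ⊗ Y2). srew (eq_sym H1).
have H2 := Hr Y1. srew (eq_sym H2).
have H3 := hba_tens Hs Y1 Y2. by srew H3.
Qed.

Lemma half_braiding_act1 (M : A) (r : Hom (Z M) M) s : half_braiding_arr M s ->
  (forall Y, s Y = (ι (P Y) ⊛ mor r) • mor (zd Z M Y)) ->
  r ∘ zunit M = idc M.
Proof.
move=> Hs Hr; apply: mor_inj; unmor; rewrite zunitE.
exchange (mor (com0 cP)) (mor r).
by rewrite -Hr (hba_one Hs).
Qed.

Lemma zmultA (X : A) : zmult X ∘ fmap Z (zmult X) = zmult X ∘ zmult (Z X).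
Proof. exact: half_braiding_actM (zbraid_half_braiding X) (zmultE X). Qed.

Lemma zmult_zunit (X : A) : zmult X ∘ zunit (Z X) = idc (Z X).
Proof. exact: half_braiding_act1 (zbraid_half_braiding X) (zmultE X). Qed.

Lemma zmult_Zzunit (X : A) : zmult X ∘ fmap Z (zunit X) = idc (Z X).
Proof.
apply: zd_uniq => Y; unmor; flat.
rewrite -(zd_natl Z Y (zunit X)) acompA -zmultE zbraid_zunit. by drop_id.
Qed.

Definition centralizer_monad : Monad Z :=
  Build_Monad zmult_nat zunit_nat zmultA zmult_zunit zmult_Zzunit.

Lemma centralizer_monadP : IsCentralizerMonad cP centralizer_monad.
Proof.
split=> [X Y1 Y2|X] /=.
- apply: mor_inj; unmor; flat; drop_id.
  have H := zmultE X Y2; srew (eq_sym H).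
  have H1 := zbraidE X Y1 Y2; srew H1. by drop_id.
- by apply: mor_inj; unmor; rewrite zunitE; flat; drop_id.
Qed.

Lemma centralizer_muE (m : Monad Z) : IsCentralizerMonad cP m ->
  forall X Y, mor (zbraid X Y) = (ι (P Y) ⊛ mor (mu m X)) • mor (zd Z (Z X) Y).
Proof.
move=> [H _] X Y.
apply: (zd_param_uniq dualA (Z := Z) (W := P Y ⊗ Z X)) => [||Y1]; try ty.
have := f_equal mor (H X Y1 Y); unmor; flat; drop_id => ->.
have H1 := zbraidE X Y1 Y; srew H1. by drop_id.
Qed.

Lemma centralizer_monad_uniq (m : Monad Z) :
  IsCentralizerMonad cP m -> centralizer_monad = m.
Proof.
move=> Hm; apply: monad_eq => X.
- by apply: zd_uniq => Y; rewrite -zmultE (centralizer_muE Hm).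
- apply: mor_inj; rewrite /= zunitE. case: Hm => _ ->. by unmor; flat; drop_id.
Qed.

End CentralizerMonad.

Lemma comonoidal_eq (A B : MonCat) (F : Functor A B) (c d : Comonoidal F) :
  (forall X Y, com2 c X Y = com2 d X Y) -> com0 c = com0 d -> c = d.
Proof.
case: c => c2 c0 ? ? ? ?; case: d => d2 d0 ? ? ? ? /= E2 E0.
have {}E2 : c2 = d2.
  by apply: functional_extensionality_dep => X; apply: functional_extensionality_dep.
by subst; f_equal; exact: proof_irrelevance.
Qed.

(** * Modules over a centralizer as half braidings *)

Section CentralizerModules.
Variables (A : MonCat).
Hypothesis dualA : has_left_duals A.
Variables (P : Functor A A) (cP : Comonoidal P) (Z : Centralizer P).
Variable m : Monad Z.
Hypothesis Hm : IsCentralizerMonad cP m.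
Local Notation zbraid := (zbraid dualA cP Z).

Lemma zbraid_mu (X Y : A) : mor (zbraid X Y) = (ι (P Y) ⊛ mor (mu m X)) • mor (zd Z (Z X) Y).
Proof. exact: centralizer_muE. Qed.

Lemma zbraid_eta (X Y : A) : mor (zbraid X Y) • (mor (eta m X) ⊛ ι Y) = mor (zd Z X Y).
Proof. by rewrite -(centralizer_monad_uniq dualA Hm) zbraid_zunit. Qed.

Lemma eta_zd (X : A) : mor (eta m X) = (mor (com0 cP) ⊛ ι (Z X)) • mor (zd Z X one).
Proof. by rewrite -(centralizer_monad_uniq dualA Hm) /= zunitE. Qed.

Lemma half_braiding_module (M : A) (r : Hom (Z M) M) (s : A -> arr A) :
  half_braiding_arr cP M s -> (forall Y, s Y = (ι (P Y) ⊛ mor r) • mor (zd Z M Y)) ->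
  r ∘ fmap Z r = r ∘ mu m M /\ r ∘ eta m M = idc M.
Proof.
rewrite -(centralizer_monad_uniq dualA Hm) => Hs Hr; split.
- exact: half_braiding_actM Hs Hr.
- exact: half_braiding_act1 Hs Hr.
Qed.

(** [zbraid_mu] expresses [P_2 ∂] through the product of [Z], and associativity of [r] then splits
    the passage of [Y1 ⊗ Y2] into two. *)
Lemma module_half_braiding (M : A) (r : Hom (Z M) M) :
  r ∘ fmap Z r = r ∘ mu m M -> r ∘ eta m M = idc M ->
  half_braiding_arr cP M (fun Y => (ι (P Y) ⊛ mor r) • mor (zd Z M Y)).
Proof.
move=> r1 r2; split=> [Y|Y Y' g|Y1 Y2|].
- ty.
- flat. have H := zd_natr Z M g; srew H. by exchange (mor (fmap P g)) (mor r).
- flat. exchange (mor (com2 cP Y1 Y2)) (mor r).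
  have H := zbraidE dualA cP Z M Y1 Y2; srew (eq_sym H).
  have H1 := zbraid_mu M Y2; srew H1.
  have H2 := zd_natl Z Y2 r; srew H2.
  have := f_equal mor r1; unmor => H3; srew H3. by flat.
- flat. exchange (mor (com0 cP)) (mor r).
  rewrite -eta_zd -mor_comp r2. done.
Qed.

Lemma linear_braided (M N : A) (r : Hom (Z M) M) (t : Hom (Z N) N) (f : Hom M N) :
  f ∘ r = t ∘ fmap Z f <->
  forall Y, (ι (P Y) ⊛ mor f) • ((ι (P Y) ⊛ mor r) • mor (zd Z M Y))
    = ((ι (P Y) ⊛ mor t) • mor (zd Z N Y)) • (mor f ⊛ ι Y).
Proof.
split=> [E Y|E].
- flat. have H := zd_natl Z Y f; srew H.
  have := f_equal mor E; unmor => H3; srew H3. by flat.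
- apply: zd_uniq => Y; unmor; flat. rewrite E; flat.
  have H := zd_natl Z Y f; by srew H.
Qed.
End CentralizerModules.

(** * The comonoidal structure of the centralizer of a bimonad *)

Section CentralizerComonoidal.
Variables (A : MonCat).
Hypothesis dualA : has_left_duals A.
Variables (P : Functor A A) (cP : Comonoidal P) (Z : Centralizer P).
Variable m : Monad Z.
Hypothesis Hm : IsCentralizerMonad cP m.
Variable mP : Monad P.
Hypothesis HP : IsBimonad mP cP.
Local Notation zbraid := (zbraid dualA cP Z).
Local Notation ZC := (CenterMonCat HP).

Lemma zbraidP (X : A) : IsHalfBraiding cP (zbraid X).
Proof. by apply/half_braidingE; exact: zbraid_half_braiding. Qed.

Definition zfree (X : A) : ZC := Build_CenterOb (zbraidP X).

Lemma zfree_uniq (X : A) (N : ZC) (f g : @Hom ZC (zfree X) N) :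
  chom f ∘ eta m X = chom g ∘ eta m X -> f = g.
Proof.
move=> E; apply: CenterHom_eq; apply: zd_uniq => Y.
have Hf (h : @Hom ZC (zfree X) N) : (ι (P Y) ⊛ mor (chom h)) • mor (zd Z X Y)
  = mor (hb N Y) • (mor (chom h ∘ eta m X) ⊛ ι Y).
  have := f_equal mor (chomP h Y); rewrite /=; unmor => H.
  rewrite -(zbraid_eta dualA Hm); flat. by srew H.
by rewrite !Hf E.
Qed.

(** The extension is [r ∘ Z h], where [r] is the action of [Z] on [N] classifying its half braiding;
    it is braided because it is a map of [Z]-modules. *)
Lemma zfree_ext (X : A) (N : ZC) (h : Hom X (cob N)) :
  exists f : @Hom ZC (zfree X) N, chom f ∘ eta m X = h.
Proof.
have /half_braidingE HN := hbP N.
have [Y|Y Y' g|r Hr] := @zd_exists _ P Z (cob N) (cob N) (fun Y => mor (hb N Y)).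
- ty.
- exact: (hba_nat HN).
- have [r1 r2] := half_braiding_module dualA Hm HN Hr.
have B : IsBraidedHom (hb (zfree X)) (hb N) (r ∘ fmap Z h).
  move=> Y; apply: mor_inj; rewrite /=; unmor.
  have E : (r ∘ fmap Z h) ∘ mu m X = r ∘ fmap Z (r ∘ fmap Z h).
    by rewrite -compA -(mu_nat m) compA -r1 fmapD -!compA.
  have := proj1 (linear_braided _ _ _) E Y; unmor.
  by rewrite (zbraid_mu dualA Hm) Hr.
exists (Build_CenterHom B) => /=.
by rewrite -compA -(eta_nat m) compA r2 comp1f.
Qed.

Definition zext (X : A) (N : ZC) (h : Hom X (cob N)) : @Hom ZC (zfree X) N :=
  proj1_sig (constructive_indefinite_description _ (zfree_ext h)).

Lemma zextE (X : A) (N : ZC) (h : Hom X (cob N)) : chom (zext h) ∘ eta m X = h.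
Proof. by rewrite /zext; case: constructive_indefinite_description. Qed.

Lemma zmapP (X Y : A) (f : Hom X Y) : IsBraidedHom (hb (zfree X)) (hb (zfree Y)) (fmap Z f).
Proof. by move=> V; apply: mor_inj; rewrite /=; unmor; rewrite zbraid_natl. Qed.

Definition zmap (X Y : A) (f : Hom X Y) : @Hom ZC (zfree X) (zfree Y) :=
  Build_CenterHom (zmapP f).

(** Obtained by freeness in the center, so that each comonoidal law is an equation of maps out of a
    free object and can be checked after the unit. *)
Definition zcom2 (X Y : A) : @Hom ZC (zfree (X ⊗ Y)) (@tens ZC (zfree X) (zfree Y)) :=
  @zext (X ⊗ Y) (@tens ZC (zfree X) (zfree Y)) (eta m X ⊠ eta m Y).
Definition zcom0 : @Hom ZC (zfree one) one := @zext one (@one ZC) (idc one).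

Lemma zcom2E (X Y : A) : chom (zcom2 X Y) ∘ eta m (X ⊗ Y) = eta m X ⊠ eta m Y.
Proof. exact: (@zextE (X ⊗ Y) (@tens ZC (zfree X) (zfree Y))). Qed.

Lemma zcom0E : chom zcom0 ∘ eta m one = idc one.
Proof. exact: (@zextE one (@one ZC)). Qed.

Lemma zcom2_nat (X X' Y Y' : A) (f : Hom X X') (g : Hom Y Y') :
  zcom2 X' Y' ∘ zmap (f ⊠ g) = (zmap f ⊠ zmap g) ∘ zcom2 X Y.
Proof.
apply: zfree_uniq => /=.
by rewrite -!compA zcom2E -eta_nat compA zcom2E -!tensmD !eta_nat.
Qed.

Lemma chom_asc (X Y V : ZC) : chom (asc X Y V) = asc (cob X) (cob Y) (cob V).
Proof. exact: (@chom_eqhom _ _ cP _ _ (tensA X Y V) (tensA _ _ _)). Qed.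

Lemma chom_lun (X : ZC) : chom (lun X) = lun (cob X).
Proof. exact: (@chom_eqhom _ _ cP _ _ (tens1l X) (tens1l _)). Qed.

Lemma chom_run (X : ZC) : chom (run X) = run (cob X).
Proof. exact: (@chom_eqhom _ _ cP _ _ (tens1r X) (tens1r _)). Qed.

Lemma zcom2A (X Y V : A) :
  asc (zfree X) (zfree Y) (zfree V) ∘ (zcom2 X Y ⊠ idc (zfree V)) ∘ zcom2 (X ⊗ Y) V
  = (idc (zfree X) ⊠ zcom2 Y V) ∘ zcom2 X (Y ⊗ V) ∘ zmap (asc X Y V).
Proof.
apply: zfree_uniq => /=; rewrite chom_asc /=.
rewrite -!compA zcom2E -eta_nat (compA _ (eta m _)) zcom2E -tensmD zcom2E.
by rewrite compA -tensmD zcom2E !comp1f tensmA.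
Qed.

Lemma zcom01l (X : A) : lun (zfree X) ∘ (zcom0 ⊠ idc (zfree X)) ∘ zcom2 one X = zmap (lun X).
Proof.
apply: zfree_uniq => /=; rewrite chom_lun /=.
by rewrite -!compA zcom2E -eta_nat -tensmD zcom0E !comp1f tensm1l.
Qed.

Lemma zcom01r (X : A) : run (zfree X) ∘ (idc (zfree X) ⊠ zcom0) ∘ zcom2 X one = zmap (run X).
Proof.
apply: zfree_uniq => /=; rewrite chom_run /=.
by rewrite -!compA zcom2E -eta_nat -tensmD zcom0E !comp1f tensm1r.
Qed.

Definition centralizer_com : Comonoidal Z.
Proof.
refine (@Build_Comonoidal A A Z (fun X Y => chom (zcom2 X Y)) (chom zcom0) _ _ _ _).
- abstract (move=> X X' Y Y' f g; exact: (f_equal (@chom _ _ _ _ _) (zcom2_nat f g))).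
- abstract (move=> X Y V; have /= := f_equal (@chom _ _ _ _ _) (zcom2A X Y V);
    rewrite chom_asc; exact).
- abstract (move=> X; have /= := f_equal (@chom _ _ _ _ _) (zcom01l X);
    rewrite chom_lun; exact).
- abstract (move=> X; have /= := f_equal (@chom _ _ _ _ _) (zcom01r X);
    rewrite chom_run; exact).
Defined.

Lemma hom_zdE (X : A) (N : ZC) (h : @Hom ZC (zfree X) N) (Y : A) :
  (ι (P Y) ⊛ mor (chom h)) • mor (zd Z X Y)
  = mor (hb N Y) • (mor (chom h ∘ eta m X) ⊛ ι Y).
Proof.
have := f_equal mor (chomP h Y); rewrite /=; unmor => H.
rewrite -(zbraid_eta dualA Hm); flat. by srew H.
Qed.

(** By [hom_zdE], a map out of a free object composed with [∂] is the half braiding of the target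
    after the restriction to generators. For the tensor product and the unit of the center this is
    the prescribed formula. *)
Lemma centralizer_comP : IsCentralizerComonoidal mP centralizer_com.
Proof.
split=> [X1 X2 Y|Y]; apply: mor_inj; unmor; rewrite /=.
- rewrite (hom_zdE (zcom2 X1 X2)) zcom2E mor_tens.
  rewrite (tens_slices (typed_mor (eta m X1)) (typed_mor (eta m X2))).
  rewrite /= /hb_push /hb_comp /=; unmor; flat; drop_id.
  exchange (mor (eta m X1)) (mor (eta m X2)).
  have H := zbraid_eta dualA Hm X2 Y; srew H.
  exchange (mor (eta m X1)) (mor (zd Z X2 Y)).
  have H' := zbraid_eta dualA Hm X1 (P Y); srew H'. by drop_id.
- rewrite (hom_zdE zcom0) zcom0E. rewrite /hb_push /hb_one /=; unmor; flat; drop_id. by [].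
Qed.

Lemma centralizer_com_uniq (c : Comonoidal Z) :
  IsCentralizerComonoidal mP c -> centralizer_com = c.
Proof.
have [E2 E0] := centralizer_comP; move=> [F2 F0]; apply: comonoidal_eq.
- move=> X Y; apply: zd_uniq => V; unmor.
  by have := f_equal mor (E2 X Y V); rewrite -F2; unmor.
- apply: zd_uniq => V.
  by have := f_equal mor (E0 V); rewrite -F0; unmor.
Qed.

Lemma zmuP (X : A) : IsBraidedHom (hb (zfree (Z X))) (hb (zfree X)) (mu m X).
Proof.
move=> Y; apply: mor_inj; rewrite /=; unmor.
rewrite !(zbraid_mu dualA Hm).
by apply: (proj1 (linear_braided (mu m (Z X)) (mu m X) (mu m X))); rewrite muA.
Qed.

Definition zmu (X : A) : @Hom ZC (zfree (Z X)) (zfree X) := Build_CenterHom (zmuP X).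

(** The product is itself braided ([zmuP]), so the laws involving it are also compared on
    generators. *)
Lemma centralizer_bimonad : IsBimonad m centralizer_com.
Proof.
split; split=> [X Y|] /=.
- have E : zcom2 X Y ∘ zmu (X ⊗ Y)
      = (zmu X ⊠ zmu Y) ∘ zcom2 (Z X) (Z Y) ∘ zmap (chom (zcom2 X Y)).
    apply: zfree_uniq => /=.
    rewrite -!compA mu_eta compf1 -eta_nat (compA _ (eta m _)) zcom2E compA -tensmD.
    by rewrite !mu_eta tensm1 comp1f.
  by have /= := f_equal (@chom _ _ _ _ _) E; rewrite compA.
- have E : zcom0 ∘ zmu one = zcom0 ∘ zmap (chom zcom0).
    apply: zfree_uniq => /=.
    by rewrite -!compA mu_eta compf1 -eta_nat compA zcom0E comp1f.
  exact: (f_equal (@chom _ _ _ _ _) E).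
- by rewrite zcom2E compf1.
- exact: zcom0E.
Qed.
End CentralizerComonoidal.

(** * Duals of modules *)

Lemma dual_pairE (C : MonCat) (D X : C) (e : Hom (D ⊗ X) one) (c : Hom one (X ⊗ D)) :
  dual_pair e c <->
  run X ∘ (idc X ⊠ e) ∘ asc X D X ∘ (c ⊠ idc X) ∘ lun' X = idc X /\
  lun D ∘ (e ⊠ idc D) ∘ asc' D X D ∘ (idc D ⊠ c) ∘ run' D = idc D.
Proof.
split=> [[z1 z2] | [z1 z2]]; split.
- by apply: mor_inj; unmor; flat; drop_id.
- by apply: mor_inj; unmor; flat; drop_id.
- by have := f_equal mor z1; unmor; flat; drop_id.
- by have := f_equal mor z2; unmor; flat; drop_id.
Qed.

Lemma curry_uncurry (C : MonCat) (D V B W : C) (e : Hom (D ⊗ V) one) (c : Hom one (V ⊗ D)) m :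
  dual_pair e c -> typed B m (W ⊗ D) ->
  (((ι W ⊛ mor e) • (m ⊛ ι V)) ⊛ ι D) • (ι B ⊛ mor c) = m.
Proof.
move=> [z1 z2] Hm; flat.
exchange m (mor c).
by srew z2; drop_id.
Qed.

(** Sections are preserved by [F]. Below, [p] and [q] are fusion operators, the second one under
    [T]. *)
Lemma cancel_split_epis (C D : Category) (F : Functor C D) (X Y : C) (U V : D)
    (p : Hom (F Y) U) (w : Hom U (F Y)) (q : Hom X Y) (v : Hom Y X) (f g : Hom U V) :
  p ∘ w = idc U -> q ∘ v = idc Y ->
  f ∘ p ∘ fmap F q = g ∘ p ∘ fmap F q -> f = g.
Proof.
move=> Hw Hv /(f_equal (fun x => x ∘ fmap F v ∘ w)).
by rewrite -!compA !(compA (fmap F q)) -fmapD Hv fmap1 comp1f Hw !compf1.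
Qed.

Section LiftDuals.
Variables (C : MonCat) (T : Bimonad C).
Local Notation m := (bmon T).
Local Notation com := (bcom T).
Local Notation TC := (ModMonCat (bimonadP T)).

Lemma lin_eqhom_mod (X Y : TC) (e : X = Y) (e' : mcar X = mcar Y) : lin (eqhom e) = eqhom e'.
Proof. exact: lin_eqhom. Qed.

Lemma dual_pair_lift (D X : TC) (e : @Hom TC (D ⊗ X) one) (c : @Hom TC one (X ⊗ D)) :
  @dual_pair C (mcar D) (mcar X) (lin e) (lin c) <-> @dual_pair TC D X e c.
Proof.
have Er : lin (run' X) = run' (mcar X) by exact: lin_eqhom_mod.
have El : lin (lun' X) = lun' (mcar X) by exact: lin_eqhom_mod.
have ErD : lin (run' D) = run' (mcar D) by exact: lin_eqhom_mod.
have Ea : lin (asc' D X D) = asc' (mcar D) (mcar X) (mcar D) by exact: lin_eqhom_mod.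
rewrite !dual_pairE; split=> [[z1 z2] | [z1 z2]]; split.
- by apply: lin_eq; rewrite !lin_comp !lin_tensm lin_asc lin_run El !lin_id.
- by apply: lin_eq; rewrite !lin_comp !lin_tensm lin_lun Ea ErD !lin_id.
- have := f_equal (@lin _ _ _ _ _) z1.
  by rewrite !lin_comp !lin_tensm lin_asc lin_run El !lin_id.
- have := f_equal (@lin _ _ _ _ _) z2.
  by rewrite !lin_comp !lin_tensm lin_lun Ea ErD !lin_id.
Qed.

End LiftDuals.

Section DualModule.
Variables (C : MonCat) (T : Bimonad C).
Local Notation m := (bmon T).
Local Notation com := (bcom T).
Variables (N D : C) (r : Hom (T N) N) (a : Hom (T D) D).
Hypothesis rM : r ∘ fmap T r = r ∘ mu m N.
Hypothesis r1 : r ∘ eta m N = idc N.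

Local Notation TC := (ModMonCat (bimonadP T)).
Definition self_mod : TC := @Build_Module C T m N r rM r1.

Section Left.
Variables (e : Hom (D ⊗ N) one) (c : Hom one (N ⊗ D)).
Hypothesis dec : dual_pair e c.
Hypothesis Ee : e ∘ (a ⊠ r) ∘ com2 com D N = com0 com ∘ fmap T e.
Hypothesis Ec : (r ⊠ a) ∘ com2 com N D ∘ fmap T c = c ∘ com0 com.

(** The composite is the fusion operator [T (A ⊗ N) -> T A ⊗ N] of the module [N]. Its section
    creates [N ⊗ D] inside [T], splits [D] off with [T_2], applies [a] and pairs [D] with the outer
    [N]. *)
Lemma left_fusion_split (A : C) : exists w : Hom (T A ⊗ N) (T (A ⊗ N)),
  (idc (T A) ⊠ r) ∘ com2 com A N ∘ w = idc _.
Proof.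
have [z1 _] := dec.
have Tw : typed (T A ⊗ N) ((ι (T (A ⊗ N)) ⊛ mor e) • (((ι (T (A ⊗ N)) ⊛ mor a)
    • mor (com2 com (A ⊗ N) D) • mor (fmap T (idc A ⊠ c))) ⊛ ι N)) (T (A ⊗ N)) by ty.
exists (realize Tw); apply: mor_inj; unmor; rewrite realizeE; flat.
exchange (mor (com2 com A N)) (mor e).
exchange (mor r) (mor e).
exchange (mor (com2 com A N)) (mor a).
have H := com2_assoc com A N D. srew H.
rewrite mor_fmap mor_tens mor_id.
have H2 := com2_natr com A c; srew H2.
have := f_equal mor Ec; unmor. rewrite (tens_slices (typed_mor r) (typed_mor a)) => H3.
srew H3.
have H4 := com0_right com A; srew H4. srew z1. by drop_id.
Qed.

Lemma left_pairing_inj (B : C) (f g : Hom B D) :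
  e ∘ (f ⊠ idc N) = e ∘ (g ⊠ idc N) -> f = g.
Proof.
move=> E; apply: mor_inj.
have Tm (h : Hom B D) : typed B (mor h) (one ⊗ D) by ty.
rewrite -(curry_uncurry dec (Tm f)) -(curry_uncurry dec (Tm g)) !atens1l.
by have := f_equal mor E; unmor => ->.
Qed.

Lemma left_dual_act1 : a ∘ eta m D = idc D.
Proof.
apply: left_pairing_inj.
have [E2 E0] := eta_com (bimonadP T).
have E2' := E2 D N; rewrite /= compf1 in E2'.
rewrite tensm1 compf1 tensm_l.
have -> : (a ⊠ idc N) ∘ (eta m D ⊠ idc N) = (a ⊠ r) ∘ (eta m D ⊠ eta m N).
  by rewrite -!tensmD r1 comp1f.
by rewrite -E2' !compA Ee -compA -eta_nat compA E0 /= comp1f.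
Qed.

(** Tested through the pairing [e] and after two fusion operators, both sides become
    [T_0 T(T_0) TT(e)] by [Ee]; the fusion operators are split, hence cancel. *)
Lemma left_dual_actM : a ∘ fmap T a = a ∘ mu m D.
Proof.
apply: left_pairing_inj.
have [w Hw] := left_fusion_split (T D).
have [w' Hw'] := left_fusion_split D.
have [E2 E0] := mu_com (bimonadP T).
have E2' := E2 D N; rewrite /= in E2'.
suff H : e ∘ ((a ∘ fmap T a) ⊠ idc N) ∘ ((idc _ ⊠ r) ∘ com2 com (T D) N)
      ∘ fmap T ((idc _ ⊠ r) ∘ com2 com D N)
    = e ∘ ((a ∘ mu m D) ⊠ idc N) ∘ ((idc _ ⊠ r) ∘ com2 com (T D) N)
      ∘ fmap T ((idc _ ⊠ r) ∘ com2 com D N).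
  exact: (cancel_split_epis Hw Hw' H).
transitivity (com0 com ∘ fmap T (com0 com) ∘ fmap T (fmap T e)).
- have -> : e ∘ ((a ∘ fmap T a) ⊠ idc N) ∘ ((idc _ ⊠ r) ∘ com2 com (T D) N)
     = e ∘ (a ⊠ r) ∘ com2 com D N ∘ fmap T (a ⊠ idc N).
    rewrite -!compA com2_nat (compA ((a ∘ _) ⊠ _)) (compA (a ⊠ r)) -!tensmD fmap1.
    by rewrite !comp1f !compf1.
  rewrite Ee -!compA -!fmapD (compA (a ⊠ idc N)) -tensm_lr (compA e) Ee.
  by rewrite !fmapD.
- rewrite fmapD -!compA.
  rewrite (compA (com2 com (T D) N)) com2_nat fmap1 -!compA.
  rewrite (compA (idc _ ⊠ r)) -tensmD (compA ((a ∘ _) ⊠ _)) -tensmD !comp1f !compf1 rM tensmD -!compA -E2'.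
  by rewrite (compA (a ⊠ r)) !compA Ee -(compA _ (fmap T e)) -mu_nat compA E0.
Qed.

Definition left_dual_mod : ModMonCat (bimonadP T) :=
  @Build_Module C T m D a left_dual_actM left_dual_act1.

Lemma left_dual_evP : @IsLinear C T m (left_dual_mod ⊗ self_mod) (one : TC) e.
Proof. by rewrite /IsLinear /= compA. Qed.

Lemma left_dual_coevP : @IsLinear C T m (one : TC) (self_mod ⊗ left_dual_mod) c.
Proof. by rewrite /IsLinear /=. Qed.

Lemma left_dual_module : exists D e c, @dual_pair (ModMonCat (bimonadP T)) D self_mod e c.
Proof.
exists left_dual_mod, (Build_MHom left_dual_evP), (Build_MHom left_dual_coevP).
by apply/dual_pair_lift.
Qed.
End Left.

Section Right.
Variables (e : Hom (N ⊗ D) one) (c : Hom one (D ⊗ N)).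
Hypothesis dec : dual_pair e c.
Hypothesis Ee : e ∘ (r ⊠ a) ∘ com2 com N D = com0 com ∘ fmap T e.
Hypothesis Ec : (a ⊠ r) ∘ com2 com D N ∘ fmap T c = c ∘ com0 com.

Lemma right_fusion_split (A : C) : exists w : Hom (N ⊗ T A) (T (N ⊗ A)),
  (r ⊠ idc (T A)) ∘ com2 com N A ∘ w = idc _.
Proof.
have [_ z2] := dec.
have Tw : typed (N ⊗ T A) ((mor e ⊛ ι (T (N ⊗ A))) • (ι N ⊛ ((mor a ⊛ ι (T (N ⊗ A)))
    • mor (com2 com D (N ⊗ A)) • mor (fmap T (asc D N A ∘ (c ⊠ idc A) ∘ lun' A)))))
    (T (N ⊗ A)) by ty.
exists (realize Tw); apply: mor_inj; unmor; rewrite realizeE.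
have -> : mor (fmap T (asc D N A ∘ (c ⊠ idc A) ∘ lun' A)) = amap T (mor c ⊛ ι A).
  by rewrite mor_fmap; congr (amap T _); unmor; flat; drop_id.
flat.
exchange (mor e) (mor (com2 com N A)).
exchange (mor e) (mor r).
exchange (mor a) (mor (com2 com N A)).
have H := com2_assoc com D N A; srew (eq_sym H).
have H2 := com2_natl com A c; srew H2.
exchange (mor a) (mor r).
have := f_equal mor Ec; unmor. rewrite (tens_slices (typed_mor a) (typed_mor r)) => H3.
srew H3.
have H4 := com0_left com A; srew H4. srew z2. by drop_id.
Qed.

Lemma right_pairing_inj (B : C) (f g : Hom B D) :
  e ∘ (idc N ⊠ f) = e ∘ (idc N ⊠ g) -> f = g.
Proof.
have [z1 _] := dec.
have K (h : Hom B D) : (ι D ⊛ mor (e ∘ (idc N ⊠ h))) • (mor c ⊛ ι B) = mor h.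
  unmor; flat. exchange (mor c) (mor h). by srew z1; drop_id.
by move=> E; apply: mor_inj; rewrite -(K f) -(K g) E.
Qed.

Lemma right_dual_act1 : a ∘ eta m D = idc D.
Proof.
apply: right_pairing_inj.
have [E2 E0] := eta_com (bimonadP T).
have E2' := E2 N D; rewrite /= compf1 in E2'.
rewrite tensm1 compf1 tensm_r.
have -> : (idc N ⊠ a) ∘ (idc N ⊠ eta m D) = (r ⊠ a) ∘ (eta m N ⊠ eta m D).
  by rewrite -!tensmD r1 comp1f.
by rewrite -E2' !compA Ee -compA -eta_nat compA E0 /= comp1f.
Qed.

Lemma right_dual_actM : a ∘ fmap T a = a ∘ mu m D.
Proof.
apply: right_pairing_inj.
have [w Hw] := right_fusion_split (T D).
have [w' Hw'] := right_fusion_split D.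
have [E2 E0] := mu_com (bimonadP T).
have E2' := E2 N D; rewrite /= in E2'.
suff H : e ∘ (idc N ⊠ (a ∘ fmap T a)) ∘ ((r ⊠ idc _) ∘ com2 com N (T D))
      ∘ fmap T ((r ⊠ idc _) ∘ com2 com N D)
    = e ∘ (idc N ⊠ (a ∘ mu m D)) ∘ ((r ⊠ idc _) ∘ com2 com N (T D))
      ∘ fmap T ((r ⊠ idc _) ∘ com2 com N D).
  exact: (cancel_split_epis Hw Hw' H).
transitivity (com0 com ∘ fmap T (com0 com) ∘ fmap T (fmap T e)).
- have -> : e ∘ (idc N ⊠ (a ∘ fmap T a)) ∘ ((r ⊠ idc _) ∘ com2 com N (T D))
     = e ∘ (r ⊠ a) ∘ com2 com N D ∘ fmap T (idc N ⊠ a).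
    rewrite -!compA com2_nat (compA (_ ⊠ (a ∘ _))) (compA (r ⊠ a)) -!tensmD fmap1.
    by rewrite !comp1f !compf1.
  rewrite Ee -!compA -!fmapD (compA (idc N ⊠ a)) -tensm_rl (compA e) Ee.
  by rewrite !fmapD.
- rewrite fmapD -!compA.
  rewrite (compA (com2 com N (T D))) com2_nat fmap1 -!compA.
  rewrite (compA (r ⊠ idc _)) -tensmD (compA (_ ⊠ (a ∘ _))) -tensmD !comp1f !compf1 rM tensmD -!compA -E2'.
  by rewrite (compA (r ⊠ a)) !compA Ee -(compA _ (fmap T e)) -mu_nat compA E0.
Qed.

Definition right_dual_mod : ModMonCat (bimonadP T) :=
  @Build_Module C T m D a right_dual_actM right_dual_act1.

Lemma right_dual_evP : @IsLinear C T m (self_mod ⊗ right_dual_mod) (one : TC) e.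
Proof. by rewrite /IsLinear /= compA. Qed.

Lemma right_dual_coevP : @IsLinear C T m (one : TC) (right_dual_mod ⊗ self_mod) c.
Proof. by rewrite /IsLinear /=. Qed.

Lemma right_dual_module : exists D e c, @dual_pair (ModMonCat (bimonadP T)) self_mod D e c.
Proof.
exists right_dual_mod, (Build_MHom right_dual_evP), (Build_MHom right_dual_coevP).
by apply/dual_pair_lift.
Qed.
End Right.
End DualModule.

(** * Actions on duals given by the antipodes *)

Section Antipodes.
Variables (C : AutonomousCategory).

Lemma ldual_pair (X : C) : dual_pair (ev X) (coev X).
Proof. by apply/dual_pairE; split; [exact: ev_coev | exact: coev_ev]. Qed.

Lemma rdual_pair (X : C) : dual_pair (rev X) (rcoev X).
Proof. by apply/dual_pairE; split; [exact: rcoev_rev | exact: rev_rcoev]. Qed.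

Lemma ev_ldualm (X Y : C) (f : Hom X Y) :
  ev X ∘ (ldualm f ⊠ idc X) = ev Y ∘ (idc (ldual Y) ⊠ f).
Proof.
have [z1 z2] := ldual_pair X.
apply: mor_inj; unmor; flat; drop_id.
exchange (mor (ev Y)) (mor (ev X)).
exchange (mor f) (mor (ev X)).
by srew z1; drop_id.
Qed.

Lemma coev_ldualm (X Y : C) (f : Hom X Y) :
  (idc Y ⊠ ldualm f) ∘ coev Y = (f ⊠ idc (ldual X)) ∘ coev X.
Proof.
have [z1 z2] := ldual_pair Y.
apply: mor_inj; unmor; flat; drop_id.
exchange (mor (coev Y)) (mor (coev X)).
exchange (mor (coev Y)) (mor f).
by srew z1; drop_id.
Qed.

Lemma rev_rdualm (X Y : C) (f : Hom X Y) :
  rev X ∘ (idc X ⊠ rdualm f) = rev Y ∘ (f ⊠ idc (rdual Y)).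
Proof.
have [z1 z2] := rdual_pair X.
apply: mor_inj; unmor; flat; drop_id.
exchange (mor (rev X)) (mor (rev Y)).
exchange (mor (rev X)) (mor f).
by srew z2; drop_id.
Qed.

Lemma rcoev_rdualm (X Y : C) (f : Hom X Y) :
  (rdualm f ⊠ idc Y) ∘ rcoev Y = (idc (rdual X) ⊠ f) ∘ rcoev X.
Proof.
have [z1 z2] := rdual_pair Y.
apply: mor_inj; unmor; flat; drop_id.
exchange (mor (rcoev X)) (mor (rcoev Y)).
exchange (mor f) (mor (rcoev Y)).
by srew z2; drop_id.
Qed.

Lemma ldualm_id (X : C) : ldualm (idc X) = idc (ldual X).
Proof.
apply: (left_pairing_inj (ldual_pair X)); by rewrite ev_ldualm.
Qed.

Lemma ldualm_comp (X Y V : C) (g : Hom Y V) (f : Hom X Y) :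
  ldualm (g ∘ f) = ldualm f ∘ ldualm g.
Proof.
apply: (left_pairing_inj (ldual_pair X)).
rewrite ev_ldualm tensm_l compA ev_ldualm -compA tensm_xchg compA ev_ldualm -compA.
by rewrite -tensm_r.
Qed.

Lemma rdualm_id (X : C) : rdualm (idc X) = idc (rdual X).
Proof.
apply: (right_pairing_inj (rdual_pair X)); by rewrite rev_rdualm.
Qed.

Lemma rdualm_comp (X Y V : C) (g : Hom Y V) (f : Hom X Y) :
  rdualm (g ∘ f) = rdualm f ∘ rdualm g.
Proof.
apply: (right_pairing_inj (rdual_pair X)).
rewrite rev_rdualm tensm_r compA rev_rdualm -compA -tensm_xchg compA rev_rdualm -compA.
by rewrite -tensm_l.
Qed.

Variable T : HopfMonad C.
Local Notation m := (bmon T).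
Local Notation com := (bcom T).
Local Notation TC := (ModMonCat (bimonadP T)).

(** The action on [ldual X] is [s_X ∘ T (ldualm r)]. It respects evaluation by the first antipode
    axiom precomposed with [ldualm r], and coevaluation by the second one followed by [r]. *)
Lemma modules_left_duals : has_left_duals TC.
Proof.
move=> N; have [s [sn [s1 s2]]] := left_antipode T.
set r := mact N; set X := mcar N.
pose a := s X ∘ fmap T (ldualm r).
have Ha : s X ∘ fmap T (ldualm r) = a by [].
clearbody a.
have Ee : ev X ∘ (a ⊠ r) ∘ com2 com (ldual X) X = com0 com ∘ fmap T (ev X).
  have E : ldualm (eta m X) ∘ ldualm r = idc _.
    by rewrite -ldualm_comp mact1 ldualm_id.
  have K : s (T X) ∘ fmap T (ldualm (mu m X)) ∘ fmap T (ldualm r) = ldualm r ∘ a.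
    rewrite -compA -fmapD -ldualm_comp -(mactM N) ldualm_comp fmapD compA sn.
    by rewrite -compA Ha.
  have := f_equal (fun x => x ∘ fmap T (ldualm r ⊠ idc X)) (s1 X).
  rewrite -(compA _ (com2 _ _ _)) com2_nat fmap1 -!compA -!fmapD -tensmD E comp1f tensm1 compf1 => ->.
  rewrite (compA (_ ⊠ _)) -tensmD K comp1f !compA.
  by rewrite tensm_l compA ev_ldualm -(compA _ _ (a ⊠ _)) -tensm_rl.
have Ec : (r ⊠ a) ∘ com2 com X (ldual X) ∘ fmap T (coev X) = coev X ∘ com0 com.
  have := f_equal (fun x => (r ⊠ idc _) ∘ x) (s2 X).
  rewrite !compA -!tensmD mact1 !comp1f tensm1 comp1f => ->.
  rewrite -(mactM N) -/r.
  have -> : (r ∘ fmap T r) ⊠ s X = (r ⊠ s X) ∘ (fmap T r ⊠ fmap T (idc _)).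
    by rewrite -tensmD fmap1 compf1.
  rewrite -!compA (compA (_ ⊠ fmap T _)) -com2_nat -!compA -fmapD -coev_ldualm.
  by rewrite fmapD (compA (com2 _ _ _)) com2_nat fmap1 !compA -tensmD compf1 Ha.
move: Ee Ec; clear sn s1 s2 Ha; subst r X; case: N a => X r r1 r2 /= a Ee Ec.
exact: left_dual_module (ldual_pair X) Ee Ec.
Qed.

Lemma modules_right_duals : has_right_duals TC.
Proof.
move=> N; have [s [sn [s1 s2]]] := right_antipode T.
set r := mact N; set X := mcar N.
pose a := s X ∘ fmap T (rdualm r).
have Ha : s X ∘ fmap T (rdualm r) = a by [].
clearbody a.
have Ee : rev X ∘ (r ⊠ a) ∘ com2 com X (rdual X) = com0 com ∘ fmap T (rev X).
  have E : rdualm (eta m X) ∘ rdualm r = idc _.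
    by rewrite -rdualm_comp mact1 rdualm_id.
  have K : s (T X) ∘ fmap T (rdualm (mu m X)) ∘ fmap T (rdualm r) = rdualm r ∘ a.
    rewrite -compA -fmapD -rdualm_comp -(mactM N) rdualm_comp fmapD compA sn.
    by rewrite -compA Ha.
  have := f_equal (fun x => x ∘ fmap T (idc X ⊠ rdualm r)) (s1 X).
  rewrite -(compA _ (com2 _ _ _)) com2_nat fmap1 -!compA -!fmapD -tensmD E comp1f tensm1 compf1 => ->.
  rewrite (compA (_ ⊠ _)) -tensmD K comp1f !compA.
  by rewrite tensm_r compA rev_rdualm -(compA _ _ (_ ⊠ a)) -tensm_lr.
have Ec : (a ⊠ r) ∘ com2 com (rdual X) X ∘ fmap T (rcoev X) = rcoev X ∘ com0 com.
  have := f_equal (fun x => (idc _ ⊠ r) ∘ x) (s2 X).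
  rewrite !compA -!tensmD mact1 !comp1f tensm1 comp1f => ->.
  rewrite -(mactM N) -/r.
  have -> : s X ⊠ (r ∘ fmap T r) = (s X ⊠ r) ∘ (fmap T (idc _) ⊠ fmap T r).
    by rewrite -tensmD fmap1 compf1.
  rewrite -!compA (compA (_ ⊠ fmap T _)) -com2_nat -!compA -fmapD -rcoev_rdualm.
  by rewrite fmapD (compA (com2 _ _ _)) com2_nat fmap1 !compA -tensmD compf1 Ha.
move: Ee Ec; clear sn s1 s2 Ha; subst r X; case: N a => X r r1 r2 /= a Ee Ec.
exact: right_dual_module (rdual_pair X) Ee Ec.
Qed.
End Antipodes.

Lemma right_uncurry_curry (C : MonCat) (V R B W : C) (e : Hom (V ⊗ R) one)
    (c : Hom one (R ⊗ V)) m :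
  dual_pair e c -> typed (V ⊗ B) m W ->
  (mor e ⊛ ι W) • (ι V ⊛ ((ι R ⊛ m) • (mor c ⊛ ι B))) = m.
Proof.
move=> [z1 z2] Hm; flat.
exchange (mor e) m.
by srew z2; drop_id.
Qed.

(** * Linear maps out of tensor products with a free module *)

Section Extensions.
Variables (C : MonCat) (T : Bimonad C).
Local Notation m := (bmon T).
Local Notation com := (bcom T).
Local Notation TC := (ModMonCat (bimonadP T)).
Local Notation F := (free m : Functor C TC).
Hypothesis leftTC : has_left_duals TC.
Hypothesis rightTC : has_right_duals TC.

Lemma free_uniq (A : C) (N : TC) (g h : @Hom TC (F A) N) :
  lin g ∘ eta m A = lin h ∘ eta m A -> g = h.
Proof.
move=> E; apply: lin_eq.
have S (k : @Hom TC (F A) N) : lin k = mact N ∘ fmap T (lin k ∘ eta m A).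
  by rewrite fmapD compA -(linP k) /= -compA mu_Teta compf1.
by rewrite S E -S.
Qed.

Lemma free_ext (A : C) (N : TC) (k : Hom A (mcar N)) :
  exists g : @Hom TC (F A) N, lin g ∘ eta m A = k.
Proof.
by exists (counit m N ∘ fmap F k); rewrite /= -compA -eta_nat compA mact1 comp1f.
Qed.

(** A dual [D] of [N] in the category of modules turns linear maps [F A ⊗ N -> N'] into linear maps
    [F A -> N' ⊗ D], to which freeness of [F A] applies. *)
Lemma left_ext (A : C) (N N' : TC) (k : Hom (A ⊗ mcar N) (mcar N')) :
  exists L : @Hom TC (F A ⊗ N) N', lin L ∘ (eta m A ⊠ idc (mcar N)) = k.
Proof.
have [D [e [c /dual_pair_lift d]]] := leftTC N.
have Tk : typed A ((mor k ⊛ ι (mcar D)) • (ι A ⊛ mor (lin c))) (mcar N' ⊗ mcar D) by ty.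
have [g Hg] := @free_ext A (N' ⊗ D) (realize Tk).
exists (run N' ∘ (idc N' ⊠ e) ∘ asc N' D N ∘ (g ⊠ idc N)).
rewrite !lin_comp !lin_tensm lin_run lin_asc !lin_id.
apply: mor_inj; unmor; flat; drop_id.
have : mor (lin g) • mor (eta m A) = (mor k ⊛ ι (mcar D)) • (ι A ⊛ mor (lin c)).
  by rewrite -mor_comp Hg realizeE.
move=> H; srew H.
have := uncurry_curry d (typed_mor k). by flat.
Qed.

Lemma left_ext_uniq (A : C) (N N' : TC) (L L' : @Hom TC (F A ⊗ N) N') :
  lin L ∘ (eta m A ⊠ idc (mcar N)) = lin L' ∘ (eta m A ⊠ idc (mcar N)) -> L = L'.
Proof.
move=> E; have [D [e [c /dual_pair_lift d]]] := leftTC N.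
pose g (K : @Hom TC (F A ⊗ N) N') : @Hom TC (F A) (N' ⊗ D) :=
  (K ⊠ idc D) ∘ asc' (F A) N D ∘ (idc (F A) ⊠ c) ∘ run' (F A).
have gE K : mor (lin (g K)) = (mor (lin K) ⊛ ι (mcar D)) • (ι (T A) ⊛ mor (lin c)).
  rewrite /g !lin_comp !lin_tensm (lin_eqhom_mod (eq_sym (tens1r (F A))) (eq_sym (tens1r (T A)))).
  rewrite (lin_eqhom_mod (eq_sym (tensA (F A) N D)) (eq_sym (tensA (T A) (mcar N) (mcar D)))).
  by rewrite !lin_id; unmor; flat; drop_id.
clearbody g; have : g L = g L'.
  apply: free_uniq; apply: mor_inj; unmor; rewrite !gE; flat.
  exchange (mor (eta m A)) (mor (lin c)).
  have := f_equal mor E; unmor => H. srew H. done.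
move=> Eg; apply: lin_eq; apply: mor_inj.
rewrite -(uncurry_curry d (typed_mor (lin L))) -(uncurry_curry d (typed_mor (lin L'))).
by rewrite -!gE Eg.
Qed.

Lemma right_ext (A : C) (N N' : TC) (k : Hom (mcar N ⊗ A) (mcar N')) :
  exists L : @Hom TC (N ⊗ F A) N', lin L ∘ (idc (mcar N) ⊠ eta m A) = k.
Proof.
have [D [e [c /dual_pair_lift d]]] := rightTC N.
have Tk : typed A ((ι (mcar D) ⊛ mor k) • (mor (lin c) ⊛ ι A)) (mcar D ⊗ mcar N') by ty.
have [g Hg] := @free_ext A (D ⊗ N') (realize Tk).
exists (lun N' ∘ (e ⊠ idc N') ∘ asc' N D N' ∘ (idc N ⊠ g)).
rewrite !lin_comp !lin_tensm lin_lun.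
rewrite (lin_eqhom_mod (eq_sym (tensA N D N')) (eq_sym (tensA (mcar N) (mcar D) (mcar N')))) !lin_id.
apply: mor_inj; unmor; flat; drop_id.
have : mor (lin g) • mor (eta m A) = (ι (mcar D) ⊛ mor k) • (mor (lin c) ⊛ ι A).
  by rewrite -mor_comp Hg realizeE.
move=> H; srew H.
have := right_uncurry_curry d (typed_mor k). by flat.
Qed.

Lemma right_ext_uniq (A : C) (N N' : TC) (L L' : @Hom TC (N ⊗ F A) N') :
  lin L ∘ (idc (mcar N) ⊠ eta m A) = lin L' ∘ (idc (mcar N) ⊠ eta m A) -> L = L'.
Proof.
move=> E; have [D [e [c /dual_pair_lift d]]] := rightTC N.
pose g (K : @Hom TC (N ⊗ F A) N') : @Hom TC (F A) (D ⊗ N') :=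
  (idc D ⊠ K) ∘ asc D N (F A) ∘ (c ⊠ idc (F A)) ∘ lun' (F A).
have gE K : mor (lin (g K)) = (ι (mcar D) ⊛ mor (lin K)) • (mor (lin c) ⊛ ι (T A)).
  rewrite /g !lin_comp !lin_tensm (lin_eqhom_mod (eq_sym (tens1l (F A))) (eq_sym (tens1l (T A)))).
  by rewrite lin_asc !lin_id; unmor; flat; drop_id.
clearbody g; have : g L = g L'.
  apply: free_uniq; apply: mor_inj; unmor; rewrite !gE; flat.
  exchange (mor (lin c)) (mor (eta m A)).
  have := f_equal mor E; unmor => H. srew H. done.
move=> Eg; apply: lin_eq; apply: mor_inj.
rewrite -(right_uncurry_curry d (typed_mor (lin L))) -(right_uncurry_curry d (typed_mor (lin L'))).
by rewrite -!gE Eg.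
Qed.
End Extensions.

(* [sealed x] is a copy of [x] that unification cannot unfold to a composite. *)
Lemma seal (A : Type) (x : A) : {y : A | y = x}.
Proof. by exists x. Qed.

Definition sealed (A : Type) (x : A) : A := proj1_sig (seal x).
Lemma sealedE (A : Type) (x : A) : sealed x = x.
Proof. exact: (proj2_sig (seal x)). Qed.

(** * The lift of a centralizer to modules *)

Section JointlyEpic.
Variables (C : MonCat) (T : Bimonad C).
Local Notation m := (bmon T).
Local Notation com := (bcom T).
Local Notation TC := (ModMonCat (bimonadP T)).
Local Notation F := (free m : Functor C TC).
Hypothesis rightC : has_right_duals C.
Hypothesis leftTC : has_left_duals TC.
Hypothesis rightTC : has_right_duals TC.

(* With values in the unit and after tensoring with any [D], so that the
   property passes from [j] to its linear extension to free modules. *)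
Definition jointly_epic (I : Type) (N : I -> C) (X : I -> C) (B : C)
    (j : forall i, Hom (X i) (N i ⊗ B)) :=
  forall (D : C) (f g : Hom (B ⊗ D) one),
    (forall i, (ι (N i) ⊛ mor f) • (mor (j i) ⊛ ι D) = (ι (N i) ⊛ mor g) • (mor (j i) ⊛ ι D)) ->
    f = g.

(** A right dual of [W], taken as the parameter [D], reduces the target [W] to the unit. *)
Lemma jointly_epic_hom (I : Type) (N : I -> C) (X : I -> C) (B W : C)
    (j : forall i, Hom (X i) (N i ⊗ B)) (f g : Hom B W) :
  jointly_epic j -> (forall i, (idc (N i) ⊠ f) ∘ j i = (idc (N i) ⊠ g) ∘ j i) -> f = g.
Proof.
move=> J E; have [R [e [c d]]] := rightC W.
apply: (left_pairing_inj d); apply: J => i; unmor; flat.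
have := f_equal mor (E i); unmor => H. by srew H.
Qed.

Definition free_map (N : TC) (X B : C) (j : Hom X (mcar N ⊗ B)) : @Hom TC (F X) (N ⊗ F B) :=
  @counit C T m (N ⊗ F B) ∘ fmap F ((idc (mcar N) ⊠ eta m B) ∘ j).

Lemma free_mapE (N : TC) (X B : C) (j : Hom X (mcar N ⊗ B)) :
  lin (free_map j) = (mact N ⊠ idc (T B)) ∘ com2 com (mcar N) B ∘ fmap T j.
Proof.
rewrite /= fmapD !compA -(compA _ (com2 _ _ _)) com2_nat fmap1 compA -tensmD.
by rewrite compf1 mu_Teta.
Qed.

Lemma free_map_eta (N : TC) (X B : C) (j : Hom X (mcar N ⊗ B)) :
  lin (free_map j) ∘ eta m X = (idc (mcar N) ⊠ eta m B) ∘ j.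
Proof. by rewrite /= -compA -eta_nat compA -[RHS]comp1f -(mact1 (N ⊗ F B)). Qed.

(** A linear map out of [F X ⊗ F D] is determined by its restriction to [X ⊗ T D] and also by the
    one to [T X ⊗ D]; this is the map on which the two sides are exchanged. *)
Definition free_map_tens (N : TC) (X B : C) (j : Hom X (mcar N ⊗ B)) (D : C)
  (L : @Hom TC (F B ⊗ F D) one) : @Hom TC (F X ⊗ F D) N :=
  run N ∘ (idc N ⊠ L) ∘ asc N (F B) (F D) ∘ (free_map j ⊠ idc (F D)).

Lemma free_map_tensE (N : TC) (X B : C) (j : Hom X (mcar N ⊗ B)) (D : C)
    (L : @Hom TC (F B ⊗ F D) one) :
  mor (lin (free_map_tens j L))
  = (ι (mcar N) ⊛ mor (lin L)) • (mor (lin (free_map j)) ⊛ ι (T D)).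
Proof.
have H : lin (free_map_tens j L) = run (mcar N) ∘ (idc (mcar N) ⊠ lin L)
    ∘ asc (mcar N) (T B) (T D) ∘ (lin (free_map j) ⊠ idc (T D)).
  by rewrite /free_map_tens !lin_comp !lin_tensm lin_run lin_asc.
rewrite H; move: (lin (free_map j)) => x. unmor; flat; drop_id. done.
Qed.

(** Extend [f] and [g] to linear maps [F B ⊗ F D -> one] and restrict these to [B ⊗ T D], where [j]
    tests equality with parameter [T D]. The tests come from linear maps out of [F X ⊗ F D], whose
    restrictions to [T X ⊗ D] agree by hypothesis. *)
Lemma jointly_epic_free (I : Type) (N : I -> TC) (X : I -> C) (B : C)
    (j : forall i, Hom (X i) (mcar (N i) ⊗ B)) :
  jointly_epic (N := fun i => mcar (N i)) j ->
  jointly_epic (N := fun i => mcar (N i)) (fun i => lin (free_map (j i))).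
Proof.
move=> J D f g E.
have [Lf Hf] := right_ext rightTC (N := F B) (N' := one) (f : Hom (_ ⊗ D) (mcar (one : TC))).
have [Lg Hg] := right_ext rightTC (N := F B) (N' := one) (g : Hom (_ ⊗ D) (mcar (one : TC))).
rewrite -Hf -Hg; suff -> : Lf = Lg by [].
apply: (left_ext_uniq leftTC); apply: J => i.
have K (L : @Hom TC (F B ⊗ F D) one) :
  (ι (mcar (N i)) ⊛ mor (lin L ∘ (eta m B ⊠ idc (T D)))) • (mor (j i) ⊛ ι (T D))
  = mor (lin (free_map_tens (j i) L)) • (mor (eta m (X i)) ⊛ ι (T D)).
  rewrite free_map_tensE; have := f_equal mor (free_map_eta (j i)).
  move: (lin (free_map (j i))) => x; unmor => H; flat. by srew H.
rewrite !K; suff -> : free_map_tens (j i) Lf = free_map_tens (j i) Lg by [].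
apply: (right_ext_uniq rightTC); apply: mor_inj.
have K' (L : @Hom TC (F B ⊗ F D) one) :
  mor (lin (free_map_tens (j i) L) ∘ (idc (T (X i)) ⊠ eta m D))
  = (ι (mcar (N i)) ⊛ mor (lin L ∘ (idc (T B) ⊠ eta m D))) • (mor (lin (free_map (j i))) ⊛ ι D).
  rewrite mor_comp free_map_tensE; move: (lin (free_map (j i))) => x; unmor; flat.
  by exchange (mor x) (mor (eta m D)).
by rewrite !K' Hf Hg E.
Qed.
End JointlyEpic.

Section LiftCentralizer.
Variables (C : MonCat) (T : Bimonad C).
Local Notation m := (bmon T).
Local Notation com := (bcom T).
Local Notation TC := (ModMonCat (bimonadP T)).
Local Notation F := (free m : Functor C TC).
Hypothesis leftC : has_left_duals C.
Hypothesis rightC : has_right_duals C.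
Hypothesis leftTC : has_left_duals TC.
Hypothesis rightTC : has_right_duals TC.
Variables (Q : Functor TC TC) (Z : Centralizer (cross Q)).
Local Notation P := (cross Q).

Definition Qfree (Y : C) : TC := Q (F Y).

Lemma zd_jointly_epic (X : C) :
  jointly_epic (N := fun Y => mcar (Qfree Y)) (fun Y => zd Z X Y).
Proof.
move=> D f g E; apply: mor_inj.
by apply: (zd_param_uniq leftC (Z := Z) (W := one)) => [||Y]; [ty|ty|exact: E].
Qed.

Lemma free_zd_exists (X W : C) (xi : forall Y, Hom (T (X ⊗ Y)) (mcar (Qfree Y) ⊗ W)) :
  (forall (Y Y' : C) (g : Hom Y Y'),
    xi Y' ∘ fmap T (idc X ⊠ g) = (lin (fmap Q (fmap F g)) ⊠ idc W) ∘ xi Y) ->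
  exists f : Hom (T (Z X)) W, forall Y, (idc (mcar (Qfree Y)) ⊠ f) ∘ lin (free_map (N := Qfree Y) (zd Z X Y)) = xi Y.
Proof.
move=> xi_nat; have [R [e [c d]]] := rightC W.
(* The target [W] becomes a parameter [R] in the source. *)
pose k Y : Hom (T (X ⊗ Y) ⊗ R) (mcar (Qfree Y)) :=
  run _ ∘ (idc _ ⊠ e) ∘ asc _ W R ∘ (xi Y ⊠ idc R).
have kE Y : mor (k Y) = (ι (mcar (Qfree Y)) ⊛ mor e) • (mor (xi Y) ⊛ ι R).
  by rewrite /k; unmor; flat; drop_id.
clearbody k.
(* Extending linearly in [R] gives maps out of [F (X ⊗ Y) ⊗ F R], which may then be restricted in
   the first factor. *)
pose L Y := proj1_sig (constructive_indefinite_description _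
  (right_ext rightTC (N := F (X ⊗ Y)) (N' := Qfree Y) (k Y))).
have LE Y : lin (L Y) ∘ (idc (T (X ⊗ Y)) ⊠ eta m R) = k Y.
  by rewrite /L; case: constructive_indefinite_description.
clearbody L.
have Lnat (Y Y' : C) (g : Hom Y Y') :
  L Y' ∘ (fmap F (idc X ⊠ g) ⊠ idc (F R)) = fmap Q (fmap F g) ∘ L Y.
  apply: (right_ext_uniq rightTC); apply: mor_inj.
  have E1 := f_equal mor (LE Y); have E2 := f_equal mor (LE Y').
  have E3 := f_equal mor (xi_nat _ _ g).
  rewrite !lin_comp lin_tensm lin_id; move: E1 E2 E3; rewrite /=.
  rewrite !kE; move: (lin (L Y)) (lin (L Y')) (fmap T (idc X ⊠ g)) (lin (fmap Q (freem m g))) => l l' x y.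
  unmor => E1 E2 E3; flat.
  exchange (mor x) (mor (eta m R)).
  srew E2. srew E3. srew E1. by exchange (mor y) (mor e).
(* On [X ⊗ Y ⊗ T R] there is no [T] around [X ⊗ Y] any more, and the centralizer applies. *)
have [Y|Y Y' g|h Hh] := @zd_param C leftC P Z X (T R) one
    (fun Y => mor (lin (L Y)) • (mor (eta m (X ⊗ Y)) ⊛ ι (T R))).
- ty.
- have E := f_equal (fun x => mor (lin x)) (Lnat _ _ g).
  have E2 := f_equal mor (eta_nat m (idc X ⊠ g)).
  move: E E2; rewrite !lin_comp lin_tensm lin_id /=.
  move: (lin (L Y)) (lin (L Y')) (fmap T (idc X ⊠ g)) (lin (fmap Q (freem m g))) => l l' x y.
  unmor => E1 E2; flat. srew E2. srew E1. done.
(* The way back: [h] extends to [F (Z X) ⊗ F R], is restricted to [T (Z X) ⊗ R], and [R] returns to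
   the target as [W]. *)
- have [M HM] := left_ext leftTC (N := F R) (N' := one) (h : Hom _ (mcar (one : TC))).
  have E Y : free_map_tens (N := Qfree Y) (zd Z X Y) M = L Y.
    apply: (left_ext_uniq leftTC); apply: mor_inj.
    have E1 := f_equal mor (free_map_eta (N := Qfree Y) (zd Z X Y)).
    have E2 := Hh Y; have E3 := f_equal mor HM.
    rewrite mor_comp free_map_tensE. move: E1 E2 E3.
    move: (lin (free_map _)) (lin (L Y)) (lin M) => x l n; unmor => E1 E2 E3; flat.
    srew E1. srew E3. rewrite E2. by flat.
  pose f0 : Hom (T (Z X) ⊗ R) one := lin M ∘ (idc _ ⊠ eta m R).
  have Tf : typed (T (Z X)) ((mor f0 ⊛ ι W) • (ι (T (Z X)) ⊛ mor c)) W by ty.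
  exists (realize Tf) => Y; apply: mor_inj.
  set w := (X in X = _); have Tw : typed (T (X ⊗ Y)) w (mcar (Qfree Y) ⊗ W) by exact: typed_mor.
  rewrite -(curry_uncurry d Tw) -(curry_uncurry d (typed_mor (xi Y))).
  congr (_ ⊛ _ • _); rewrite -kE -LE -E /w.
  rewrite !mor_comp free_map_tensE.
  have Hf0 := uncurry_curry d (typed_mor f0).
  have f0E : mor f0 = mor (lin M) • (ι (T (Z X)) ⊛ mor (eta m R)) by rewrite /f0; unmor.
  move: (lin M) (lin (free_map (N := Qfree Y) (zd Z X Y))) (lin (free_map _)) f0E => l x x' f0E.
  unmor; rewrite realizeE; clearbody f0; flat.
  srew Hf0. rewrite f0E; flat. by exchange (mor x') (mor (eta m R)).
Qed.

(* The linear extension of [(idc ⊠ eta) ∘ zd]. *)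
Definition free_zd (X Y : C) : @Hom TC (F (X ⊗ Y)) (Qfree Y ⊗ F (Z X)) :=
  sealed (free_map (N := Qfree Y) (zd Z X Y)).

Lemma free_zdE (X Y : C) :
  lin (free_zd X Y) = (mact (Qfree Y) ⊠ idc _) ∘ com2 com (mcar (Qfree Y)) (Z X) ∘ fmap T (zd Z X Y).
Proof. rewrite /free_zd sealedE; exact: free_mapE. Qed.

Lemma free_zd_eta (X Y : C) : lin (free_zd X Y) ∘ eta m (X ⊗ Y) = (idc _ ⊠ eta m (Z X)) ∘ zd Z X Y.
Proof. rewrite /free_zd sealedE; exact: (free_map_eta (N := Qfree Y)). Qed.

Lemma zd_epic (X W : C) (f g : Hom (Z X) W) :
  (forall Y, (idc _ ⊠ f) ∘ zd Z X Y = (idc _ ⊠ g) ∘ zd Z X Y) -> f = g.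
Proof. by move=> E; apply: (zd_uniq (Z := Z)) => Y; have := f_equal mor (E Y); unmor. Qed.

Lemma free_zd_jointly_epic (X : C) :
  jointly_epic (N := fun Y => mcar (Qfree Y)) (fun Y => lin (free_zd X Y)).
Proof.
have -> : (fun Y => lin (free_zd X Y)) = (fun Y => lin (free_map (N := Qfree Y) (zd Z X Y))).
  by apply: functional_extensionality_dep => Y; rewrite /free_zd sealedE.
apply (jointly_epic_free (N := Qfree) leftTC rightTC (j := fun Y => zd Z X Y)).
exact: zd_jointly_epic.
Qed.

Lemma free_zd_epic (X W : C) (f g : Hom (T (Z X)) W) :
  (forall Y, (idc _ ⊠ f) ∘ lin (free_zd X Y) = (idc _ ⊠ g) ∘ lin (free_zd X Y)) -> f = g.
Proof.
move=> E; apply (@jointly_epic_hom C rightC C (fun Y => mcar (Qfree Y)) (fun Y => T (X ⊗ Y))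
  (T (Z X)) W (fun Y => lin (free_zd X Y))); [exact: free_zd_jointly_epic | exact: E].
Qed.

(** [jointly_epic_free] is applied to its own conclusion; associativity of the lifted action is an
    equation on [T (T (Z X))]. *)
Lemma free_free_zd_epic (X W : C) (f g : Hom (T (T (Z X))) W) :
  (forall Y, (idc _ ⊠ f) ∘ ((mact (Qfree Y) ⊠ idc _) ∘ com2 com _ _ ∘ fmap T (lin (free_zd X Y)))
    = (idc _ ⊠ g) ∘ ((mact (Qfree Y) ⊠ idc _) ∘ com2 com _ _ ∘ fmap T (lin (free_zd X Y)))) -> f = g.
Proof.
move=> E; apply (@jointly_epic_hom C rightC C (fun Y => mcar (Qfree Y)) (fun Y => T (T (X ⊗ Y)))
  (T (T (Z X))) W (fun Y => lin (free_map (N := Qfree Y) (lin (free_zd X Y))))).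
  apply (jointly_epic_free (N := Qfree) leftTC rightTC (j := fun Y => lin (free_zd X Y))).
  exact: free_zd_jointly_epic.
by move=> Y; rewrite free_mapE; exact: E.
Qed.

(* The universal morphism at modules; it depends only on the carrier [X] of the
   first one. *)
Definition zd_mod (X : C) (N : TC) : Hom (X ⊗ mcar N) (mcar (Q N) ⊗ Z X) :=
  sealed ((lin (fmap Q (counit m N)) ⊠ idc (Z X)) ∘ zd Z X (mcar N)).

Lemma zd_modE (X : C) (N : TC) :
  zd_mod X N = (lin (fmap Q (counit m N)) ⊠ idc (Z X)) ∘ zd Z X (mcar N).
Proof. exact: sealedE. Qed.

Lemma zd_mod_natl (X X' : C) (N : TC) (f : Hom X X') :
  zd_mod X' N ∘ (f ⊠ idc (mcar N)) = (idc _ ⊠ fmap Z f) ∘ zd_mod X N.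
Proof. by rewrite !zd_modE -!compA (zd_nat Z) fmap1 !compA -!tensmD !comp1f !compf1. Qed.

Lemma zd_mod_natr (X : C) (N N' : TC) (g : @Hom TC N N') :
  zd_mod X N' ∘ (idc X ⊠ lin g) = (lin (fmap Q g) ⊠ idc _) ∘ zd_mod X N.
Proof.
have E : lin (fmap Q (counit m N')) ∘ lin (fmap Q (fmap F (lin g)))
  = lin (fmap Q g) ∘ lin (fmap Q (counit m N)).
  by rewrite -!lin_comp -!fmapD counit_nat.
rewrite !zd_modE -!compA (zd_nat Z) fmap1 !compA -!tensmD !comp1f.
by congr ((_ ⊠ _) ∘ _); exact: E.
Qed.

Lemma zd_mod_free (X Y : C) : zd_mod X (F Y) ∘ (idc X ⊠ eta m Y) = zd Z X Y.
Proof.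
have E : lin (fmap Q (counit m (F Y))) ∘ lin (fmap Q (fmap F (eta m Y))) = idc _.
  rewrite -lin_comp -fmapD -[RHS]lin_id -fmap1; congr (lin (fmap Q _)).
  by apply: lin_eq; exact: mu_Teta.
rewrite !zd_modE -!compA (zd_nat Z) fmap1 compA -tensmD comp1f -[RHS]comp1f -tensm1.
by congr ((_ ⊠ _) ∘ _); exact: E.
Qed.

(** The fusion operator of [M], built from linear maps so that its linearity comes with it. *)
Definition act_free (M : TC) (Y : C) : @Hom TC (F (mcar M ⊗ Y)) (M ⊗ F Y) :=
  sealed (@tensm TC _ _ _ _ (counit m M) (idc (F Y)) ∘ free_com2 T (mcar M) Y).

Lemma act_freeE (M : TC) (Y : C) :
  lin (act_free M Y) = (mact M ⊠ idc (T Y)) ∘ com2 com (mcar M) Y.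
Proof. by rewrite /act_free sealedE lin_comp free_com2E lin_tensm. Qed.

Lemma act_free_eta (M : TC) (Y : C) :
  lin (act_free M Y) ∘ eta m (mcar M ⊗ Y) = idc (mcar M) ⊠ eta m Y.
Proof.
have [E2 _] := eta_com (bimonadP T).
have E := E2 (mcar M) Y; rewrite /= compf1 in E.
by rewrite act_freeE -compA E -tensmD mact1 comp1f.
Qed.

Lemma act_free_nat (M : TC) (Y Y' : C) (g : Hom Y Y') :
  lin (act_free M Y') ∘ fmap T (idc (mcar M) ⊠ g) = (idc (mcar M) ⊠ fmap T g) ∘ lin (act_free M Y).
Proof.
by rewrite !act_freeE -compA com2_nat fmap1 !compA -!tensmD !comp1f !compf1.
Qed.

Lemma act_free_natl (M M' : TC) (f : @Hom TC M M') (Y : C) :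
  lin (act_free M' Y) ∘ fmap T (lin f ⊠ idc Y) = (lin f ⊠ idc _) ∘ lin (act_free M Y).
Proof.
by rewrite !act_freeE -compA com2_nat fmap1 !compA -!tensmD !comp1f (linP f).
Qed.

(** The equation is forced: it is linearity of [zd_mod] at the free module [F Y], restricted along
    the unit of [Y]. *)
Lemma lift_act_exists (M : TC) : exists f : Hom (T (Z (mcar M))) (Z (mcar M)),
  forall Y, (idc (mcar (Qfree Y)) ⊠ f) ∘ lin (free_zd (mcar M) Y) = zd_mod (mcar M) (F Y) ∘ lin (act_free M Y).
Proof.
have [Y Y' g|f Hf] := free_zd_exists (xi := fun Y => zd_mod (mcar M) (F Y) ∘ lin (act_free M Y));
  last by exists f => Y; rewrite /free_zd sealedE.
by rewrite -compA act_free_nat compA (zd_mod_natr _ (fmap F g)) -compA.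
Qed.

Definition lift_act (M : TC) : Hom (T (Z (mcar M))) (Z (mcar M)) :=
  proj1_sig (constructive_indefinite_description _ (lift_act_exists M)).

Lemma lift_actE (M : TC) (Y : C) :
  (idc (mcar (Qfree Y)) ⊠ lift_act M) ∘ lin (free_zd (mcar M) Y) = zd_mod (mcar M) (F Y) ∘ lin (act_free M Y).
Proof. by rewrite /lift_act; case: constructive_indefinite_description. Qed.

(** Linearity of [zd_mod]: the free case [lift_actE] on the carrier of [N] is carried to [N] by [Q]
    of the counit. *)
Lemma lift_act_zd_mod (M N : TC) :
  zd_mod (mcar M) N ∘ ((mact M ⊠ mact N) ∘ com2 com (mcar M) (mcar N))
  = (mact (Q N) ⊠ lift_act M) ∘ com2 com (mcar (Q N)) (Z (mcar M)) ∘ fmap T (zd_mod (mcar M) N).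
Proof.
have E := f_equal (fun x => (lin (fmap Q (counit m N)) ⊠ idc _) ∘ x) (lift_actE M (mcar N)).
have E2 := zd_mod_natr (mcar M) (counit m N).
rewrite /= in E2; move: E; rewrite /= (compA (lin _ ⊠ _) (zd_mod _ _)) -E2 act_freeE free_zdE.
rewrite -!compA (compA (idc _ ⊠ mact N)) -tensmD comp1f compf1 => <-.
have L := linP (fmap Q (counit m N)); rewrite /IsLinear in L.
rewrite [in RHS]zd_modE fmapD !compA -(compA _ (com2 _ _ _) (fmap T (_ ⊠ _))) com2_nat !compA.
by rewrite -!tensmD !comp1f fmap1 !compf1 L.
Qed.

Lemma lift_act_uniq (M : TC) (a : Hom (T (Z (mcar M))) (Z (mcar M))) :
  (forall N : TC, zd_mod (mcar M) N ∘ ((mact M ⊠ mact N) ∘ com2 com (mcar M) (mcar N))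
  = (mact (Q N) ⊠ a) ∘ com2 com (mcar (Q N)) (Z (mcar M)) ∘ fmap T (zd_mod (mcar M) N)) ->
  a = lift_act M.
Proof.
move=> Ha; apply: free_zd_epic => Y; rewrite lift_actE free_zdE.
have E := f_equal (fun x => x ∘ fmap T (idc _ ⊠ eta m Y)) (Ha (F Y)).
move: E; rewrite /= -!compA -fmapD zd_mod_free com2_nat (compA (_ ⊠ _) (fmap T _ ⊠ _)) -tensmD.
rewrite fmap1 compf1 mu_Teta -act_freeE => ->.
by rewrite !compA -!tensmD comp1f compf1.
Qed.

Lemma lift_act1 (M : TC) : lift_act M ∘ eta m (Z (mcar M)) = idc _.
Proof.
apply: zd_epic => Y.
rewrite -(comp1f (idc (P Y))) tensmD -compA.
have E := free_zd_eta (mcar M) Y; rewrite /= in E.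
rewrite -E compA lift_actE -compA act_free_eta zd_mod_free.
by rewrite !comp1f tensm1 comp1f.
Qed.

(** On the jointly epic family both sides become [zd_mod] after [act_free] after [mu]: the left one
    by linearity of [zd_mod] and [act_free], the right one by linearity of [free_zd]. *)
Lemma lift_actM (M : TC) : lift_act M ∘ fmap T (lift_act M) = lift_act M ∘ mu m (Z (mcar M)).
Proof.
apply: free_free_zd_epic => Y.
have E1 : (idc _ ⊠ mu m (Z (mcar M))) ∘ ((mact (Qfree Y) ⊠ idc _) ∘ com2 com _ _ ∘ fmap T (lin (free_zd (mcar M) Y)))
    = lin (free_zd (mcar M) Y) ∘ mu m (mcar M ⊗ Y).
  have L := linP (free_zd (mcar M) Y); rewrite /IsLinear /= in L.
  by rewrite L !compA -!tensmD comp1f compf1.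
have L := linP (act_free M Y); rewrite /IsLinear /= in L.
transitivity (zd_mod (mcar M) (F Y) ∘ lin (act_free M Y) ∘ mu m (mcar M ⊗ Y)).
- rewrite !compA -tensmD comp1f compf1.
  have -> : mact (Qfree Y) ⊠ (lift_act M ∘ fmap T (lift_act M))
     = (mact (Qfree Y) ⊠ lift_act M) ∘ (fmap T (idc _) ⊠ fmap T (lift_act M)).
    by rewrite -tensmD fmap1 compf1.
  rewrite -!compA (compA (fmap T _ ⊠ _)) -com2_nat -!compA -fmapD lift_actE fmapD.
  by rewrite !compA -(lift_act_zd_mod M (F Y)) -!compA L !compA.
- by rewrite tensm_r -[RHS]compA E1 compA lift_actE.
Qed.

Lemma lift_act_nat (M M' : TC) (f : @Hom TC M M') :
  fmap Z (lin f) ∘ lift_act M = lift_act M' ∘ fmap T (fmap Z (lin f)).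
Proof.
apply: free_zd_epic => Y.
transitivity (zd_mod (mcar M') (F Y) ∘ lin (act_free M' Y) ∘ fmap T (lin f ⊠ idc Y)).
- rewrite tensm_r -compA lift_actE compA -zd_mod_natl.
  by rewrite -!compA act_free_natl.
- rewrite -lift_actE !free_zdE.
  rewrite tensm_r -!compA -fmapD (zd_nat Z) fmap1.
  rewrite fmapD (compA (com2 _ _ _) (fmap T (_ ⊠ _))) com2_nat fmap1.
  by rewrite !compA; congr (_ ∘ _ ∘ _); rewrite -!compA -!tensmD !comp1f !compf1.
Qed.

Definition lift_ob (M : TC) : TC :=
  @Build_Module C T m (Z (mcar M)) (lift_act M) (lift_actM M) (lift_act1 M).

Definition lift_hom (M M' : TC) (f : @Hom TC M M') : @Hom TC (lift_ob M) (lift_ob M') :=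
  @Build_MHom C T m (lift_ob M) (lift_ob M') (fmap Z (lin f)) (lift_act_nat f).

Definition lift_fun : Functor TC TC.
Proof.
refine (@Build_Functor TC TC lift_ob lift_hom _ _).
- abstract (by move=> M; apply: lin_eq; rewrite /= fmap1).
- abstract (by move=> M M' M'' g f; apply: lin_eq; rewrite /= fmapD).
Defined.

Lemma lift_zdP (M N : TC) :
  @IsLinear C T m (M ⊗ N) (Q N ⊗ lift_ob M) (zd_mod (mcar M) N).
Proof. by rewrite /IsLinear; exact: lift_act_zd_mod. Qed.

Definition lift_zd (M N : TC) : @Hom TC (M ⊗ N) (Q N ⊗ lift_fun M) :=
  @Build_MHom C T m (M ⊗ N) (Q N ⊗ lift_ob M) _ (lift_zdP M N).

Lemma lift_zd_nat (M M' N N' : TC) (f : @Hom TC M M') (g : @Hom TC N N') :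
  lift_zd M' N' ∘ (f ⊠ g) = (fmap Q g ⊠ fmap lift_fun f) ∘ lift_zd M N.
Proof.
apply: lin_eq; rewrite !lin_comp !lin_tensm /=.
rewrite (tensm_rl (lin f)) compA (zd_mod_natr _ g) -compA zd_mod_natl compA -tensmD.
by rewrite comp1f compf1.
Qed.

(** Restricted to the generators of free modules, [xi] is a family for [Z] and yields [r]; counits
    recover [xi] at every module. Linearity of [r] is an equation on [T (Z M)], tested with
    [free_zd_epic]. *)
Lemma lift_zd_univ (M K : TC) (xi : forall N : TC, @Hom TC (M ⊗ N) (Q N ⊗ K)) :
  (forall (N N' : TC) (g : @Hom TC N N'),
     xi N' ∘ (idc M ⊠ g) = (fmap Q g ⊠ idc K) ∘ xi N) ->
  exists! r : @Hom TC (lift_fun M) K,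
    forall N : TC, xi N = (idc (Q N) ⊠ r) ∘ lift_zd M N.
Proof.
move=> xi_nat.
have xn (N N' : TC) (g : @Hom TC N N') :
    lin (xi N') ∘ (idc _ ⊠ lin g) = (lin (fmap Q g) ⊠ idc _) ∘ lin (xi N).
  exact: (f_equal (@lin _ _ _ _ _) (xi_nat _ _ g)).
pose xi' (Y : C) : Hom (mcar M ⊗ Y) (P Y ⊗ mcar K) := lin (xi (F Y)) ∘ (idc _ ⊠ eta m Y).
have [|r [Hr r_uniq]] := @zd_univ _ _ Z (mcar M) (mcar K) xi'.
  move=> Y Y' g; rewrite /xi' -compA -tensmD eta_nat tensmD !compA.
  by congr (_ ∘ _); exact: (xn _ _ (fmap F g)).
have rE N : lin (xi N) = (idc _ ⊠ r) ∘ zd_mod (mcar M) N.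
  rewrite zd_modE compA -tensmD comp1f compf1 tensm_lr -compA -(Hr (mcar N)) /xi' compA.
  by rewrite -(xn _ _ (counit m N)) -compA -tensmD mact1 comp1f tensm1 compf1.
have r_lin : @IsLinear C T m (lift_ob M) K r.
  rewrite /IsLinear; apply: free_zd_epic => Y.
  transitivity (lin (xi (F Y)) ∘ lin (act_free M Y)).
    by rewrite tensm_r -compA lift_actE compA -rE.
  have L := linP (xi (F Y)); rewrite /IsLinear /= in L.
  rewrite free_zdE; transitivity ((mact (Qfree Y) ⊠ mact K) ∘ com2 com _ _ ∘ fmap T ((idc (P Y) ⊠ r) ∘ zd Z (mcar M) Y)).
    rewrite -Hr /xi' fmapD compA -L -!compA com2_nat fmap1 (compA (_ ⊠ _)) -tensmD compf1 mu_Teta.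
    by rewrite -act_freeE.
  rewrite fmapD !compA -(compA _ (com2 _ _ _) (fmap T (_ ⊠ _))) com2_nat fmap1 !compA.
  by rewrite -!tensmD !comp1f !compf1.
exists (@Build_MHom C T m (lift_ob M) K r r_lin); split=> [N|r' Hr'].
  by apply: lin_eq; rewrite lin_comp lin_tensm; exact: rE.
apply: lin_eq; apply: r_uniq => Y; rewrite /xi'.
rewrite Hr' lin_comp lin_tensm -compA /=; congr (_ ∘ _).
exact: zd_mod_free.
Qed.

Definition lift_centralizer : Centralizer Q :=
  @Build_Centralizer TC Q lift_fun lift_zd lift_zd_nat lift_zd_univ.
End LiftCentralizer.

Lemma functor_eq (C D : Category) (F G : Functor C D) (e : forall X, F X = G X) :
  (forall X Y (f : Hom X Y), eqhom (e Y) ∘ fmap F f = fmap G f ∘ eqhom (e X)) -> F = G.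
Proof.
case: F e => F f F1 FD; case: G => G g G1 GD /= e.
have E : F = G by apply: functional_extensionality_dep.
case: _ / E g G1 GD e => g G1 GD e H.
have E : f = g.
  apply: functional_extensionality_dep => X; apply: functional_extensionality_dep => Y.
  apply: functional_extensionality_dep => h.
  by have := H X Y h; rewrite !eqhom1 comp1f compf1.
by case: _ / E G1 GD H => G1 GD _; rewrite (proof_irrelevance _ F1 G1) (proof_irrelevance _ FD GD).
Qed.

Lemma distr_law_eq (C : Category) (T P : Functor C C) (mT : Monad T) (mP : Monad P)
  (O O' : DistrLaw mT mP) : (forall X, O X = O' X) -> O = O'.
Proof.
case: O => o ? ? ? ? ?; case: O' => o' ? ? ? ? ? /= E.
have {}E : o = o' by apply: functional_extensionality_dep.
by subst; f_equal; exact: proof_irrelevance.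
Qed.

(** * The canonical distributive law *)

Section LiftedStructure.
Variables (C : MonCat) (T : Bimonad C).
Local Notation m := (bmon T).
Local Notation com := (bcom T).
Local Notation TC := (ModMonCat (bimonadP T)).
Local Notation F := (free m : Functor C TC).
Hypothesis leftC : has_left_duals C.
Hypothesis rightC : has_right_duals C.
Hypothesis leftTC : has_left_duals TC.
Hypothesis rightTC : has_right_duals TC.
Variables (Q : Functor TC TC) (cQ : Comonoidal Q) (Z : Centralizer (cross Q)).
Local Notation P := (cross Q).
Local Notation W := (lift_centralizer leftC rightC leftTC rightTC Z).
Local Notation lift_act := (lift_act leftC rightC leftTC rightTC Z).
Local Notation cP := (cross_com cQ).

Lemma zd_mod_ext (X Y : C) (N : TC) (g : Hom Y (mcar N)) :
  zd_mod Z X N ∘ (idc X ⊠ g) = (lin (fmap Q (counit m N ∘ fmap F g)) ⊠ idc _) ∘ zd Z X Y.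
Proof.
rewrite zd_modE -compA (zd_nat Z) fmap1 compA -tensmD comp1f fmapD lin_comp.
by [].
Qed.

Lemma lift_zdE (M N : TC) : lin (zd W M N) = zd_mod Z (mcar M) N.
Proof. by []. Qed.

Section Monad.
Variables (mZ : Monad Z) (mW : Monad W).
Hypothesis HZ : IsCentralizerMonad cP mZ.
Hypothesis HW : IsCentralizerMonad cQ mW.

Lemma lin_eta_lift (M : TC) : lin (eta mW M) = eta mZ (mcar M).
Proof.
have [_ E] := HZ; have [_ E'] := HW; rewrite E E' cross_com0E !lin_comp lin_lun lin_tensm.
rewrite (lin_eqhom_mod (eq_sym (tens1r M)) (eq_sym (tens1r (mcar M)))) lin_id /= zd_modE.
by rewrite tensm_l !compA.
Qed.

(** Restricting the equation for [W] at [F Y1] and [F Y2] along the units produces, by [zd_mod_ext],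
    the factor [Q (free_com2)]; together with [Q_2] this is the comonoidal structure of [Q ⋊ T]. *)
Lemma lin_mu_lift (M : TC) : lin (mu mW M) = mu mZ (mcar M).
Proof.
apply: (zd_uniq (Z := Z)) => Y2.
rewrite -(zbraid_mu leftC HZ).
apply: (zd_param_uniq leftC (Z := Z) (W := P Y2 ⊗ Z (mcar M))) => [||Y1]; try ty.
rewrite (zbraidE leftC).
have [E _] := HW; have := f_equal (@lin _ _ _ _ _) (E M (F Y1) (F Y2)).
rewrite !lin_comp !lin_tensm !lin_asc !lin_id !lift_zdE.
move: (lin (mu mW M) : Hom (Z (Z (mcar M))) (Z (mcar M))) => u /(f_equal mor) {}E.
have {}E := f_equal (fun x => x • (ι (mcar M) ⊛ mor (eta m Y1 ⊠ eta m Y2))) E.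
have H1 := f_equal mor (zd_mod_ext (mcar M) (N := F Y1 ⊗ F Y2) (eta m Y1 ⊠ eta m Y2)).
have H2 := f_equal mor (zd_mod_free Z (mcar M) Y1).
have H3 := f_equal mor (zd_mod_free Z (Z (mcar M)) Y2).
rewrite cross_com2E lin_comp.
change (counit m (F Y1 ⊗ F Y2) ∘ fmap F (eta m Y1 ⊠ eta m Y2)) with (free_com2 T Y1 Y2) in H1 |- *.
move: H1 E; unmor => H1.
move=> E.
have {}E : (ι (P Y1) ⊛ ι (P Y2) ⊛ mor u) • (ι (P Y1) ⊛ mor (zd_mod Z (Z (mcar M)) (F Y2)))
    • (mor (zd_mod Z (mcar M) (F Y1)) ⊛ ι (T Y2)) • (ι (mcar M) ⊛ mor (eta m Y1) ⊛ mor (eta m Y2))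
  = (mor (lin (com2 cQ (F Y1) (F Y2))) ⊛ ι (Z (mcar M)))
    • mor (zd_mod Z (mcar M) (F Y1 ⊗ F Y2)) • (ι (mcar M) ⊛ mor (eta m Y1) ⊛ mor (eta m Y2)).
  move: E; flat; drop_id. exact.
move: E; rewrite -(acompA _ (mor (zd_mod Z (mcar M) (F Y1 ⊗ F Y2)))) H1.
move: H2 H3; unmor => H2 H3 E.
transitivity ((ι (P Y1) ⊛ ι (P Y2) ⊛ mor u) • (ι (P Y1) ⊛ mor (zd_mod Z (Z (mcar M)) (F Y2)))
    • (mor (zd_mod Z (mcar M) (F Y1)) ⊛ ι (T Y2)) • (ι (mcar M) ⊛ mor (eta m Y1) ⊛ mor (eta m Y2))).
- rewrite (tens_slices (typed_mor (eta m Y1)) (typed_mor (eta m Y2))); flat.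
  srew H2. exchange (mor (zd Z (mcar M) Y1)) (mor (eta m Y2)).
  srew H3. done.
- rewrite {}E. move: (lin (com2 cQ _ _)) (lin (fmap Q (free_com2 T Y1 Y2))) => c2 q2.
  by flat.
Qed.

Lemma lift_act_mu (M : TC) : mu mZ (mcar M) ∘ lift_act (W M) = lift_act M ∘ fmap T (mu mZ (mcar M)).
Proof. by have := linP (mu mW M); rewrite /IsLinear lin_mu_lift. Qed.

Lemma lift_act_eta (M : TC) : eta mZ (mcar M) ∘ mact M = lift_act M ∘ fmap T (eta mZ (mcar M)).
Proof. by have := linP (eta mW M); rewrite /IsLinear lin_eta_lift. Qed.

(** The formula is forced: at [F X] a canonical law satisfies [Z (mu) ∘ O_(T X) = lift_act (F X)],
    and naturality with [mu ∘ T eta = id] isolates [O_X]. *)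
Definition canonical_law_fun (X : C) : Hom (T (Z X)) (Z (T X)) :=
  sealed (lift_act (F X) ∘ fmap T (fmap Z (eta m X))).

Lemma canonical_law_funE (X : C) :
  canonical_law_fun X = lift_act (F X) ∘ fmap T (fmap Z (eta m X)).
Proof. exact: sealedE. Qed.

Lemma lift_act_free_nat (X : C) (N : TC) (f : @Hom TC (F X) N) :
  lift_act N ∘ fmap T (fmap Z (lin f)) = fmap Z (lin f) ∘ lift_act (F X).
Proof. by rewrite -lift_act_nat. Qed.

Lemma canonical_law_act (M : TC) : fmap Z (mact M) ∘ canonical_law_fun (mcar M) = lift_act M.
Proof.
have := lift_act_free_nat (counit m M); rewrite canonical_law_funE compA => <-.
by rewrite -compA -!fmapD mact1 !fmap1 compf1.
Qed.

Local Notation O := canonical_law_fun.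

Lemma canonical_law_nat (X Y : C) (f : Hom X Y) :
  O Y ∘ fmap T (fmap Z f) = fmap Z (fmap T f) ∘ O X.
Proof.
have E : lift_act (F Y) ∘ fmap T (fmap Z (fmap T f)) = fmap Z (fmap T f) ∘ lift_act (F X).
  exact: (lift_act_free_nat (fmap F f)).
by rewrite !canonical_law_funE compA -E -!compA -!(fmapD T) -!(fmapD Z) eta_nat.
Qed.

(** Besides linearity of the product of [W] ([E1]), the point is that the action on [W (F X)] is
    itself a linear map from a free module; naturality of [lift_act] along it ([E2]) supplies the
    second [O]. *)
Lemma canonical_law_mu (X : C) : O X ∘ fmap T (mu mZ X) = mu mZ (T X) ∘ fmap Z (O X) ∘ O (Z X).
Proof.
have E1 : mu mZ (T X) ∘ lift_act (W (F X)) = lift_act (F X) ∘ fmap T (mu mZ (T X)).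
  exact: (lift_act_mu (F X)).
have E2 : fmap Z (lift_act (F X)) ∘ lift_act (F (Z (T X))) = lift_act (W (F X)) ∘ fmap T (fmap Z (lift_act (F X))).
  exact: (lift_act_nat leftC rightC leftTC rightTC Z
      (@Build_MHom C T m (F (Z (T X))) (W (F X)) (lift_act (F X)) (eq_sym (mactM (W (F X)))))).
have E3 : lift_act (F X) ∘ eta m (Z (T X)) = idc _ by exact: (mact1 (W (F X))).
have E4 := canonical_law_nat (fmap Z (eta m X)).
transitivity (mu mZ (T X) ∘ (lift_act (W (F X)) ∘ fmap T (fmap Z (fmap Z (eta m X))))).
  by rewrite canonical_law_funE -[LHS]compA -fmapD -mu_nat fmapD compA -E1 -compA.
rewrite -[RHS]compA; congr (_ ∘ _).
rewrite [O X]canonical_law_funE fmapD -[RHS]compA -E4 canonical_law_funE !compA E2 -!compA; congr (_ ∘ _).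
by rewrite compA -!fmapD E3 comp1f.
Qed.

Lemma canonical_law_eta (X : C) : O X ∘ fmap T (eta mZ X) = eta mZ (T X).
Proof.
have E : eta mZ (T X) ∘ mu m X = lift_act (F X) ∘ fmap T (eta mZ (T X)) by exact: (lift_act_eta (F X)).
by rewrite !canonical_law_funE -compA -fmapD -eta_nat fmapD compA -E -compA mu_Teta compf1.
Qed.

Lemma canonical_law_muT (X : C) : O X ∘ mu m (Z X) = fmap Z (mu m X) ∘ O (T X) ∘ fmap T (O X).
Proof.
have E1 : lift_act (F X) ∘ fmap T (lift_act (F X)) = lift_act (F X) ∘ mu m (Z (T X)).
  exact: (mactM (W (F X))).
have E2 := canonical_law_act (F X); rewrite /= in E2.
by rewrite E2 !canonical_law_funE -compA -mu_nat compA -E1 -compA -fmapD.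
Qed.

Lemma canonical_law_etaT (X : C) : O X ∘ eta m (Z X) = fmap Z (eta m X).
Proof.
have E3 : lift_act (F X) ∘ eta m (Z (T X)) = idc _ by exact: (mact1 (W (F X))).
by rewrite !canonical_law_funE -compA -eta_nat compA E3 comp1f.
Qed.

Definition canonical_law : DistrLaw m mZ :=
  Build_DistrLaw canonical_law_nat canonical_law_mu canonical_law_eta
    canonical_law_muT canonical_law_etaT.

Lemma lifts_centralizer : LiftsCentralizer Z W.
Proof.
have e : compF (forget m : Functor TC C) W = compF Z (forget m : Functor TC C).
  refine (@functor_eq TC C (compF (forget m : Functor TC C) W) (compF Z (forget m : Functor TC C))
    (fun M => eq_refl (Z (mcar M))) _) => M N f.
  by rewrite /= comp1f compf1.
exists e => M N.
set h := f_equal _ e; have -> : eqhom h = idc (Z (mcar M)) by exact: (eqhom_irr h eq_refl).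
by rewrite lift_zdE zd_modE tensm1 comp1f.
Qed.

Lemma canonical_lawP : IsCanonicalLaw canonical_law.
Proof.
exists W; split; first exact: lifts_centralizer.
move=> M; apply: (@module_eq _ _ m (W M) (lift_module canonical_law M) eq_refl).
rewrite /IsLinear /= comp1f fmap1 compf1; exact: (eq_sym (canonical_law_act M)).
Qed.

(** The universal maps of any other lift are linear over the same [zd_mod], so [lift_act_uniq]
    identifies the actions. *)
Lemma canonical_law_uniq (O' : DistrLaw m mZ) : IsCanonicalLaw O' -> canonical_law = O'.
Proof.
move=> [W' [[e He] Hl]].
have act_eq (M : TC) : fmap Z (mact M) ∘ O' (mcar M) = lift_act M.
  apply: lift_act_uniq => N.
  pose f : @Hom TC (M ⊗ N) (Q N ⊗ lift_module O' M) :=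
    @tensm TC _ _ _ _ (idc (Q N)) (eqhom (Hl M) : @Hom TC (W' M) (lift_module O' M)) ∘ zd W' M N.
  have Ef : lin f = zd_mod Z (mcar M) N.
    rewrite zd_modE -(He M N) /f lin_comp lin_tensm lin_id; congr ((_ ⊠ _) ∘ _).
    exact: lin_eqhom.
  have := linP f; rewrite /IsLinear Ef; exact.
apply: distr_law_eq => X.
have E := act_eq (F X).
rewrite /= canonical_law_funE -E -compA (dlaw_nat O') compA -fmapD.
have -> : mact (F X) ∘ fmap T (eta m X) = idc _ by exact: mu_Teta.
by rewrite fmap1 comp1f.
Qed.
End Monad.
End LiftedStructure.

(** * Modules over the double *)

Section Comparison.
Variables (C : MonCat) (T : Bimonad C).
Local Notation m := (bmon T).
Local Notation com := (bcom T).
Local Notation TC := (ModMonCat (bimonadP T)).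
Local Notation F := (free m : Functor C TC).
Local Notation UT := (forget m : Functor TC C).
Hypothesis leftC : has_left_duals C.
Hypothesis rightC : has_right_duals C.
Hypothesis leftTC : has_left_duals TC.
Hypothesis rightTC : has_right_duals TC.
Variables (Q : Functor TC TC) (cQ : Comonoidal Q) (Z : Centralizer (cross Q)).
Local Notation P := (cross Q).
Local Notation W := (lift_centralizer leftC rightC leftTC rightTC Z).
Local Notation lift_act := (lift_act leftC rightC leftTC rightTC Z).
Local Notation cP := (cross_com cQ).
Variables (mZ : Monad Z) (mW : Monad W).
Hypothesis HZ : IsCentralizerMonad cP mZ.
Hypothesis HW : IsCentralizerMonad cQ mW.
Local Notation O := (canonical_law HZ HW).
Local Notation D := (double O).

Lemma law_lift_act (M : TC) : fmap Z (mact M) ∘ O (mcar M) = lift_act M.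
Proof. exact: canonical_law_act. Qed.

Definition zact (A : Module D) : Hom (Z (mcar A)) (mcar A) :=
  sealed (mact A ∘ fmap Z (eta m (mcar A))).

Lemma zactE (A : Module D) : zact A = mact A ∘ fmap Z (eta m (mcar A)).
Proof. exact: sealedE. Qed.

Lemma double_actM (A : Module D) : mact A ∘ fmap Z (fmap T (mact A))
  = mact A ∘ mu mZ (T (mcar A)) ∘ fmap Z (fmap Z (mu m (mcar A)) ∘ O (T (mcar A))).
Proof. by have := mactM A; rewrite /= /composite_mu => ->; rewrite fmapD !compA. Qed.

Lemma law_unit (X : C) : fmap Z (mu m X) ∘ O (T X) ∘ eta m (Z (T X)) = idc (Z (T X)).
Proof. by rewrite -compA dlaw_etaT -fmapD mu_eta fmap1. Qed.

(** The action of the double is recovered from its restrictions to [T] and [Z], by associativity and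
    the unit laws. *)
Lemma double_act_zact (A : Module D) : zact A ∘ fmap Z (mact A ∘ eta mZ (T (mcar A))) = mact A.
Proof.
rewrite zactE -compA -fmapD (compA (eta m _)) eta_nat -compA fmapD compA double_actM.
rewrite -[LHS]compA -(fmapD Z) (compA _ (eta m _)) law_unit comp1f.
by rewrite -compA mu_Teta compf1.
Qed.

Lemma zactM (A : Module D) : zact A ∘ fmap Z (zact A) = zact A ∘ mu mZ (mcar A).
Proof.
transitivity (mact A ∘ (fmap Z (fmap T (mact A)) ∘ fmap Z (eta m _ ∘ fmap Z (eta m (mcar A))))).
  by rewrite !zactE -compA -!fmapD !compA eta_nat.
rewrite compA double_actM zactE -[RHS]compA -mu_nat -!compA; congr (_ ∘ (_ ∘ _)).
by rewrite -fmapD compA law_unit comp1f.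
Qed.

Lemma zact1 (A : Module D) : zact A ∘ eta mZ (mcar A) = idc (mcar A).
Proof. by rewrite zactE -compA -eta_nat compA; exact: restrict1. Qed.

(** Both sides equal [mact A ∘ O]: the left one by [double_act_zact], the right one because the
    product of the double moves [T] past [Z] with [O]. *)
Lemma zact_lin (A : Module D) :
  @IsLinear C T m (W (restrict A)) (restrict A) (zact A).
Proof.
rewrite /IsLinear /=.
have -> : lift_act (restrict A) = fmap Z (mact A ∘ eta mZ (T (mcar A))) ∘ O (mcar A).
  by rewrite -law_lift_act.
rewrite compA double_act_zact zactE fmapD.
transitivity (mact A ∘ (fmap Z (fmap T (mact A)) ∘ (eta mZ (T (Z (T (mcar A)))) ∘ fmap T (fmap Z (eta m (mcar A)))))); last first.
  by rewrite !compA -(compA _ _ (eta mZ _)) -eta_nat !compA.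
rewrite [RHS]compA double_actM -!compA; congr (_ ∘ _).
rewrite (compA (fmap Z (_ ∘ _))) -(eta_nat mZ) -!compA (dlaw_nat O).
rewrite (compA (mu mZ _)) mu_eta comp1f compA -fmapD mu_Teta.
by rewrite fmap1 comp1f.
Qed.

Definition zact_hom (A : Module D) : @Hom TC (W (restrict A)) (restrict A) :=
  Build_MHom (zact_lin A).

Lemma zact_homM (A : Module D) :
  zact_hom A ∘ fmap W (zact_hom A) = zact_hom A ∘ mu mW (restrict A).
Proof.
apply: lin_eq; rewrite !lin_comp (lin_mu_lift HZ HW); exact: zactM.
Qed.

Lemma zact_hom1 (A : Module D) : zact_hom A ∘ eta mW (restrict A) = idc _.
Proof. apply: lin_eq; rewrite !lin_comp (lin_eta_lift HZ HW); exact: zact1. Qed.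

Lemma sigmaE (A : Module D) (N : TC) :
  sigma A N = lin ((idc (Q N) ⊠ zact_hom A) ∘ zd W (restrict A) N).
Proof.
rewrite lin_comp lin_tensm lin_id lift_zdE zd_modE compA -tensmD comp1f compf1.
by have -> : lin (zact_hom A) = zact A by []; rewrite /sigma zactE.
Qed.

Lemma comparison_wd : ComparisonWellDefined cQ O.
Proof.
have L (A : Module D) (N : TC) :
    @IsLinear C T m (restrict A ⊗ N) (Q N ⊗ restrict A) (sigma A N).
  by rewrite sigmaE; exact: linP.
exists L => A.
apply/half_braidingE.
have B := module_half_braiding leftTC HW (zact_homM A) (zact_hom1 A).
have -> : (fun N => @mor TC (restrict A ⊗ N) (Q N ⊗ restrict A)
      (@Build_MHom C T m (restrict A ⊗ N) (Q N ⊗ restrict A) (sigma A N) (L A N)))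
  = (fun N => (ι (Q N) ⊛ mor (zact_hom A)) • mor (zd W (restrict A) N)); last exact: B.
apply: functional_extensionality_dep => N.
rewrite -mor_id -mor_tens -mor_comp; congr (mor _).
by apply: lin_eq; exact: sigmaE.
Qed.

Local Notation ZC := (CenterCat cQ).

Lemma center_act_exists (X : ZC) : exists r : @Hom TC (W (cob X)) (cob X),
  forall N : TC, mor (hb X N) = (ι (Q N) ⊛ mor r) • mor (zd W (cob X) N).
Proof.
have /half_braidingE Hs := hbP X.
by apply: zd_exists => [N|N N' g]; [ty | exact: (hba_nat Hs)].
Qed.

Definition center_act (X : ZC) : @Hom TC (W (cob X)) (cob X) :=
  proj1_sig (constructive_indefinite_description _ (center_act_exists X)).

Lemma center_actE (X : ZC) (N : TC) :
  mor (hb X N) = (ι (Q N) ⊛ mor (center_act X)) • mor (zd W (cob X) N).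
Proof. by rewrite /center_act; case: constructive_indefinite_description. Qed.

Lemma center_act_module (X : ZC) :
  center_act X ∘ fmap W (center_act X) = center_act X ∘ mu mW (cob X)
  /\ center_act X ∘ eta mW (cob X) = idc _.
Proof.
have /half_braidingE Hs := hbP X.
exact: (half_braiding_module leftTC HW Hs (center_actE X)).
Qed.

Lemma center_act_nat (X Y : ZC) (f : @Hom ZC X Y) :
  chom f ∘ center_act X = center_act Y ∘ fmap W (chom f).
Proof.
apply/linear_braided => N.
rewrite -!center_actE; have := f_equal mor (chomP f N); by unmor.
Qed.

Definition center_zact (X : ZC) : Hom (Z (mcar (cob X))) (mcar (cob X)) :=
  sealed (lin (center_act X)).

Lemma center_zactE (X : ZC) : center_zact X = lin (center_act X).
Proof. exact: sealedE. Qed.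

Lemma center_zactM (X : ZC) :
  center_zact X ∘ fmap Z (center_zact X) = center_zact X ∘ mu mZ (mcar (cob X)).
Proof.
have [E _] := center_act_module X; have := f_equal (@lin _ _ _ _ _) E.
by rewrite !lin_comp (lin_mu_lift HZ HW) center_zactE.
Qed.

Lemma center_zact1 (X : ZC) : center_zact X ∘ eta mZ (mcar (cob X)) = idc _.
Proof.
have [_ E] := center_act_module X; have := f_equal (@lin _ _ _ _ _) E.
by rewrite !lin_comp (lin_eta_lift HZ HW) center_zactE.
Qed.

Lemma center_zact_lin (X : ZC) :
  center_zact X ∘ (fmap Z (mact (cob X)) ∘ O (mcar (cob X)))
  = mact (cob X) ∘ fmap T (center_zact X).
Proof. by rewrite center_zactE law_lift_act; exact: (linP (center_act X)). Qed.

Definition center_dact (X : ZC) : Hom (Z (T (mcar (cob X)))) (mcar (cob X)) :=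
  center_zact X ∘ fmap Z (mact (cob X)).

(** Linearity of [center_zact] exchanges the two actions along [O]; this brings the two [Z] and the
    two [T] together, where their own associativities apply. *)
Lemma center_dactM (X : ZC) :
  center_dact X ∘ fmap (compF Z T) (center_dact X)
  = center_dact X ∘ mu D (mcar (cob X)).
Proof.
rewrite /= /composite_mu /center_dact.
set s := mact (cob X); set p := center_zact X.
transitivity (p ∘ fmap Z (p ∘ (fmap Z s ∘ O (mcar (cob X))) ∘ fmap T (fmap Z s))).
  by rewrite center_zact_lin -/p -/s -compA -fmapD -compA -fmapD.
rewrite -!compA fmapD compA center_zactM -/p -!compA; congr (_ ∘ _).
rewrite (compA (fmap Z s) (mu mZ _)) -(mu_nat mZ) -!compA; congr (_ ∘ _).
rewrite -!fmapD; congr (fmap Z _).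
rewrite (dlaw_nat O) !compA -!fmapD; congr (fmap Z _ ∘ _).
exact: mactM.
Qed.

Lemma center_dact1 (X : ZC) : center_dact X ∘ eta D (mcar (cob X)) = idc _.
Proof.
rewrite /= /composite_eta /center_dact.
rewrite compA -(compA (center_zact X)) -(eta_nat mZ) compA center_zact1 comp1f.
exact: mact1.
Qed.

Definition center_module (X : ZC) : Module D :=
  @Build_Module C (compF Z T) D (mcar (cob X)) (center_dact X)
    (center_dactM X) (center_dact1 X).

Lemma center_module_lin (X Y : ZC) (f : @Hom ZC X Y) :
  @IsLinear C (compF Z T) D (center_module X) (center_module Y) (lin (chom f)).
Proof.
have := f_equal (@lin _ _ _ _ _) (center_act_nat f); rewrite !lin_comp -!center_zactE => E.
rewrite /IsLinear /= /center_dact compA E -!compA; congr (_ ∘ _).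
by rewrite /= -!fmapD (linP (chom f)).
Qed.

Definition center_module_hom (X Y : ZC) (f : @Hom ZC X Y) :
  @Hom (ModCat D) (center_module X) (center_module Y) :=
  @Build_MHom C (compF Z T) D (center_module X) (center_module Y) _ (center_module_lin f).

Definition center_to_modules : Functor ZC (ModCat D).
Proof.
refine (@Build_Functor ZC (ModCat D) center_module center_module_hom _ _).
- abstract (by move=> X; apply: MHom_eq).
- abstract (by move=> X Y V g f; apply: MHom_eq).
Defined.

Variable H : ComparisonWellDefined cQ O.
Local Notation I := (comparison H).

(** Both maps classify the half braiding [sigma]. *)
Lemma center_zact_comparison (A : ModCat D) : center_zact (I A) = zact A.
Proof.
have E : center_act (I A) = zact_hom A.
  apply: (zd_uniq (Z := W)) => N; rewrite -center_actE -mor_id -mor_tens -mor_comp.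
  by congr (mor _); apply: lin_eq; rewrite -sigmaE.
by rewrite center_zactE E.
Qed.

Lemma center_module_comparison (A : ModCat D) : center_module (I A) = A.
Proof.
apply: (@module_eq _ _ D (center_module (I A)) A eq_refl).
rewrite /IsLinear comp1f fmap1 compf1 /= /center_dact center_zact_comparison.
exact: double_act_zact.
Qed.

Lemma restrict_center_module (X : ZC) : restrict (center_module X) = cob X.
Proof.
apply: (@module_eq _ _ m (restrict (center_module X)) (cob X) eq_refl).
rewrite /IsLinear comp1f fmap1 compf1 /= /center_dact.
by rewrite -compA -(eta_nat mZ) compA center_zact1 comp1f.
Qed.

Lemma sigma_center_module (X : ZC) (N : TC) : sigma (center_module X) N = lin (hb X N).
Proof.
have -> : hb X N = (idc (Q N) ⊠ center_act X) ∘ zd W (cob X) N.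
  by apply: mor_inj; rewrite center_actE mor_comp mor_tens.
rewrite lin_comp lin_tensm lin_id lift_zdE zd_modE compA -tensmD comp1f compf1 /sigma.
congr ((_ ⊠ _) ∘ _).
by rewrite /= /center_dact -compA -fmapD mact1 fmap1 compf1 center_zactE.
Qed.

Lemma comparison_center_module (X : ZC) : I (center_module X) = X.
Proof.
apply: (@center_eq _ _ cQ (I (center_module X)) X (restrict_center_module X)) => N.
apply: lin_eq; rewrite !lin_comp !lin_tensm.
have -> : lin (eqhom (restrict_center_module X)) = idc (mcar (cob X)).
  exact: (@lin_eqhom_mod C T (restrict (center_module X)) (cob X) (restrict_center_module X)
    (eq_refl (mcar (cob X)))).
rewrite -[lin (hb X N)]sigma_center_module /= !tensm1 compf1; exact: comp1f.
Qed.

Lemma comparison_iso : IsIsoOfCategories I.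
Proof.
exists center_to_modules; split.
- refine (@functor_eq _ _ (compF center_to_modules I) (idF _) center_module_comparison _) => A B f.
  apply: MHom_eq; rewrite /=.
  rewrite (lin_eqhom (center_module_comparison A) eq_refl).
  rewrite (lin_eqhom (center_module_comparison B) eq_refl) /=.
  by rewrite comp1f compf1.
- refine (@functor_eq _ _ (compF I center_to_modules) (idF _) comparison_center_module _) => X Y f.
  apply: CenterHom_eq; apply: lin_eq; rewrite /=.
  have E (X0 : ZC) : lin (chom (eqhom (comparison_center_module X0))) = idc (mcar (cob X0)).
    exact: (@fmap_eqhom _ _ (compF UT (center_forget cQ)) _ _ (comparison_center_module X0) eq_refl).
  by rewrite !E comp1f compf1.
Qed.

Lemma comparison_forget : compF (forget_center cQ) I = forget D.
Proof.
refine (@functor_eq _ _ (compF (forget_center cQ) I) (forget D) (fun _ => eq_refl) _) => A B f.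
by rewrite /= comp1f compf1.
Qed.
End Comparison.

(** * The monoidal case *)

Section BimonadEquations.
Variables (C : MonCat) (T : Functor C C) (m : Monad T) (c : Comonoidal T).
Hypothesis H : IsBimonad m c.

Lemma com2_mu (X Y : C) :
  com2 c X Y ∘ mu m (X ⊗ Y) = (mu m X ⊠ mu m Y) ∘ (com2 c (T X) (T Y) ∘ fmap T (com2 c X Y)).
Proof. exact: (proj1 (mu_com H)). Qed.

Lemma com0_mu : com0 c ∘ mu m one = com0 c ∘ fmap T (com0 c).
Proof. exact: (proj2 (mu_com H)). Qed.

Lemma com2_eta (X Y : C) : com2 c X Y ∘ eta m (X ⊗ Y) = eta m X ⊠ eta m Y.
Proof. by have := proj1 (eta_com H) X Y; rewrite /= compf1. Qed.

Lemma com0_eta : com0 c ∘ eta m one = idc one.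
Proof. exact: (proj2 (eta_com H)). Qed.
End BimonadEquations.

(** * The bimonad structure of [Q ⋊ T] *)

Section CrossBimonad.
Variables (C : MonCat) (T : Bimonad C).
Local Notation m := (bmon T).
Local Notation com := (bcom T).
Local Notation TC := (ModMonCat (bimonadP T)).
Local Notation F := (free m : Functor C TC).
Variables (Q : Functor TC TC) (cQ : Comonoidal Q) (mQ : Monad Q).
Local Notation P := (cross Q).
Local Notation cP := (cross_com cQ).
Hypothesis HQ : IsBimonad mQ cQ.

Lemma counit_tens (M N : TC) :
  @tensm TC _ _ _ _ (counit m M) (counit m N) ∘ free_com2 T (mcar M) (mcar N) = counit m (M ⊗ N).
Proof. by apply: lin_eq; rewrite lin_comp lin_tensm free_com2E. Qed.

Lemma counit_nat_TC (M N : TC) (f : @Hom TC M N) :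
  @comp TC _ _ _ (counit m N) (fmap F (lin f)) = @comp TC _ _ _ f (counit m M).
Proof. exact: (@counit_nat C T m M N f). Qed.

Lemma cross_muE (X : C) :
  mu (cross_monad mQ) X = lin (mu mQ (F X) ∘ fmap Q (counit m (Q (F X)))).
Proof. by []. Qed.

Lemma cross_etaE (X : C) : eta (cross_monad mQ) X = lin (eta mQ (F X)) ∘ eta m X.
Proof. by []. Qed.

Lemma cross_fmapE (X Y : C) (f : Hom X Y) : fmap (cross Q) f = lin (fmap Q (fmap F f)).
Proof. by []. Qed.

(** Each law is the image of an equation of linear maps, obtained from the law for [Q] and
    naturality of the counit; the two unit laws also use that the unit of [T] is comonoidal. *)
Lemma cross_bimonad : IsBimonad (cross_monad mQ) (cross_com cQ).
Proof.
split; split.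
- move=> X Y.
  have E : com2 cQ (F X) (F Y) ∘ fmap Q (free_com2 T X Y) ∘ (mu mQ (F (X ⊗ Y)) ∘ fmap Q (counit m (Q (F (X ⊗ Y)))))
    = ((mu mQ (F X) ∘ fmap Q (counit m (Q (F X)))) ⊠ (mu mQ (F Y) ∘ fmap Q (counit m (Q (F Y)))))
      ∘ (com2 cQ (F (cross Q X)) (F (cross Q Y)) ∘ fmap Q (free_com2 T (cross Q X) (cross Q Y))
         ∘ fmap Q (fmap F (lin (com2 cQ (F X) (F Y) ∘ fmap Q (free_com2 T X Y))))).
    rewrite tensmD -!compA (compA (fmap Q _ ⊠ fmap Q _)) -com2_nat.
    rewrite -!compA -!fmapD (compA (@tensm TC _ _ _ _ (counit m (Q (F X))) (counit m (Q (F Y))))) counit_tens.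
    rewrite (counit_nat_TC (com2 cQ (F X) (F Y) ∘ fmap Q (free_com2 T X Y))).
    rewrite (compA (fmap Q (free_com2 _ _ _))) -mu_nat -!compA [LHS]compA.
    rewrite (com2_mu HQ).
    by rewrite !fmapD !compA.
  have E2 : com2 (Comonoidal_comp cP cP) X Y = com2 cP (P X) (P Y) ∘ fmap P (com2 cP X Y).
    reflexivity.
  rewrite {}E2.
  rewrite !cross_com2E.
  rewrite cross_fmapE.
  rewrite !cross_muE.
  rewrite -(lin_comp (com2 cQ (F (P X)) (F (P Y)) ∘ fmap Q (free_com2 T (P X) (P Y)))).
  rewrite -lin_tensm.
  rewrite -(lin_comp (com2 cQ (F X) (F Y) ∘ fmap Q (free_com2 T X Y))).
  exact: (f_equal (@lin _ _ _ _ _) E).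
- have E : com0 cQ ∘ fmap Q (counit m (one : TC)) ∘ (mu mQ (F one) ∘ fmap Q (counit m (Q (F one))))
    = com0 cQ ∘ fmap Q (counit m (one : TC)) ∘ fmap Q (fmap F (lin (com0 cQ ∘ fmap Q (counit m (one : TC))))).
    rewrite -!compA -!fmapD counit_nat_TC [LHS]compA -[LHS]compA (compA (fmap Q (counit _ _)) (mu mQ _)) -mu_nat -!compA [LHS]compA.
    rewrite (com0_mu HQ).
    by rewrite !fmapD !compA.
  exact: (f_equal (@lin _ _ _ _ _) E).
- move=> X Y.
  have E : com2 cQ (F X) (F Y) ∘ fmap Q (free_com2 T X Y) ∘ eta mQ (F (X ⊗ Y))
    = (eta mQ (F X) ⊠ eta mQ (F Y)) ∘ free_com2 T X Y.
    by rewrite -compA -eta_nat compA (com2_eta HQ).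
  have {}E : lin (com2 cQ (F X) (F Y) ∘ fmap Q (free_com2 T X Y)) ∘ lin (eta mQ (F (X ⊗ Y)))
    = (lin (eta mQ (F X)) ⊠ lin (eta mQ (F Y))) ∘ com2 com X Y.
    by rewrite -free_com2E -lin_tensm -!lin_comp E.
  rewrite cross_com2E !cross_etaE compf1 compA.
  rewrite [X in X ∘ _]E tensmD -compA; congr (_ ∘ _).
  exact: (com2_eta (bimonadP T)).
- have E : com0 cQ ∘ fmap Q (counit m (one : TC)) ∘ eta mQ (F one) = counit m (one : TC).
    by rewrite -compA -eta_nat compA (com0_eta HQ) comp1f.
  have := f_equal (@lin _ _ _ _ _) E; rewrite !lin_comp => {}E.
  rewrite cross_com0E cross_etaE lin_comp compA [X in X ∘ _]E.
  exact: (com0_eta (bimonadP T)).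
Qed.
End CrossBimonad.

Section LinHalfBraidings.
Variables (C : MonCat) (T : Bimonad C).
Local Notation m := (bmon T).
Local Notation TC := (ModMonCat (bimonadP T)).

Lemma lin_hb_comp (M N K K2 K3 K4 : TC) (u : @Hom TC K3 K4)
    (s : @Hom TC (M ⊗ K2) (K3 ⊗ M)) (t : @Hom TC (N ⊗ K) (K2 ⊗ N)) :
  mor (lin ((u ⊠ idc (M ⊗ N)) ∘ (asc K3 M N ∘ (s ⊠ idc N) ∘ asc' M K2 N ∘ (idc M ⊠ t) ∘ asc M N K)))
  = (mor (lin u) ⊛ ι (mcar M) ⊛ ι (mcar N)) • (mor (lin s) ⊛ ι (mcar N))
    • (ι (mcar M) ⊛ mor (lin t)).
Proof.
rewrite !lin_comp !lin_tensm !lin_asc !lin_id.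
rewrite (lin_eqhom_mod (eq_sym (tensA M K2 N)) (eq_sym (tensA (mcar M) (mcar K2) (mcar N)))).
by unmor; flat; drop_id.
Qed.

Lemma lin_hb_unit (K K2 : TC) (v : @Hom TC K K2) :
  mor (lin ((v ⊠ idc one) ∘ (run' K ∘ lun K))) = mor (lin v).
Proof.
rewrite !lin_comp !lin_tensm lin_lun !lin_id.
rewrite (lin_eqhom_mod (eq_sym (tens1r K)) (eq_sym (tens1r (mcar K)))).
by unmor; flat; drop_id.
Qed.

Lemma center_eq_lin (Q : Functor TC TC) (cQ : Comonoidal Q) (X Y : CenterOb cQ)
    (e : cob X = cob Y) (e' : mcar (cob X) = mcar (cob Y)) :
  (forall K : TC, (idc (mcar (Q K)) ⊠ eqhom e') ∘ lin (hb X K) = lin (hb Y K) ∘ (eqhom e' ⊠ idc (mcar K))) ->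
  X = Y.
Proof.
move=> E; apply: (@center_eq _ _ cQ X Y e) => K.
by apply: lin_eq; rewrite !lin_comp !lin_tensm (lin_eqhom_mod e e') !lin_id E.
Qed.
End LinHalfBraidings.

(** * The double as a bimonad, and strictness of the comparison functor *)

Section DoubleBimonad.
Variables (C : MonCat) (T : Bimonad C).
Local Notation m := (bmon T).
Local Notation com := (bcom T).
Local Notation TC := (ModMonCat (bimonadP T)).
Local Notation F := (free m : Functor C TC).
Local Notation UT := (forget m : Functor TC C).
Hypothesis leftC : has_left_duals C.
Hypothesis rightC : has_right_duals C.
Hypothesis leftTC : has_left_duals TC.
Hypothesis rightTC : has_right_duals TC.
Variables (Q : Functor TC TC) (cQ : Comonoidal Q) (Z : Centralizer (cross Q)).
Local Notation P := (cross Q).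
Local Notation W := (lift_centralizer leftC rightC leftTC rightTC Z).
Local Notation lift_act := (lift_act leftC rightC leftTC rightTC Z).
Local Notation cP := (cross_com cQ).
Variables (mZ : Monad Z) (mW : Monad W).
Hypothesis HZ : IsCentralizerMonad cP mZ.
Hypothesis HW : IsCentralizerMonad cQ mW.
Local Notation O := (canonical_law HZ HW).
Local Notation D := (double O).
Variables (mQ : Monad Q) (HQ : IsBimonad mQ cQ).
Variables (cZ : Comonoidal Z) (cW : Comonoidal W).
Hypothesis HcZ : IsCentralizerComonoidal (cross_monad mQ) cZ.
Hypothesis HcW : IsCentralizerComonoidal mQ cW.
Hypothesis BZ : IsBimonad mZ cZ.

Lemma lift_com2_zd_mod (M N K : TC) :
  (ι (mcar (Q K)) ⊛ mor (lin (com2 cW M N))) • mor (zd_mod Z (mcar M ⊗ mcar N) K)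
  = (mor (lin (mu mQ K)) ⊛ ι (Z (mcar M)) ⊛ ι (Z (mcar N)))
    • (mor (zd_mod Z (mcar M) (Q K)) ⊛ ι (Z (mcar N))) • (ι (mcar M) ⊛ mor (zd_mod Z (mcar N) K)).
Proof.
have [E _] := HcW; have := f_equal (@lin _ _ _ _ _) (E M N K).
rewrite !lin_comp !lin_tensm !lin_asc (lin_eqhom_mod (eq_sym (tensA M (Q K) (W N))) (eq_sym (tensA (mcar M) (mcar (Q K)) (Z (mcar N))))).
rewrite !lift_zdE !lin_id.
move: (lin (com2 cW M N) : Hom (Z (mcar M ⊗ mcar N)) (Z (mcar M) ⊗ Z (mcar N))) => c2.
move=> /(f_equal mor) {}E.
transitivity (mor ((idc (mcar (Q K)) ⊠ c2) ∘ zd_mod Z (mcar M ⊗ mcar N) K)).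
  by unmor.
rewrite [LHS]E; unmor; flat; drop_id. done.
Qed.

Lemma lift_com0_zd_mod (K : TC) :
  (ι (mcar (Q K)) ⊛ mor (lin (com0 cW))) • mor (zd_mod Z one K) = mor (lin (eta mQ K)).
Proof.
have [_ E] := HcW; have := f_equal (@lin _ _ _ _ _) (E K).
rewrite !lin_comp !lin_tensm lin_lun (lin_eqhom_mod (eq_sym (tens1r (Q K))) (eq_sym (tens1r (mcar (Q K))))).
rewrite !lift_zdE !lin_id.
move: (lin (com0 cW) : Hom (Z one) one) => c0.
move=> /(f_equal mor) {}E.
transitivity (mor ((idc (mcar (Q K)) ⊠ c0) ∘ zd_mod Z one K)).
  by unmor.
rewrite [LHS]E; unmor; flat; drop_id. done.
Qed.

(** Again restriction at free modules: [zd_mod] at [Q (F Y)] contains [Q] of the counit, which with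
    the product of [Q] is the product of [Q ⋊ T]. *)
Lemma lin_com2_lift (M N : TC) : lin (com2 cW M N) = com2 cZ (mcar M) (mcar N).
Proof.
apply: (zd_uniq (Z := Z)) => Y.
have [E _] := HcZ; have := f_equal mor (E (mcar M) (mcar N) Y); unmor => ->.
have := f_equal (fun x => x • (ι (mcar M) ⊛ ι (mcar N) ⊛ mor (eta m Y))) (lift_com2_zd_mod M N (F Y)).
have H1 := f_equal mor (zd_mod_free Z (mcar M ⊗ mcar N) Y).
have H2 := f_equal mor (zd_mod_free Z (mcar N) Y).
have H3 := f_equal mor (zd_modE Z (mcar M) (Q (F Y))).
move: H1 H2 H3; unmor; rewrite !id_tens !atensA => H1 H2 H3.
rewrite -[LHS]acompA H1 => {}E.
rewrite [LHS]E; flat; drop_id. srew H2. srew H3.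
by flat.
Qed.

Lemma lin_com0_lift : lin (com0 cW) = com0 cZ.
Proof.
apply: (zd_uniq (Z := Z)) => Y.
have [_ E] := HcZ; have := f_equal mor (E Y); unmor => ->.
have := f_equal (fun x => x • (ι one ⊛ mor (eta m Y))) (lift_com0_zd_mod (F Y)).
have H1 := f_equal mor (zd_mod_free Z one Y).
move: H1; unmor => H1; rewrite -[LHS]acompA H1 => {}E.
rewrite [LHS]E; flat; drop_id. done.
Qed.

Lemma lift_act_com2 (M N : TC) :
  com2 cZ (mcar M) (mcar N) ∘ lift_act (M ⊗ N)
  = (lift_act M ⊠ lift_act N) ∘ com2 com (Z (mcar M)) (Z (mcar N)) ∘ fmap T (com2 cZ (mcar M) (mcar N)).
Proof. by have := linP (com2 cW M N); rewrite /IsLinear lin_com2_lift. Qed.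

Lemma lift_act_com0 : com0 cZ ∘ lift_act one = com0 com ∘ fmap T (com0 cZ).
Proof. by have := linP (com0 cW); rewrite /IsLinear lin_com0_lift. Qed.

(** The comonoidal structure of [W] is linear at [F X] and [F Y]; moving this along the linear map
    [free_com2] and restricting to generators gives compatibility of the law with [Z_2] and
    [T_2]. *)
Lemma law_com2 (X Y : C) :
  com2 cZ (T X) (T Y) ∘ fmap Z (com2 com X Y) ∘ O (X ⊗ Y)
  = (O X ⊠ O Y) ∘ com2 com (Z X) (Z Y) ∘ fmap T (com2 cZ X Y).
Proof.
have E : fmap Z (com2 com X Y) ∘ lift_act (F (X ⊗ Y)) = lift_act (F X ⊗ F Y) ∘ fmap T (fmap Z (com2 com X Y)).
  have E := lift_act_nat leftC rightC leftTC rightTC Z (free_com2 T X Y).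
  by rewrite free_com2E in E; exact: E.
have E2 := lift_act_com2 (F X) (F Y).
have OE (V : C) : O V = lift_act (F V) ∘ fmap T (fmap Z (eta m V)) by exact: canonical_law_funE.
transitivity (com2 cZ (T X) (T Y) ∘ (lift_act (F X ⊗ F Y) ∘ fmap T (fmap Z (eta m X ⊠ eta m Y)))).
  by rewrite OE -(com2_eta (bimonadP T)) !fmapD -!compA (compA (fmap Z _)) E -!compA.
rewrite compA [X in X ∘ _ = _]E2 -[LHS]compA -fmapD com2_nat fmapD -[LHS]compA.
rewrite (compA (com2 com _ _)) com2_nat !OE tensmD -!compA. by [].
Qed.

Lemma law_com0 : com0 cZ ∘ fmap Z (com0 com) ∘ O one = com0 com ∘ fmap T (com0 cZ).
Proof.
have E := law_lift_act HZ HW (one : TC).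
by rewrite -compA [X in _ ∘ X]E lift_act_com0.
Qed.

(** The product of the double is that of [Z] after [Z] of [Z (mu) ∘ O]; this treats the inner
    factor, by [law_com2] and comonoidality of [mu]. *)
Lemma law_mu_com2 (X Y : C) :
  com2 cZ (T X) (T Y) ∘ fmap Z (com2 com X Y) ∘ (fmap Z (mu m (X ⊗ Y)) ∘ O (T (X ⊗ Y)))
  = (fmap Z (mu m X) ⊠ fmap Z (mu m Y)) ∘ ((O (T X) ⊠ O (T Y))
    ∘ (com2 com (Z (T X)) (Z (T Y)) ∘ fmap T (com2 cZ (T X) (T Y) ∘ fmap Z (com2 com X Y)))).
Proof.
have BT := bimonadP T.
transitivity (com2 cZ (T X) (T Y) ∘ fmap Z (mu m X ⊠ mu m Y)
  ∘ (fmap Z (com2 com (T X) (T Y)) ∘ (fmap Z (fmap T (com2 com X Y)) ∘ O (T (X ⊗ Y))))).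
  by rewrite -!compA; congr (_ ∘ _); rewrite !compA -!fmapD (com2_mu BT) !compA.
rewrite com2_nat -(dlaw_nat O) -!compA; congr (_ ∘ _).
have L := law_com2 (T X) (T Y).
by rewrite !compA L fmapD !compA.
Qed.

Lemma law_mu_com0 :
  com0 cZ ∘ fmap Z (com0 com) ∘ (fmap Z (mu m one) ∘ O (T one))
  = com0 com ∘ fmap T (com0 cZ ∘ fmap Z (com0 com)).
Proof.
transitivity (com0 cZ ∘ fmap Z (com0 com) ∘ (fmap Z (fmap T (com0 com)) ∘ O (T one))).
  by rewrite -!compA; congr (_ ∘ _); rewrite !compA -!fmapD (com0_mu (bimonadP T)).
by rewrite -(dlaw_nat O) !compA law_com0 fmapD !compA.
Qed.

Lemma double_bimonad : IsBimonad D (Comonoidal_comp cZ com).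
Proof.
have BT := bimonadP T.
split; split.
- move=> X Y.
  transitivity (com2 cZ (T X) (T Y) ∘ fmap Z (com2 com X Y) ∘ (mu mZ (T (X ⊗ Y))
    ∘ fmap Z (fmap Z (mu m (X ⊗ Y)) ∘ O (T (X ⊗ Y))))).
    by rewrite fmapD /= /composite_mu !compA.
  transitivity ((mu mZ (T X) ⊠ mu mZ (T Y)) ∘ com2 cZ (Z (T X)) (Z (T Y))
    ∘ fmap Z (com2 cZ (T X) (T Y) ∘ fmap Z (com2 com X Y) ∘ (fmap Z (mu m (X ⊗ Y)) ∘ O (T (X ⊗ Y))))).
    rewrite !fmapD -!compA (compA (fmap Z (com2 com X Y)) (mu mZ _)) -(mu_nat mZ).
    by rewrite -!compA (compA (com2 cZ _ _) (mu mZ _)) (com2_mu BZ) -!compA.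
  rewrite law_mu_com2 fmapD -!compA (compA (com2 cZ _ _)) com2_nat.
  rewrite fmapD -!compA (compA (com2 cZ _ _)) com2_nat !compA -!tensmD.
  by rewrite fmapD [LHS]compA.
- transitivity (com0 cZ ∘ fmap Z (com0 com) ∘ (mu mZ (T one)
    ∘ fmap Z (fmap Z (mu m one) ∘ O (T one)))).
    by rewrite fmapD /= /composite_mu !compA.
  transitivity (com0 cZ ∘ fmap Z (com0 cZ ∘ fmap Z (com0 com) ∘ (fmap Z (mu m one) ∘ O (T one)))).
    rewrite !fmapD -!compA (compA (fmap Z (com0 com)) (mu mZ _)) -(mu_nat mZ).
    by rewrite -!compA (compA (com0 cZ) (mu mZ _)) (com0_mu BZ) -!compA.
  by rewrite law_mu_com0 fmapD [LHS]compA.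
- move=> X Y; rewrite /= /composite_eta compf1.
  rewrite -!compA (compA (fmap Z _) (eta mZ _)) -(eta_nat mZ) -!compA.
  by rewrite (com2_eta BT) compA (com2_eta BZ) -tensmD.
- rewrite /= /composite_eta.
  rewrite -!compA (compA (fmap Z _) (eta mZ _)) -(eta_nat mZ) -!compA.
  by rewrite (com0_eta BT) compf1 (com0_eta BZ).
Qed.

Variable HD : IsBimonad D (Comonoidal_comp cZ com).
Variable H : ComparisonWellDefined cQ O.
Local Notation MD := (ModMonCat HD).
Local Notation ZC := (CenterMonCat HQ).
Local Notation I := (comparison H : Functor MD ZC).

Lemma restrict_tens (A B : MD) :
  restrict (A ⊗ B : MD) = (restrict A : TC) ⊗ restrict B :> TC.
Proof.
apply: (@module_eq _ _ m (restrict (A ⊗ B : MD)) (@tens TC (restrict A) (restrict B)) eq_refl).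
rewrite /IsLinear comp1f fmap1 compf1 /=.
rewrite -!compA -(eta_nat mZ) (compA (com2 cZ _ _)) (com2_eta BZ) !compA -tensmD.
by [].
Qed.

Lemma restrict_one : restrict (one : MD) = one :> TC.
Proof.
apply: (@module_eq _ _ m (restrict (one : MD)) (one : TC) eq_refl).
rewrite /IsLinear comp1f fmap1 compf1 /=.
by rewrite -!compA -(eta_nat mZ) compA (com0_eta BZ) comp1f.
Qed.

Lemma zact_tens (A B : MD) :
  zact (A ⊗ B : MD) = (zact A ⊠ zact B) ∘ com2 cZ (mcar A) (mcar B).
Proof.
rewrite !zactE /= tensmD -!compA -com2_nat -!fmapD; congr (_ ∘ (_ ∘ fmap Z _)).
exact: (com2_eta (bimonadP T)).
Qed.

Lemma zact_one : zact (one : MD) = com0 cZ.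
Proof. by rewrite zactE /= -compA -fmapD (com0_eta (bimonadP T)) fmap1 compf1. Qed.

Lemma sigma_zd_mod (A : Module D) (K : TC) :
  sigma A K = (idc _ ⊠ zact A) ∘ zd_mod Z (mcar A) K.
Proof. by rewrite /sigma zactE zd_modE compA -tensmD comp1f compf1. Qed.

(** [Z] acts on a tensor product by [zact A ⊠ zact B] after [Z_2], and the equation defining [Z_2]
    has the shape of the tensor product of half braidings. *)
Lemma sigma_tens (A B : MD) (K : TC) :
  mor (sigma (A ⊗ B : MD) K) = (mor (lin (mu mQ K)) ⊛ ι (mcar A) ⊛ ι (mcar B))
    • (mor (sigma A (Q K)) ⊛ ι (mcar B)) • (ι (mcar A) ⊛ mor (sigma B K)).
Proof.
rewrite !sigma_zd_mod zact_tens -(lin_com2_lift (restrict A) (restrict B)).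
have := lift_com2_zd_mod (restrict A) (restrict B) K.
move: (lin (com2 cW (restrict A) (restrict B)) : Hom (Z (mcar A ⊗ mcar B)) (Z (mcar A) ⊗ Z (mcar B))) (lin (mu mQ K)) => c2 u E.
transitivity ((ι (mcar (Q K)) ⊛ mor (zact A) ⊛ mor (zact B)) • ((ι (mcar (Q K)) ⊛ mor c2) • mor (zd_mod Z (mcar A ⊗ mcar B) K))).
  by unmor; flat.
rewrite [X in _ • X]E (tens_slices (typed_mor (zact A)) (typed_mor (zact B))).
unmor; flat; drop_id.
exchange (mor u) (mor (zact B)).
exchange (mor (zd_mod Z (mcar A) (Q K))) (mor (zact B)).
exchange (mor u) (mor (zact A)). done.
Qed.

Lemma lin_hb_tens (X Y : ZC) (K : TC) :
  mor (lin (hb (X ⊗ Y : ZC) K)) = (mor (lin (mu mQ K)) ⊛ ι (mcar (cob X)) ⊛ ι (mcar (cob Y)))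
    • (mor (lin (hb X (Q K))) ⊛ ι (mcar (cob Y))) • (ι (mcar (cob X)) ⊛ mor (lin (hb Y K))).
Proof. exact: (lin_hb_comp (mu mQ K) (hb X (Q K)) (hb Y K)). Qed.

Lemma lin_hb_one (K : TC) : mor (lin (hb (one : ZC) K)) = mor (lin (eta mQ K)).
Proof. exact: (lin_hb_unit (eta mQ K)). Qed.

Lemma comparison_tens (A B : MD) : I (A ⊗ B) = I A ⊗ I B :> ZC.
Proof.
(* The carriers are convertible, so [eq_refl] relates them and only the half braidings remain to be
   compared. *)
refine (@center_eq_lin C T Q cQ (I (A ⊗ B)) (I A ⊗ I B : ZC) (restrict_tens A B)
  (eq_refl (mcar A ⊗ mcar B)) _) => K.
have El : idc (mcar (Q K)) ⊠ eqhom (eq_refl (mcar A ⊗ mcar B)) = idc _ by exact: tensm1.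
have Er : eqhom (eq_refl (mcar A ⊗ mcar B)) ⊠ idc (mcar K) = idc _ by exact: tensm1.
rewrite [X in X ∘ _ = _]El [X in _ = _ ∘ X]Er.
transitivity (lin (hb (I A ⊗ I B : ZC) K)); last exact: (eq_sym (compf1 _)).
transitivity (sigma (A ⊗ B : MD) K); first exact: comp1f.
apply: mor_inj.
exact: (eq_trans (sigma_tens A B K) (eq_sym (lin_hb_tens (I A) (I B) K))).
Qed.

Lemma comparison_one : I one = one :> ZC.
Proof.
refine (@center_eq_lin C T Q cQ (I one) (one : ZC) restrict_one (eq_refl one) _) => K.
have El : idc (mcar (Q K)) ⊠ eqhom (eq_refl one) = idc _ by exact: tensm1.
have Er : eqhom (eq_refl one) ⊠ idc (mcar K) = idc _ by exact: tensm1.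
rewrite [X in X ∘ _ = _]El [X in _ = _ ∘ X]Er.
transitivity (lin (hb (one : ZC) K)); last exact: (eq_sym (compf1 _)).
transitivity (sigma (one : MD) K); first exact: comp1f.
apply: mor_inj; apply: (eq_trans _ (eq_sym (lin_hb_one K))).
by rewrite -lift_com0_zd_mod lin_com0_lift sigma_zd_mod zact_one mor_comp.
Qed.

Lemma lin_chom_eqhom (X Y : ZC) (e : X = Y) (e' : mcar (cob X) = mcar (cob Y)) :
  lin (chom (eqhom e)) = eqhom e'.
Proof. exact: (@fmap_eqhom ZC C (compF UT (center_forget cQ)) X Y e e'). Qed.

Lemma comparison_strict : StrictMonoidal I.
Proof.
refine (@Build_StrictMonoidal MD ZC I comparison_tens comparison_one _).
move=> A A' B B' f g; apply: CenterHom_eq; apply: lin_eq.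
have E := lin_chom_eqhom (comparison_tens A B) (eq_refl (mcar A ⊗ mcar B)).
have E' := lin_chom_eqhom (comparison_tens A' B') (eq_refl (mcar A' ⊗ mcar B')).
transitivity (lin (chom (eqhom (comparison_tens A' B'))) ∘ (lin f ⊠ lin g)); first by [].
transitivity ((lin f ⊠ lin g) ∘ lin (chom (eqhom (comparison_tens A B)))); last by [].
rewrite [X in X ∘ _ = _]E' [X in _ = _ ∘ X]E.
exact: (eq_trans (comp1f _) (eq_sym (compf1 _))).
Qed.
End DoubleBimonad.

(** Strict monoidality is a proposition, so equality as monoidal functors reduces to equality as
    functors. *)
Lemma strict_functor_eq (A B : MonCat) (F G : StrictFunctor A B) : sfun F = sfun G -> F = G.
Proof.
case: F => F HF; case: G => G HG /= E; case: _ / E HG => HG.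
by rewrite (proof_irrelevance _ HF HG).
Qed.

Lemma autonomous_left_duals (C : AutonomousCategory) : has_left_duals C.
Proof. by move=> X; exists (ldual X), (ev X), (coev X); exact: ldual_pair. Qed.

Lemma autonomous_right_duals (C : AutonomousCategory) : has_right_duals C.
Proof. by move=> X; exists (rdual X), (rev X), (rcoev X); exact: rdual_pair. Qed.

Theorem theorem7p6 (C : AutonomousCategory) (T : HopfMonad C)
    (Q : Functor (ModMonCat (bimonadP T)) (ModMonCat (bimonadP T)))
    (cQ : Comonoidal Q) (Z : Centralizer (cross Q)) :
  exists mZ : Monad Z, unique (@IsCentralizerMonad C _ (cross_com cQ) Z) mZ /\
  exists O : DistrLaw (bmon T) mZ, unique (@IsCanonicalLaw C T Q Z mZ) O /\
  exists H : ComparisonWellDefined cQ O,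
    let D : Monad (compF Z T) := double O in
    let I : Functor (ModCat D) (CenterCat cQ) := comparison H in
    IsIsoOfCategories I
    /\ compF (forget_center cQ) I = forget D
    /\ forall (mQ : Monad Q) (HQ : IsBimonad mQ cQ),
       exists cZ : Comonoidal Z,
         unique (@IsCentralizerComonoidal C _ (cross_monad mQ) Z) cZ /\
       exists HD : IsBimonad D (Comonoidal_comp cZ (bcom T)),
       exists HI : StrictMonoidal (I : Functor (ModMonCat HD) (CenterMonCat HQ)),
         strict_comp (forget_centerS HQ) (Build_StrictFunctor HI) = forgetS HD.
Proof.
have lC := @autonomous_left_duals C; have rC := @autonomous_right_duals C.
have lTC := modules_left_duals (T := T); have rTC := modules_right_duals (T := T).
pose W := lift_centralizer lC rC lTC rTC Z.
have HZ := centralizer_monadP lC (cross_com cQ) Z.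
have HW := centralizer_monadP lTC cQ W.
exists (centralizer_monad lC (cross_com cQ) Z); split.
  by split; [exact: HZ | exact: centralizer_monad_uniq].
exists (canonical_law HZ HW); split.
  by split; [exact: canonical_lawP | exact: canonical_law_uniq].
exists (comparison_wd HZ HW) => D I; split; first exact: comparison_iso.
split; first exact: comparison_forget.
move=> mQ HQ.
have HP := cross_bimonad HQ.
have HcZ := centralizer_comP lC HZ HP.
have HcW := centralizer_comP lTC HW HQ.
have BZ := centralizer_bimonad lC HZ HP.
exists (centralizer_com lC HZ HP); split.
  by split; [exact: HcZ | exact: centralizer_com_uniq].
have HD := double_bimonad HZ HW HcZ HcW BZ.
exists HD.
exists (comparison_strict HQ HcZ HcW BZ HD (comparison_wd HZ HW)).
apply: strict_functor_eq.
refine (@functor_eq (ModMonCat HD) C (compF (compF (forget (bmon T)) (center_forget cQ)) I)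
  (forget D) (fun A => eq_refl (mcar A)) _) => A B f.
exact: (eq_trans (comp1f _) (eq_sym (compf1 _))).
Qed.
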